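(* There exist absolute constants $C_2, C_3, C_4 > 0$ such that the following holds for every positive integer $k$ and every directed graph $G$. Let $p \in \{2,3,4\}$ and suppose that $G$ does not contain a family of $k$ directed cycles such that every vertex of $G$ is contained in at most $p$ of the cycles. (a) If $p=4$, then $\mathrm{dtw}(G) \le C_4 k^3$. (b) If $p=3$, then $\mathrm{dtw}(G) \le C_3 k^4$. (c) If $p=2$, then $\mathrm{dtw}(G) \le C_2 k^5$.
   Context: $\mathrm{dtw}(G)$ denotes the directed treewidth of $G$ (in the standard sense of Johnson, Robertson, Seymour and Thomas). The family of cycles is a multiset: a vertex lying on several cycles of the family (counted with multiplicity) is counted for each of them. *)

(* Defs.v *)
From mathcomp Require Import all_boot.
Set Implicit Arguments. Unset Strict Implicit. Unset Printing Implicit Defensive.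

(* A digraph is (T : finType, e : rel T); e x y means an arc x -> y. *)

Definition directed_cycle (T : finType) (e : rel T) (c : seq T) : Prop :=
  [/\ c != [::], uniq c & cycle e c].

(* G contains a family (multiset, given as a list) of k directed cycles such
   that every vertex lies in at most p of them (counted with multiplicity). *)
Definition has_cycle_family (T : finType) (e : rel T) (k p : nat) : Prop :=
  exists F : seq (seq T),
    [/\ size F = k, (forall c, c \in F -> directed_cycle e c)
      & forall v : T, count (fun c => v \in c) F <= p].

(* Z is X-guarded (JRST "X-normal"): Z and X are disjoint, and there is no
   directed walk in G - X with first and last vertices in Z that uses a
   vertex of G - (Z u X). *)
Definition guarded (T : finType) (e : rel T) (X Z : {set T}) : Prop :=
  [disjoint Z & X] /\
  forall z1 z2 v : T, z1 \in Z -> z2 \in Z -> v \notin Z -> v \notin X ->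
    let eX := [rel x y | [&& e x y, x \notin X & y \notin X]] in
    connect eX z1 v -> connect eX v z2 -> False.

(* Arboreal decomposition (Johnson-Robertson-Seymour-Thomas) of width <= w.
   The arborescence R has node set N, root r and parent map par (par r = r,
   every node reaches r by iterating par); its arcs are (par t, t), t != r.
   The guard of the arc entering t (t != r) is X t; the bag of t is W t. *)
Definition arboreal_decomposition_of_width (T : finType) (e : rel T)
    (N : finType) (r : N) (par : N -> N) (X W : N -> {set T}) (w : nat) : Prop :=
  par r = r /\
      (forall t, fconnect par t r) /\
      (forall t, W t != set0) /\
      (forall v, exists t, v \in W t) /\
      (forall t1 t2 v, v \in W t1 -> v \in W t2 -> t1 = t2) /\
      (forall t, t != r ->
         guarded e (X t) [set v | [exists t', (v \in W t') && fconnect par t' t]]) /\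
      (forall t,
         #|W t :|: (if t != r then X t else set0)
              :|: \bigcup_(c | (par c == t) && (c != r)) X c| <= w.+1).

(* dtw(G) <= w.  The empty digraph has directed treewidth 0 by convention. *)
Definition dtw_le (T : finType) (e : rel T) (w : nat) : Prop :=
  #|T| = 0 \/
  exists (N : finType) (r : N) (par : N -> N) (X W : N -> {set T}),
    arboreal_decomposition_of_width e r par X W w.

(* Main.v *)
Require Import Defs.
From mathcomp Require Import all_boot.
From mathcomp Require Import zify.

(* Let [G] be a digraph of large directed treewidth.  A recursive construction
   of an arboreal decomposition with singleton bags can only fail at a set [S]
   such that, for every small [X], some strong component of [G - X] contains
   more than half of [S]; these components form a bramble whose elements
   pairwise intersect.  A path [P] meeting all of them is found greedily.  The
   minimum number of vertices needed to cut a set off from the bramble, in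
   either direction, is a matroid rank function, and matroid intersection gives
   a subset of [P] of linear size that is independent in both matroids; by
   Menger's theorem it is well linked.

   Cut [P] into [2 k] pieces and link the second half of each piece back to the
   first half.  If few pairs of paths of different linkages meet, averaging
   yields [k] disjoint back paths, hence [k] cycles of congestion 2.  Otherwise
   two of the linkages, [L] and [K], meet densely.  Close them up by further
   linkages:
   - congestion 4: [L], [S], [K], [S'] form a closed system of walks; cutting
     it into intervals, two intervals that meet often must meet in inverted
     order, which gives a cycle, and a maximal matching of such pairs has
     at least [k] edges;
   - congestion 3: after passing to a subgraph of large minimum degree, the
     walks made of a path of [L], a link and a path of [K] form a digraph of
     large minimum degree, in which a random [k]-colouring gives [k] disjoint
     cycles;
   - congestion 2: [L] and [K] are each closed up by a return linkage and cut
     into intervals; by the congestion-4 argument the intervals of one system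
     can be coloured with O(k) colours such that intervals of equal colour are
     disjoint, and some pair of colours contains [k] disjoint pairs of
     intervals that meet in inverted order. *)

Set Implicit Arguments. Unset Strict Implicit. Unset Printing Implicit Defensive.

(** * Strong components of a digraph with a vertex set removed *)

Section Induced.
Variables (T : finType) (e : rel T).
Implicit Types (Q X Y Z C : {set T}) (x y z u v : T).

Definition induced Q : rel T := [rel x y | [&& e x y, x \in Q & y \in Q]].

Lemma connect_induced_sub Q1 Q2 x y :
  Q1 \subset Q2 -> connect (induced Q1) x y -> connect (induced Q2) x y.
Proof.
move=> sQ; apply: connect_sub => u v /and3P[euv uQ vQ]; apply: connect1.
by rewrite /induced /= euv !(subsetP sQ).
Qed.

Lemma connect_induced_mem Q x y :
  connect (induced Q) x y -> x != y -> (x \in Q) && (y \in Q).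
Proof.
case/connectP=> p pth ->; case: p pth => [|w p] /=; first by rewrite eqxx.
case/andP=> /and3P[_ -> wQ] pth _ /=.
by elim: p w wQ pth => //= z p IH w _ /andP[/and3P[_ _ zQ] /(IH _ zQ)].
Qed.

Lemma connect_induced_end Q x y : connect (induced Q) x y -> x \in Q -> y \in Q.
Proof.
have [-> //|nxy] := eqVneq x y.
by move=> c _; case/andP: (connect_induced_mem c nxy).
Qed.

Lemma connect_induced_start Q x y : connect (induced Q) x y -> y \in Q -> x \in Q.
Proof.
have [-> //|nxy] := eqVneq x y.
by move=> c _; case/andP: (connect_induced_mem c nxy).
Qed.

Definition scc X v := [set u | [&& v \notin X, u \notin X,
  connect (induced (~: X)) v u & connect (induced (~: X)) u v]].

Lemma scc_refl X v : v \notin X -> v \in scc X v.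
Proof. by move=> vX; rewrite inE vX !connect0. Qed.

Lemma scc_notin X u v : u \in scc X v -> u \notin X.
Proof. by rewrite inE => /and4P[]. Qed.

Lemma scc_eq X u v : u \in scc X v -> scc X u = scc X v.
Proof.
rewrite inE => /and4P[vX uX vu uv]; apply/setP=> w; rewrite !inE uX vX /=.
case: (w \notin X) => //=; apply/andP/andP=> -[a b]; split.
- exact: connect_trans vu a.
- exact: connect_trans b uv.
- exact: connect_trans uv a.
- exact: connect_trans b vu.
Qed.

(** A walk in [G - X] that leaves [v] and returns to it visits only vertices of the component; if
    these avoid [Y], the walk survives in [G - Y]. *)
Lemma scc_sub X Y v : v \notin Y ->
  (forall x, x \in scc X v -> x \notin Y) -> scc X v \subset scc Y v.
Proof.
move=> vY H; apply/subsetP=> u; rewrite inE => /and4P[vX uX vu uv].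
have uS : u \in scc X v by rewrite inE vX uX vu uv.
have aux x y : connect (induced (~: X)) x y -> connect (induced (~: X)) v x ->
    connect (induced (~: X)) y v -> connect (induced (~: Y)) x y.
  case/connectP=> p; elim: p x => [|z p IH] x /=; first by move=> _ -> *; rewrite connect0.
  case/andP=> exz pth yE vx yv.
  have zy : connect (induced (~: X)) z y by rewrite yE; apply/connectP; exists p.
  have vz : connect (induced (~: X)) v z by apply: connect_trans vx (connect1 exz).
  have inY w : connect (induced (~: X)) v w -> connect (induced (~: X)) w v -> w \in ~: Y.
    move=> vw wv; rewrite inE; apply: H; rewrite inE vX vw wv !andbT /=.
    by have := connect_induced_end vw; rewrite !inE; apply.
  apply: connect_trans (IH z pth yE vz yv); apply: connect1.
  rewrite /induced /=; case/and3P: (exz) => -> _ _ /=; apply/andP; split; apply: inY => //.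
    apply: connect_trans (connect1 exz) _; exact: connect_trans zy yv.
  exact: connect_trans zy yv.
rewrite inE vY (H u uS) /=; apply/andP; split.
  by apply: aux => //; rewrite connect0.
by apply: aux => //; rewrite connect0.
Qed.

Lemma scc_anti X Y v : X \subset Y -> scc Y v \subset scc X v.
Proof.
move=> sXY; have [vY|vY] := boolP (v \in Y).
  by apply/subsetP=> u; rewrite inE vY.
apply: scc_sub; first by apply: contra vY; apply: subsetP.
by move=> x /scc_notin; apply: contra; apply: subsetP.
Qed.

(** This makes every strong component of [G - X] admissible as the vertex set of a subtree with
    guard [X]. *)
Lemma guarded_scc X v : v \notin X -> guarded e X (scc X v).
Proof.
move=> vX; split.
  by rewrite disjoint_subset; apply/subsetP=> u /scc_notin; rewrite !inE.
move=> z1 z2 x z1S z2S xS xX /= c1 c2; case/negP: xS.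
have E : [rel x y | [&& e x y, x \notin X & y \notin X]] =2 induced (~: X).
  by move=> a b; rewrite /induced /= !inE.
rewrite (eq_connect E) in c1; rewrite (eq_connect E) in c2.
move: z1S z2S; rewrite !inE => /and4P[_ _ vz1 _] /and4P[_ _ _ z2v].
rewrite vX xX /=; apply/andP; split; [exact: connect_trans vz1 c1|exact: connect_trans c2 z2v].
Qed.
End Induced.

(** * Gluing decompositions of strong components under a new root *)

Section Decomposition.
Variables (T : finType) (e : rel T) (B : nat).
Implicit Types (Z g U : {set T}) (x y z u v : T).

(* A rooted tree on the vertex set [Z] (all bags are singletons), in which
   [D t] is the vertex set of the subtree below [t]; [g] plays the part of the
   guard of the missing arc entering the root. *)
Definition partial_decomposition g Z (r : T) (par : {ffun T -> T}) (X D : {ffun T -> {set T}}) :=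
  [/\ [/\ r \in Z, par r = r & D r = Z],
      (forall t, t \in Z -> t != r ->
         [/\ par t \in Z, t \in D t, D t \subset D (par t) & par t \notin D t]),
      (forall t v, t \in Z -> v \in D t -> v != t ->
         exists c, [/\ c \in Z, c != r, par c = t & v \in D c]),
      (forall t, t \in Z -> t != r -> guarded e (X t) (D t)) &
      (forall t, t \in Z ->
         #|[set t] :|: (if t != r then X t else g)
            :|: \bigcup_(c | [&& c \in Z, par c == t & c != r]) X c| <= B)].

(** The classes [C v] partition [Z] minus [z], and their trees are hung below the new root [z]. Only
    the node [z] needs a new estimate: [z], [g] and the guards of its children all lie in [U]. *)
Lemma glue_partial_decomposition g Z z (C : T -> {set T}) (gC : {set T} -> {set T}) U :
  z \in Z ->
  (forall v, v \in Z -> v != z -> [/\ v \in C v, C v \subset Z :\ z & forall u, u \in C v -> C u = C v] /\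
    [/\ guarded e (gC (C v)) (C v), gC (C v) \subset U
      & exists r par X D, partial_decomposition (gC (C v)) (C v) r par X D]) ->
  z \in U -> g \subset U -> #|U| <= B ->
  exists r par X D, partial_decomposition g Z r par X D.
Proof.
move=> zZ HC zU gU cU.
pose ok v (q : T * {ffun T -> T} * {ffun T -> {set T}} * {ffun T -> {set T}}) :=
  v \in Z -> v != z -> partial_decomposition (gC (C v)) (C v) q.1.1.1 q.1.1.2 q.1.2 q.2.
have [q0 okq0] : exists q0 : T -> _, forall v, ok v (q0 v).
  apply: (@fin_all_exists T (fun=> _) ok) => v.
  case: (boolP ((v \in Z) && (v != z))) => [/andP[vZ vz]|nv].
    have [_ [_ _ [r [par [X [D H]]]]]] := HC v vZ vz.
    by exists (r, par, X, D).
  by exists (z, [ffun=> z], [ffun=> set0], [ffun=> set0]) => vZ vz; rewrite vZ vz in nv.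
pose rep (S : {set T}) := odflt z [pick u in S].
have rep_in v : v \in Z -> v != z -> rep (C v) \in C v.
  move=> vZ vz; have [[vC _ _] _] := HC v vZ vz.
  by rewrite /rep; case: pickP => //= /(_ v); rewrite vC.
pose q v := q0 (rep (C v)).
have inZ v u : v \in Z -> v != z -> u \in C v -> (u \in Z) && (u != z).
  move=> vZ vz uC; have [[_ /subsetP/(_ u uC) sC _] _] := HC v vZ vz.
  by move: sC; rewrite !inE andbC.
have Crep v : v \in Z -> v != z -> C (rep (C v)) = C v.
  by move=> vZ vz; have [[_ _ H] _] := HC v vZ vz; apply: H; apply: rep_in.
have okq v : v \in Z -> v != z ->
    partial_decomposition (gC (C v)) (C v) (q v).1.1.1 (q v).1.1.2 (q v).1.2 (q v).2.
  move=> vZ vz; have /andP[rZ rz] := inZ _ _ vZ vz (rep_in v vZ vz).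
  by have := okq0 (rep (C v)) rZ rz; rewrite Crep.
have qE v u : v \in Z -> v != z -> u \in C v -> q u = q v.
  by move=> vZ vz uC; rewrite /q; have [[_ _ -> //] _] := HC v vZ vz.
have CE v u : v \in Z -> v != z -> u \in C v -> C u = C v.
  by move=> vZ vz uC; have [[_ _ -> //] _] := HC v vZ vz.
pose rt v := (q v).1.1.1.
have rtE v u : v \in Z -> v != z -> u \in C v -> rt u = rt v.
  by move=> vZ vz uC; rewrite /rt (qE _ _ vZ vz uC).
pose par := [ffun v => if v == z then z else if v == rt v then z else (q v).1.1.2 v].
pose X := [ffun v => if v == rt v then gC (C v) else (q v).1.2 v].
pose D := [ffun v => if v == z then Z else (q v).2 v].
exists z, par, X, D.
have inC v : v \in Z -> v != z -> v \in C v by move=> vZ vz; have [[]] := HC v vZ vz.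
have DsubC v : v \in Z -> v != z -> D v \subset C v.
  move=> vZ vz; rewrite ffunE (negPf vz).
  have [[r1 r2 r3] H2 H3 _ _] := okq v vZ vz.
  (* Passing to the parent enlarges [D] strictly, so induction on the size of the complement climbs
     to the root, where [D] is the whole class. *)
  have main n : forall u, u \in C v -> #|~: (q v).2 u| <= n -> (q v).2 u \subset C v.
    elim: n => [|n IH] u uC hn.
      have [-> |ur] := eqVneq u (rt v); first by rewrite /rt r3.
      have [_ _ sD] := H2 u uC ur; case/negP.
      by move: hn; rewrite leqn0 cards_eq0 => /eqP/setP/(_ ((q v).1.1.2 u)); rewrite !inE => /negbFE.
    have [-> |ur] := eqVneq u (rt v); first by rewrite /rt r3.
    have [pC _ sD pD] := H2 u uC ur; apply: (subset_trans sD); apply: IH => //.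
    have [e1|pr] := eqVneq ((q v).1.1.2 u) (rt v).
      rewrite -ltnS; apply: leq_trans hn; apply: proper_card; rewrite properE setCS sD /=.
      rewrite setCS; apply/negP=> /subsetP/(_ ((q v).1.1.2 u)) h; case/negP: pD; apply: h.
      by rewrite e1 r3.
    rewrite -ltnS; apply: leq_trans hn; apply: proper_card; rewrite properE setCS sD /=.
    rewrite setCS; apply/negP=> /subsetP/(_ ((q v).1.1.2 u)) h; case/negP: pD; apply: h.
    by have [] := H2 _ pC pr.
  by apply: (main #|~: (q v).2 v|) => //; apply: inC.
have parE v : v \in Z -> v != z -> v != rt v -> par v = (q v).1.1.2 v /\ par v \in C v.
  move=> vZ vz vr; rewrite ffunE (negPf vz) (negPf vr); split => //.
  by have [_ H2 _ _ _] := okq v vZ vz; have [] := H2 v (inC v vZ vz) vr.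
split.
- by split=> //; rewrite ffunE eqxx.
- move=> t tZ tz.
  have [[r1 r2 r3] H2 _ _ _] := okq t tZ tz.
  have [tr|tr] := eqVneq t (rt t).
    have -> : par t = z by rewrite ffunE (negPf tz) -tr eqxx.
    have DE : D t = C t by rewrite ffunE (negPf tz) -[RHS]r3 -/(rt t) -tr.
    split=> //; first by rewrite DE inC.
      rewrite DE [D z]ffunE eqxx; have [[_ sC _] _] := HC t tZ tz.
      by apply: subset_trans sC _; apply: subsetDl.
    rewrite DE; have [[_ sC _] _] := HC t tZ tz.
    by apply/negP=> /(subsetP sC); rewrite !inE eqxx.
  have [pE pC] := parE t tZ tz tr; have /andP[pZ pz] := inZ _ _ tZ tz pC.
  have [_ a2 a3 a4] := H2 t (inC t tZ tz) tr.
  split=> //.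
  + by rewrite ffunE (negPf tz).
  + by rewrite [D t]ffunE (negPf tz) [D (par t)]ffunE (negPf pz) (qE _ _ tZ tz pC) pE.
  + by rewrite pE ffunE (negPf tz).
- move=> t v tZ; have [->|tz] := eqVneq t z.
    rewrite ffunE eqxx => vZ vz; exists (rt v).
    have [[r1 r2 r3] _ _ _ _] := okq v vZ vz; have /andP[rZ rz] := inZ _ _ vZ vz r1.
    split=> //.
      by rewrite ffunE (negPf rz) (rtE _ _ vZ vz r1) eqxx.
    by rewrite ffunE (negPf rz) (qE _ _ vZ vz r1) r3 inC.
  move=> vD vt; have vC := subsetP (DsubC t tZ tz) _ vD.
  move: vD; rewrite ffunE (negPf tz) => vD.
  have [_ _ H3 _ _] := okq t tZ tz.
  have [c [cC cr pc vc]] := H3 t v (inC t tZ tz) vD vt.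
  have /andP[cZ cz] := inZ _ _ tZ tz cC.
  exists c; split=> //.
    by rewrite ffunE (negPf cz) (rtE _ _ tZ tz cC) (negPf cr) (qE _ _ tZ tz cC).
  by rewrite ffunE (negPf cz) (qE _ _ tZ tz cC).
- move=> t tZ tz; have [_ [gd _ _]] := HC t tZ tz.
  have [[r1 r2 r3] _ _ H4 _] := okq t tZ tz.
  have [tr|tr] := eqVneq t (rt t).
    have -> : D t = C t by rewrite ffunE (negPf tz) -[RHS]r3 -/(rt t) -tr.
    by rewrite ffunE -tr eqxx.
  by rewrite !ffunE (negPf tz) (negPf tr); apply: H4 => //; apply: inC.
move=> t tZ; have [->|tz] /= := eqVneq t z.
  apply: leq_trans cU; apply: subset_leq_card; rewrite !subUset sub1set zU gU /=.
  apply/bigcupsP=> c /and3P[cZ /eqP pc cz].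
  have [cr|cr] := eqVneq c (rt c).
    by rewrite ffunE -cr eqxx; have [_ []] := HC c cZ cz.
  have [_ pC] := parE c cZ cz cr.
  by have /andP[_] := inZ _ _ cZ cz pC; rewrite pc eqxx.
have [[r1 r2 r3] H2 _ _ H5] := okq t tZ tz.
apply: leq_trans (H5 t (inC t tZ tz)); apply: subset_leq_card.
apply: setUSS; first apply: setUS.
  by rewrite ffunE -/(rt t); case: (t == rt t).
apply/bigcupsP=> c /and3P[cZ /eqP pc cz].
have cr : c != rt c.
  by apply: contra tz => cr; rewrite -pc ffunE (negPf cz) cr.
have [pE pC] := parE c cZ cz cr; rewrite pc in pE pC.
have cC : c \in C t by rewrite (CE _ _ cZ cz pC) inC.
rewrite ffunE (negPf cr) (qE _ _ tZ tz cC).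
have cc : [&& c \in C t, (q t).1.1.2 c == t & c != (q t).1.1.1].
  by rewrite cC -/(rt t) -(rtE _ _ tZ tz cC) cr andbT /= -(qE _ _ tZ tz cC) -pE.
by rewrite (bigD1 c) //= subsetUl.
Qed.
End Decomposition.

(** * Arboreal decompositions from balanced separators *)

Section TreeDecomposition.
Variables (T : finType) (e : rel T).

(** The size of [D t] increases strictly towards the root. This shows that iterating [par] ends at
    [r] and that [D t] consists of the descendants of [t]. *)
Lemma dtw_le_of_partial_decomposition w r par X D :
  partial_decomposition e w.+1 set0 [set: T] r par X D -> dtw_le e w.
Proof.
case=> -[_ pr Dr] H2 H3 H4 H5; right; exists T, r, par, X, (fun t => [set t]).
have tD t : t \in D t.
  by have [->|tr] := eqVneq t r; [rewrite Dr inE | have [] := H2 t (in_setT t) tr].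
have DS t : D t \subset D (par t).
  by have [->|tr] := eqVneq t r; [rewrite pr | have [] := H2 t (in_setT t) tr].
have Dlt t : t != r -> #|D t| < #|D (par t)|.
  move=> tr; have [_ _ s n] := H2 t (in_setT t) tr.
  apply: proper_card; rewrite properE s /=; apply: contra n => /subsetP; apply.
  exact: tD.
have conr t : fconnect par t r.
  have [n] := ubnP (#|T| - #|D t|); elim: n t => // n IH t lt.
  have [->|tr] := eqVneq t r; first exact: connect0.
  apply: connect_trans (fconnect1 par t) (IH _ _).
  by move: lt (Dlt t tr) (max_card (D (par t))); clear; lia.
have DE t v : (v \in D t) = fconnect par v t.
  apply/idP/idP.
    have [n] := ubnP #|D t|; elim: n t => // n IH t lt vD.
    have [->|vt] := eqVneq v t; first exact: connect0.
    have [c [_ cr pc vc]] := H3 t v (in_setT t) vD vt.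
    have := Dlt c cr; rewrite pc => ltc.
    apply: connect_trans (IH c _ vc) _; first by move: lt ltc; clear; lia.
    by rewrite -pc fconnect1.
  move/iter_findex=> <-; elim: (findex _ _ _) => [|n IH] //=.
  exact: (subsetP (DS _)).
do !split=> //.
- by move=> t; apply/set0Pn; exists t; rewrite inE.
- by move=> v; exists v; rewrite inE.
- by move=> t1 t2 v /set1P-> /set1P->.
- have -> : [set v | [exists t', (v \in [set t']) && fconnect par t' t]] = D t.
    apply/setP=> v; rewrite inE DE; apply/existsP/idP.
      by case=> t' /andP[/set1P->].
    by exists v; rewrite inE eqxx.
  by case: (H4 t (in_setT t) H).
- have -> : [set v | [exists t', (v \in [set t']) && fconnect par t' t]] = D t.
    apply/setP=> v; rewrite inE DE; apply/existsP/idP.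
      by case=> t' /andP[/set1P->].
    by exists v; rewrite inE eqxx.
  by case: (H4 t (in_setT t) H).
- move=> t; apply: leq_trans (H5 t (in_setT t)).
  rewrite leq_eqVlt; apply/orP; left; apply/eqP; congr #|pred_of_set (_ :|: _)|.
  by apply: eq_bigl => c; rewrite inE.
Qed.

Variable w : nat.
Hypothesis balanced : forall Y : {set T}, #|Y| <= 2 * w + 2 ->
  exists2 X : {set T}, #|X| <= w & forall v, v \notin X -> 2 * #|scc e X v :&: Y| <= #|Y|.

(* [Y] is the guard inherited from the last rebalancing, [X] a balanced
   separator of [Y], and [Q] the part of [X] that has been eliminated so far. *)
Lemma partial_decomposition_exists n (Z Y X Q : {set T}) z :
  #|Z| < n -> #|Y| <= 2 * w + 2 -> #|X| <= w + 1 ->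
  (forall v, v \notin X -> #|scc e X v :&: Y| <= w + 1) ->
  Q \subset X -> z \in Z -> z \in X ->
  (forall v, v \in Z -> v \notin Y :|: Q /\ scc e (Y :|: Q) v \subset Z) ->
  exists r par X' D, partial_decomposition e (3 * w + 3) (Y :|: Q) Z r par X' D.
Proof.
elim: n Z Y X Q z => // n IH Z Y X Q z cZ cY cX bX sQ zZ zX clZ.
pose H := Y :|: (z |: Q).
pose rep (S : {set T}) := odflt z [pick u in S].
(* A component that still meets [X] takes the guard [H] and goes on eliminating [X]. A component
   that misses [X] needs as guard only [X] and the part of [Y] in its component of [G - X], at most
   [2 * w + 2] vertices; there a new separator is chosen. *)
pose gC (S : {set T}) := if S :&: X != set0 then H else X :|: (Y :&: scc e X (rep S)).
have sH : H \subset Y :|: X by rewrite setUS // subUset sub1set zX sQ.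
have sQH : Y :|: Q \subset H by rewrite setUS // subsetUr.
apply: (@glue_partial_decomposition _ _ _ (Y :|: Q) Z z (scc e H) gC (Y :|: X)) => //.
- move=> v vZ vz; have [vYQ sv] := clZ v vZ.
  have vH : v \notin H by move: vYQ; rewrite !inE (negPf vz).
  have vC : v \in scc e H v by apply: scc_refl.
  have CZ : scc e H v \subset Z :\ z.
    apply/subsetP=> u uC; rewrite !inE; apply/andP; split.
      by apply: contraTneq uC => ->; rewrite !inE eqxx /= !orbT /= andbF.
    by apply: (subsetP sv); apply: (subsetP (scc_anti _ _ sQH)).
  have cC : #|scc e H v| < n.
    apply: leq_ltn_trans (subset_leq_card CZ) _.
    by move: cZ; rewrite (cardsD1 z Z) zZ add1n ltnS.
  split; first by split=> // u uC; apply: scc_eq.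
  have repC : rep (scc e H v) \in scc e H v.
    by rewrite /rep; case: pickP => //= /(_ v); rewrite vC.
  rewrite /gC; set v0 := rep _ in repC *.
  case: ifPn => [/set0Pn[x /setIP[xC xX]]|].
    split=> //; first exact: guarded_scc.
    apply: (IH _ _ X (z |: Q) x) => //; first by rewrite subUset sub1set zX.
    by move=> u uC; rewrite (scc_notin uC) (scc_eq uC).
  rewrite negbK => /eqP CX; set Y' := X :|: _.
  have nX x : x \in scc e H v -> x \notin X.
    by move=> xC; apply/negP=> xX; have := in_set0 x; rewrite -CX inE xC xX.
  have sXY : X \subset Y' by rewrite /Y' subsetUl.
  have v0H : v0 \notin H := scc_notin repC.
  have CE0 : scc e H v0 = scc e H v := scc_eq repC.
  have nY x : x \in scc e H v -> x \notin Y.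
    by move/scc_notin; rewrite !inE => /norP[].
  have v0Y' : v0 \notin Y' by rewrite !inE (negPf (nX _ repC)) (negPf (nY _ repC)).
  have CE : scc e H v = scc e Y' v0.
    apply/eqP; rewrite eqEsubset -CE0; apply/andP; split; apply: scc_sub => //.
      by move=> x; rewrite CE0 => xC; rewrite !inE (negPf (nX _ xC)) (negPf (nY _ xC)).
    move=> x xC; have xX : x \notin X by move: (scc_notin xC); rewrite inE => /norP[].
    have xD : x \in scc e X v0 by apply: (subsetP (@scc_anti _ e X Y' v0 sXY)).
    have xY : x \notin Y.
      apply: contra (scc_notin xC) => xY; by rewrite !in_setU in_setI xY xD orbT.
    apply/negP => /(subsetP sH); rewrite inE => /orP[].
      by rewrite (negPf xY).
    by rewrite (negPf xX).
  have cY' : #|Y'| <= 2 * w + 2.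
    rewrite /Y'; apply: leq_trans (leq_card_setU _ _) _.
    by move: (bX v0 (nX _ repC)) cX; rewrite setIC; clear; lia.
  split.
  - by rewrite CE; apply: guarded_scc.
  - by rewrite subUset subsetUr /= (subset_trans (subsetIl _ _)) ?subsetUl.
  (* Adding [v0] makes the new separator meet the component, so that there is a next vertex to
     eliminate; this is the extra one in the bound [w + 1]. *)
  have [X0 cX0 bX0] := balanced cY'.
  have := @IH (scc e H v) Y' (v0 |: X0) set0 v0; rewrite setU0; apply=> //.
  - by apply: leq_trans (leq_card_setU _ _) _; rewrite cards1 addnC leq_add2r.
  - move=> u uX; have uX0 : u \notin X0 by move: uX; rewrite !inE => /norP[].
    have := bX0 u uX0; have s : scc e (v0 |: X0) u :&: Y' \subset scc e X0 u :&: Y'.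
      by rewrite setSI // scc_anti // subsetUr.
    by move/subset_leq_card: s; move: cY'; clear; lia.
  - exact: sub0set.
  - by rewrite !inE eqxx.
  move=> u uC; rewrite CE in uC *; split; first exact: scc_notin uC.
  by rewrite (scc_eq uC).
- by rewrite inE zX orbT.
- by rewrite setUS.
by apply: leq_trans (leq_card_setU _ _) _; move: cX cY; clear; lia.
Qed.

Lemma dtw_le_of_balanced : dtw_le e (3 * w + 2).
Proof.
case: (posnP #|T|) => [T0|]; first by left.
case/card_gt0P => x _.
have [r [par [X [D H]]]] : exists r par X D,
    partial_decomposition e (3 * w + 3) (set0 :|: set0) [set: T] r par X D.
  apply: (@partial_decomposition_exists #|T|.+1 _ _ [set x] _ x) => //.
  - by rewrite ltnS cardsT.
  - by rewrite cards0.
  - by rewrite cards1 addn1.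
  - by move=> v _; rewrite setI0 cards0.
  - exact: sub0set.
  - by rewrite inE.
  - by move=> v _; rewrite setU0 inE subsetT.
rewrite setU0 addn3 in H; rewrite addn2; exact: dtw_le_of_partial_decomposition H.
Qed.

End TreeDecomposition.

Lemma dtw_le_or_haven (T : finType) (e : rel T) (w : nat) :
  dtw_le e (3 * w + 2) \/ exists S : {set T}, forall X : {set T}, #|X| <= w ->
    exists2 v, v \notin X & #|S| < 2 * #|scc e X v :&: S|.
Proof.
case: (boolP [forall Y : {set T}, (#|Y| <= 2 * w + 2) ==> [exists X : {set T}, (#|X| <= w) &&
   [forall v, (v \notin X) ==> (2 * #|scc e X v :&: Y| <= #|Y|)]]]).
  move/forallP=> H; left; apply: dtw_le_of_balanced => Y cY.
  have /existsP[X /andP[cX /forallP bX]] := implyP (H Y) cY.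
  by exists X => // v vX; apply: (implyP (bX v)).
case/forallPn=> S; rewrite negb_imply => /andP[_ /existsPn H]; right; exists S => X cX.
have := H X; rewrite cX /= => /forallPn[v]; rewrite negb_imply -ltnNge => /andP[vX lt].
by exists v.
Qed.

(** * Matroid rank functions and matroid intersection *)

Section MatroidIntersection.
Variable T : finType.
Implicit Types (A B E U : {set T}) (r : {set T} -> nat).

Definition matroid_rank r :=
  [/\ r set0 = 0, (forall A B, A \subset B -> r A <= r B),
      (forall A x, r (x |: A) <= (r A).+1) &
      (forall A B, r (A :&: B) + r (A :|: B) <= r A + r B)].

Lemma matroid_rank_contract r x :
  matroid_rank r -> r [set x] = 1 -> matroid_rank (fun A => (r (x |: A)).-1).
Proof.
move=> [r0 rm r1 rs] rx.
have pos A : 0 < r (x |: A) by rewrite -rx; apply: rm; apply: subsetUl.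
split.
- by rewrite setU0 rx.
- by move=> A B sAB; rewrite -ltnS !prednK //; apply: rm; apply: setUS.
- move=> A y; rewrite setUCA; have := r1 (x |: A) y; move: (pos A); clear; lia.
move=> A B; have := rs (x |: A) (x |: B); rewrite -setUIr setUACA setUid.
by move: (pos A) (pos B) (pos (A :&: B)) (pos (A :|: B)); clear; lia.
Qed.

Lemma matroid_rank_loops r U :
  matroid_rank r -> (forall x, x \in U -> r [set x] = 0) -> r U = 0.
Proof.
move=> [r0 rm r1 rs]; have [n] := ubnP #|U|; elim: n U => // n IH U cU H.
have [->|[x xU]] := set_0Vmem U; first by [].
have U0 : r (U :\ x) = 0.
  apply: IH; first by move: cU; rewrite (cardsD1 x U) xU add1n ltnS.
  by move=> y /setD1P[_ /H].
have := rs [set x] (U :\ x); rewrite setD1K // H // U0 leqn0 addn_eq0.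
by case/andP=> _ /eqP.
Qed.

(** The nontrivial half of Edmonds' min-max theorem, by induction on [E]. For an element [x] that is
    a loop of neither matroid, deleting or contracting [x] preserves the hypothesis; otherwise two
    violating sets [U1] and [U2] are uncrossed by submodularity. *)
Theorem matroid_intersection r1 r2 E n :
  matroid_rank r1 -> matroid_rank r2 ->
  (forall U, U \subset E -> n <= r1 U + r2 (E :\: U)) ->
  exists I : {set T}, [/\ I \subset E, #|I| = n, r1 I = n & r2 I = n].
Proof.
have [c] := ubnP #|E|; elim: c E n r1 r2 => // c IH E n r1 r2 cE R1 R2; case: n => [|n] H.
  by case: R1 R2 => [a _ _ _] [b _ _ _]; exists set0; rewrite sub0set cards0.
(* Otherwise every element of [E] is a loop of one of the matroids, and the set [U] of loops of [r1]
   has [r1 U + r2 (E :\: U) = 0]. *)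
have [x [xE rx1 rx2]] : exists x, [/\ x \in E, r1 [set x] = 1 & r2 [set x] = 1].
  pose U := [set x in E | r1 [set x] == 0].
  have UE : U \subset E by apply/subsetP=> x; rewrite inE => /andP[].
  case: (pickP [pred x in E | (r1 [set x] == 1) && (r2 [set x] == 1)]) => [x /= /and3P[xE /eqP ? /eqP ?]|no].
    by exists x.
  have le1 r x : matroid_rank r -> r [set x] <= 1.
    by case=> a _ b _; have := b set0 x; rewrite setU0 a.
  have := H U UE; rewrite (matroid_rank_loops R1) ?(matroid_rank_loops R2) //.
    move=> x; rewrite !inE => /andP[nU xE].
    have := no x; rewrite /= xE /=; rewrite xE /= in nU.
    by move: (le1 r1 x R1) (le1 r2 x R2) nU; case: (r1 _) => [|[|]] //; case: (r2 _) => [|[|]].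
  by move=> x; rewrite inE => /andP[_ /eqP].
have cE' : #|E :\ x| < c by move: cE; rewrite (cardsD1 x E) xE add1n ltnS.
have sE' : E :\ x \subset E := subsetDl _ _.
case: (boolP [forall U : {set T}, (U \subset E :\ x) ==> (n.+1 <= r1 U + r2 (E :\ x :\: U))]).
  move/forallP=> Hd; have [I [sI cI i1 i2]] := IH (E :\ x) n.+1 r1 r2 cE' R1 R2 (fun U => implyP (Hd U)).
  by exists I; rewrite (subset_trans sI).
case/forallPn=> U1; rewrite negb_imply -ltnNge => /andP[sU1 lt1].
pose s1 A := (r1 (x |: A)).-1; pose s2 A := (r2 (x |: A)).-1.
have pos r A : matroid_rank r -> r [set x] = 1 -> 0 < r (x |: A).
  by case=> _ rm _ _ rx; rewrite -rx; apply: rm; apply: subsetUl.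
case: (boolP [forall U : {set T}, (U \subset E :\ x) ==> (n <= s1 U + s2 (E :\ x :\: U))]).
  move/forallP=> Hd.
  have [I [sI cI i1 i2]] := IH (E :\ x) n s1 s2 cE' (matroid_rank_contract R1 rx1)
    (matroid_rank_contract R2 rx2) (fun U => implyP (Hd U)).
  exists (x |: I); rewrite subUset sub1set xE (subset_trans sI) //; split=> //.
  - rewrite cardsU1 cI; case: (boolP (x \in I)) => // /(subsetP sI).
    by rewrite !inE eqxx.
  - by rewrite -i1 /s1 prednK // pos.
  - by rewrite -i2 /s2 prednK // pos.
case/forallPn=> U2; rewrite negb_imply -ltnNge => /andP[sU2 lt2]; exfalso.
case: (R1) (R2) => [_ _ _ sm1] [_ _ _ sm2].
(* The failures give a sum of at most [n] for [U1], and of at most [n.+1] for [U2] with [x] added on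
   both sides. The intersection and the union give at least [n.+1] each, and
   [2 * n + 1 < 2 * n + 2]. *)
have a1 := sm1 U1 (x |: U2); have a2 := sm2 (E :\ x :\: U1) (x |: (E :\ x :\: U2)).
have xU1 : x \notin U1 by apply/negP=> /(subsetP sU1); rewrite !inE eqxx.
have xU2 : x \notin U2 by apply/negP=> /(subsetP sU2); rewrite !inE eqxx.
have E1 : (E :\ x :\: U1) :&: (x |: (E :\ x :\: U2)) = E :\: (U1 :|: (x |: U2)).
  apply/setP=> y; rewrite !inE; have [->|_] /= := eqVneq y x; first by rewrite orbT andbF.
  by case: (y \in U1); case: (y \in U2); case: (y \in E).
have E2 : (E :\ x :\: U1) :|: (x |: (E :\ x :\: U2)) = E :\: (U1 :&: (x |: U2)).
  apply/setP=> y; rewrite !inE; have [->|_] /= := eqVneq y x; first by rewrite xE (negPf xU1) orbT.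
  by case: (y \in U1); case: (y \in U2); case: (y \in E).
rewrite E1 E2 in a2.
have b1 : n.+1 <= r1 (U1 :&: (x |: U2)) + r2 (E :\: (U1 :&: (x |: U2))).
  apply: H; exact: subset_trans (subsetIl _ _) (subset_trans sU1 sE').
have b2 : n.+1 <= r1 (U1 :|: (x |: U2)) + r2 (E :\: (U1 :|: (x |: U2))).
  by apply: H; rewrite !subUset sub1set xE (subset_trans sU1 sE') (subset_trans sU2 sE').
move: a1 a2 b1 b2 lt1 lt2 (pos r1 U2 R1 rx1) (pos r2 (E :\ x :\: U2) R2 rx2).
rewrite /s1 /s2; clear; lia.
Qed.
End MatroidIntersection.

(** * Disjoint paths: Menger's theorem for digraphs *)

Lemma take_set (T : finType) (A : {set T}) n : n <= #|A| ->
  exists2 B : {set T}, B \subset A & #|B| = n.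
Proof.
move=> le; exists [set u in take n (enum A)].
  by apply/subsetP=> u; rewrite inE => /mem_take; rewrite mem_enum.
rewrite cardsE; have /card_uniqP -> : uniq (take n (enum A)) by rewrite take_uniq ?enum_uniq.
by rewrite size_takel // -cardE.
Qed.

Section Menger.
Variable T : finType.
Implicit Types (e : rel T) (A B S V X : {set T}).

Definition separates e A B X := forall a b, a \in A -> b \in B -> a \notin X -> b \notin X ->
  ~~ connect (induced e (~: X)) a b.

(* The vertex set of a simple path from [a] to [b]. *)
Definition route e V a b :=
  [/\ a \in V, connect (induced e V) a b,
      (forall x, x \in V -> x != b -> connect (induced e (V :\ b)) a x) &
      (forall x, x \in V -> x != a -> connect (induced e (V :\ a)) x b)].

Lemma path_connect_induced e V a p :
  path e a p -> {subset a :: p <= V} -> connect (induced e V) a (last a p).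
Proof.
elim: p a => [|z p IH] a /=; first by rewrite connect0.
case/andP=> eaz pth sV; apply: connect_trans (IH z pth _); last first.
  by move=> u up; apply: sV; rewrite inE up orbT.
apply: connect1; rewrite /induced /= eaz !sV //; by rewrite !inE eqxx ?orbT.
Qed.

Lemma routeP e V a b : a \in V -> connect (induced e V) a b ->
  exists2 V' : {set T}, V' \subset V & route e V' a b.
Proof.
move=> aV /connectP[p0 pth0 ->]; case/shortenP: pth0 => p pth un _.
have pe : path e a p by apply: sub_path pth => x y /and3P[].
have pV : {subset a :: p <= V}.
  move=> u; rewrite inE => /predU1P[->//|].
  elim: p a aV pth {un pe} => //= z p IH a _ /andP[/and3P[_ _ zV] pth].
  by rewrite inE => /predU1P[->//|]; apply: (IH z).
exists [set x in a :: p]; first by apply/subsetP=> u; rewrite inE => /pV.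
split.
- by rewrite !inE eqxx.
- by apply: path_connect_induced => // u up; rewrite inE.
- move=> x; rewrite inE => xp xb; case/splitPl: xp xb pe un => p1 p2 lx.
  rewrite cat_path last_cat lx => xb /andP[pth1 _]; rewrite -cat_cons cat_uniq => /and3P[_ n _].
  have := @path_connect_induced e ([set z in a :: (p1 ++ p2)] :\ last x p2) a p1 pth1.
  rewrite lx; apply=> u up.
  rewrite !inE mem_cat orbA -in_cons up andbT; case: (eqVneq u (last x p2)) => //= uE.
  case/negP: n; apply/hasP; exists u => //; rewrite uE.
  by move: (mem_last x p2); rewrite inE eq_sym (negPf xb).
move=> x; rewrite inE => xp xa; case/splitPl: xp pe un => p1 p2 lx.
rewrite cat_path last_cat lx => /andP[_ pth2]; rewrite -cat_cons cat_uniq => /and3P[_ n _].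
apply: path_connect_induced => // u; rewrite !inE mem_cat => /predU1P[->|up2].
  by rewrite xa; move: (mem_last a p1); rewrite lx inE => /orP[->|->]; rewrite ?orbT.
rewrite up2 !orbT andbT; apply: contra n => /eqP ua; apply/hasP; exists u => //.
by rewrite ua mem_head.
Qed.

Lemma connect_eq_of_no_arc e Q a b :
  (forall x y, x != y -> ~~ e x y) -> connect (induced e Q) a b -> a = b.
Proof.
move=> no /connectP[p]; elim: p a => [|z p IH] a /=; first by [].
case/andP=> /and3P[eaz _ _] pth l; have [->|az] := eqVneq a z; first exact: IH.
by have := no a z az; rewrite eaz.
Qed.

(** Induction on the number of arcs. Delete an arc from [x] to [y]. If the hypothesis fails
    afterwards, some [S] with [m - 1] vertices separates in the smaller digraph, and the induction
    hypothesis links [A] to [x |: S] and [y |: S] to [B]. The two families are joined at [S] and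
    along the deleted arc. *)
Theorem Menger e A B m :
  (forall X, separates e A B X -> m <= #|X|) ->
  exists A0 (V : T -> {set T}) (t : T -> T),
    [/\ A0 \subset A, #|A0| = m,
        (forall a, a \in A0 -> [/\ a \in V a, t a \in B & connect (induced e (V a)) a (t a)]) &
        (forall a a', a \in A0 -> a' \in A0 -> a != a' -> [disjoint V a & V a'])].
Proof.
have [n] := ubnP #|[set p | e p.1 p.2]|; elim: n e A B => // n IH e A B ce H.
case: (pickP [pred p : T * T | (p.1 != p.2) && e p.1 p.2]) => [[x y] /= /andP[xy exy]|no]; last first.
  have no' x y : x != y -> ~~ e x y by move=> xy; have := no (x, y); rewrite /= xy /= => ->.
  have : m <= #|A :&: B|.
    apply: H => a b aA bB aX bX; apply/negP=> /(connect_eq_of_no_arc no') ab.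
    by case/negP: aX; rewrite inE aA ab.
  move=> le.
  have [A0 sA0 cA0] := take_set le.
  exists A0, (fun a => [set a]), id; split=> //.
  - by apply: subset_trans sA0 _; apply: subsetIl.
  - by move=> a /(subsetP sA0)/setIP[_ aB]; rewrite inE eqxx aB connect0.
  by move=> a a' _ _ aa'; rewrite disjoints1 inE.
pose e' : rel T := [rel u v | e u v && ((u, v) != (x, y))].
have ee' : subrel e' e by move=> u v /andP[].
have ce' : #|[set p | e' p.1 p.2]| < n.
  rewrite -ltnS; apply: leq_trans ce; rewrite ltnS; apply: proper_card; rewrite properE.
  apply/andP; split; first by apply/subsetP=> p; rewrite !inE => /andP[].
  by apply/subsetPn; exists (x, y); rewrite inE ?exy // /e' /= eqxx andbF.
have inde Q : subrel (induced e' Q) (induced e Q).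
  by move=> u v /and3P[/ee' a b c]; apply/and3P.
have cone Q a b : connect (induced e' Q) a b -> connect (induced e Q) a b.
  by apply: connect_sub => u v /inde; apply: connect1.
pose sepb S := [forall a in A, forall b in B, (a \notin S) ==> (b \notin S) ==> ~~ connect (induced e' (~: S)) a b].
have sepP S : reflect (separates e' A B S) (sepb S).
  apply: (iffP forall_inP) => [h a b aA bB aS bS | h a aA].
    by have /forall_inP/(_ b bB)/implyP/(_ aS)/implyP/(_ bS) := h a aA.
  by apply/forall_inP => b bB; apply/implyP=> aS; apply/implyP=> bS; apply: h.
case: (boolP [exists S : {set T}, sepb S && (#|S| < m)]); last first.
  move/existsPn => no; have [|A0 [V [t [h1 h2 h3 h4]]]] := IH e' A B ce'.
    by move=> X /sepP sX; have := no X; rewrite sX /= -leqNgt.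
  by exists A0, V, t; split=> // a /h3[? ? /cone].
case/existsP=> S /andP[/sepP sS ltS].
have mem1 (Q : {set T}) u v : e u v -> (u, v) != (x, y) -> u \in Q -> v \in Q -> induced e' Q u v.
  by move=> h1 h2 h3 h4; apply/and3P; split=> //; apply/andP.
(* Adding either end of the deleted arc to [S] separates [A] from [B] in [e]; hence [#|S| = m - 1]
   and neither end lies in [S]. *)
have cS z : (z == x) || (z == y) -> m <= #|z |: S|.
  move=> zxy; apply: H => a b aA bB; rewrite !inE !negb_or => /andP[az aS] /andP[bz bS].
  apply: contra (sS a b aA bB aS bS); apply: connect_sub => u v /and3P[euv].
  rewrite !inE !negb_or => /andP[uz uS] /andP[vz vS]; apply: connect1.
  apply: mem1 => //; rewrite ?inE //; apply/negP=> /eqP[ux vy].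
  by case/orP: zxy => /eqP zE; [rewrite zE ux eqxx in uz | rewrite zE vy eqxx in vz].
have xS : x \notin S.
  by have := cS x; rewrite eqxx cardsU1 => /(_ isT); case: (x \in S) => //=; move: ltS; clear; lia.
have yS : y \notin S.
  by have := cS y; rewrite eqxx orbT cardsU1 => /(_ isT); case: (y \in S) => //=; move: ltS; clear; lia.
have cS1 : #|S|.+1 = m.
  by have := cS x; rewrite eqxx cardsU1 xS => /(_ isT); move: ltS; clear; lia.
have cx : #|x |: S| = m by rewrite cardsU1 xS.
have cy : #|y |: S| = m by rewrite cardsU1 yS.
(* A separator [X] of [A] from [x |: S] in [e'] also separates [A] from [B] in [e]: a path avoiding
   [X] visits [x |: S] before it can use the deleted arc, or else avoids both [S] and that arc. *)
have [|A1 [V1 [t1 [sA1 cA1 r1 d1]]]] := IH e' A (x |: S) ce'.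
  move=> X sX; apply: H => a b aA bB aX bX; apply/negP=> /connectP[p pth bE].
  have : (exists2 s, s \in x |: S & connect (induced e' (~: X)) a s) \/
         (a \notin S /\ connect (induced e' (~: S)) a b).
    elim: p a aX pth bE {aA} => [|c p IHp] a aX /=.
      move=> _ ->; case: (boolP (a \in S)) => aS; last by right; rewrite connect0.
      by left; exists a; rewrite ?connect0 // inE aS orbT.
    case/andP=> /and3P[eac _ cX] pth bE.
    case: (boolP (a \in x |: S)) => [axS|]; first by left; exists a; rewrite ?connect0.
    rewrite !inE negb_or => /andP[ax aS].
    have nac : (a, c) != (x, y) by apply: contra ax => /eqP[-> _].
    rewrite inE in cX.
    case: (IHp c cX pth bE) => [[s sS' cs]|[cS' cb]].
      left; exists s => //; apply: connect_trans cs; apply: connect1.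
      by apply: mem1; rewrite ?inE.
    right; split=> //; apply: connect_trans cb; apply: connect1.
    by apply: mem1; rewrite ?inE.
  case=> [[s sS' cs]|[aS ab]].
    have sX' : s \notin X by have := connect_induced_end cs; rewrite !inE; apply.
    by have := sX a s aA sS' aX sX'; rewrite cs.
  have bS : b \notin S by have := connect_induced_end ab; rewrite !inE; apply.
  by have := sS a b aA bB aS bS; rewrite ab.
have [|A2 [V2 [t2 [sA2 cA2 r2 d2]]]] := IH e' (y |: S) B ce'.
  move=> X sX; apply: H => a b aA bB aX bX; apply/negP=> /connectP[p pth bE].
  have : (exists2 s, s \in y |: S & connect (induced e' (~: X)) s b) \/
         [/\ a \notin S, connect (induced e' (~: S)) a b & connect (induced e' (~: X)) a b].
    elim: p a aX pth bE {aA} => [|c p IHp] a aX /=.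
      move=> _ ->; case: (boolP (a \in S)) => aS; last by right; rewrite !connect0.
      by left; exists a; rewrite ?connect0 // inE aS orbT.
    case/andP=> /and3P[eac _ cX] pth bE; rewrite inE in cX.
    case: (IHp c cX pth bE) => [|[cS' cb cb']]; first by left.
    case: (eqVneq (a, c) (x, y)) => [[_ cy']|nac].
      by left; exists y; rewrite ?inE ?eqxx // -cy'.
    have ab : connect (induced e' (~: X)) a b.
      by apply: connect_trans cb'; apply: connect1; apply: mem1; rewrite ?inE.
    case: (boolP (a \in S)) => aS; first by left; exists a => //; rewrite inE aS orbT.
    right; split=> //.
    by apply: connect_trans cb; apply: connect1; apply: mem1; rewrite ?inE.
  case=> [[s sS' cs]|[aS ab _]].
    have sX' : s \notin X by have := connect_induced_start cs; rewrite !inE; apply.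
    by have := sX s b sS' bB sX' bX; rewrite cs.
  have bS : b \notin S by have := connect_induced_end ab; rewrite !inE; apply.
  by have := sS a b aA bB aS bS; rewrite ab.
have A2E : A2 = y |: S by apply/eqP; rewrite eqEcard sA2 cA2 cy leqnn.
have /fin_all_exists[W1 hW1] : forall a, exists W : {set T}, a \in A1 -> W \subset V1 a /\ route e' W a (t1 a).
  move=> a.
  case: (boolP (a \in A1)) => [aA1|]; last by exists set0.
  by have [aV _ c] := r1 a aA1; have [W ? ?] := routeP aV c; exists W.
have /fin_all_exists[W2 hW2] : forall a, exists W : {set T}, a \in A2 -> W \subset V2 a /\ route e' W a (t2 a).
  move=> a.
  case: (boolP (a \in A2)) => [aA2|]; last by exists set0.
  by have [aV _ c] := r2 a aA2; have [W ? ?] := routeP aV c; exists W.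
have t1V a : a \in A1 -> t1 a \in W1 a.
  by move=> /hW1[_ [aW c _ _]]; apply: connect_induced_end c aW.
have dW1 a a' v : a \in A1 -> a' \in A1 -> v \in W1 a -> v \in W1 a' -> a = a'.
  move=> aA a'A va va'; apply/eqP; apply/negPn/negP=> naa'.
  have /pred0P/(_ v) := d1 a a' aA a'A naa'.
  by rewrite /= (subsetP (proj1 (hW1 a aA)) _ va) (subsetP (proj1 (hW1 a' a'A)) _ va').
have dW2 a a' v : a \in A2 -> a' \in A2 -> v \in W2 a -> v \in W2 a' -> a = a'.
  move=> aA a'A va va'; apply/eqP; apply/negPn/negP=> naa'.
  have /pred0P/(_ v) := d2 a a' aA a'A naa'.
  by rewrite /= (subsetP (proj1 (hW2 a aA)) _ va) (subsetP (proj1 (hW2 a' a'A)) _ va').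
have t1inj : {in A1 &, injective t1}.
  by move=> a a' aA a'A tt; have h := t1V a' a'A; rewrite -tt in h; exact: (dW1 _ _ _ aA a'A (t1V a aA) h).
have t1im : t1 @: A1 = x |: S.
  apply/eqP; rewrite eqEcard card_in_imset // cA1 cx leqnn andbT.
  by apply/subsetP=> _ /imsetP[a aA ->]; have [] := r1 a aA.
have only1 a v : a \in A1 -> v \in W1 a -> v \in x |: S -> v = t1 a.
  move=> aA va; rewrite -t1im => /imsetP[a' a'A vE]; rewrite vE.
  by congr t1; have h := t1V a' a'A; rewrite -vE in h; exact: (dW1 _ _ _ a'A aA h va).
have only2 s v : s \in A2 -> v \in W2 s -> v \in y |: S -> v = s.
  by rewrite -A2E => sA vs vA; apply: (@dW2 _ _ v) => //; have [_ []] := hW2 v vA.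
(* Otherwise the first path up to [v] and the second path from [v] on would connect [A] to [B] in
   [e'] without meeting [S]. *)
have cross a s v : a \in A1 -> s \in A2 -> v \in W1 a -> v \in W2 s -> v \in S.
  move=> aA sA va vs; apply/negPn/negP=> vS.
  have [_ [aW c1 p1 _]] := hW1 a aA; have [_ [sW c2 _ p2]] := hW2 s sA.
  have av : connect (induced e' (~: S)) a v.
    have [vt|vt] := eqVneq v (t1 a).
      rewrite vt; apply: connect_induced_sub c1; apply/subsetP=> u uW; rewrite inE.
      by apply: contra vS => uS; rewrite vt -(only1 a u) // inE uS orbT.
    apply: connect_induced_sub (p1 v va vt); apply/subsetP=> u /setD1P[ut uW]; rewrite inE.
    by apply: contra ut => uS; rewrite -(only1 a u) // inE uS orbT.
  have vb : connect (induced e' (~: S)) v (t2 s).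
    have [vt|vt] := eqVneq v s.
      rewrite vt; apply: connect_induced_sub c2; apply/subsetP=> u uW; rewrite inE.
      by apply: contra vS => uS; rewrite vt -(only2 s u) // inE uS orbT.
    apply: connect_induced_sub (p2 v vs vt); apply/subsetP=> u /setD1P[ut uW]; rewrite inE.
    by apply: contra ut => uS; rewrite -(only2 s u) // inE uS orbT.
  have aS : a \notin S by have := connect_induced_start av; rewrite !inE; apply.
  have bS : t2 s \notin S by have := connect_induced_end vb; rewrite !inE; apply.
  have [_ bB _] := r2 s sA.
  by have := sS a (t2 s) (subsetP sA1 _ aA) bB aS bS; rewrite (connect_trans av vb).
(* A path ending at [x] is continued from [y] through the deleted arc; a path ending in [S] is
   continued from the same vertex. *)
pose phi s := if s == x then y else s.
have phiA a : a \in A1 -> phi (t1 a) \in A2.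
  move=> aA; have [_ tS _] := r1 a aA; rewrite A2E /phi !inE.
  by move: tS; rewrite !inE; case: eqP => _ /=; rewrite ?eqxx // => ->; rewrite orbT.
have phiinj a a' : a \in A1 -> a' \in A1 -> phi (t1 a) = phi (t1 a') -> a = a'.
  move=> aA a'A; have [_ tS _] := r1 a aA; have [_ tS' _] := r1 a' a'A.
  rewrite /phi; move: tS tS'; rewrite !inE.
  case: eqP => [e1|_] /=; case: eqP => [e2|_] /= u1 u2 E; apply: t1inj => //.
  - by rewrite e1 e2.
  - by case/negP: yS; rewrite E.
  - by case/negP: yS; rewrite -E.
exists A1, (fun a => W1 a :|: W2 (phi (t1 a))), (fun a => t2 (phi (t1 a))); split=> //.
  move=> a aA; have pA := phiA a aA.
  have [_ [aW c1 _ _]] := hW1 a aA; have [_ [sW c2 _ _]] := hW2 _ pA.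
  have [_ bB _] := r2 _ pA; split=> //; first by rewrite inE aW.
  apply: (@connect_trans _ _ (phi (t1 a))); last first.
    by apply: connect_induced_sub (subsetUr _ _) _; apply: cone.
  apply: (@connect_trans _ _ (t1 a)).
    by apply: connect_induced_sub (subsetUl _ _) _; apply: cone.
  rewrite {2}/phi; case: eqP => [tx|_]; last exact: connect0.
  apply: connect1; apply/and3P; split; first by rewrite tx.
    by rewrite inE t1V.
  by rewrite inE; apply/orP; right; move: sW; rewrite {1}/phi tx eqxx.
move=> a a' aA a'A naa'; apply/pred0P=> v /=; apply/negP=> /andP[].
have sub1 b b' : b \in A1 -> b' \in A1 -> v \in W1 b -> v \in W2 (phi (t1 b')) -> b = b'.
  move=> bA b'A v1 v2; have vS := cross _ _ _ bA (phiA _ b'A) v1 v2.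
  have vt := only1 b v bA v1 (setU1r _ vS).
  have vs := only2 _ v (phiA _ b'A) v2 (setU1r _ vS).
  apply: phiinj => //; rewrite -vs {1}/phi -vt.
  by case: eqP => // vx; case/negP: xS; rewrite -vx.
rewrite !inE => /orP[v1|v1] /orP[v2|v2]; case/eqP: naa'.
- exact: (dW1 _ _ v).
- exact: sub1.
- by apply/esym; apply: sub1.
by apply: phiinj => //; apply: (@dW2 _ _ v); rewrite ?phiA.
Qed.
End Menger.

(** * The rank function measuring separation from a bramble *)

Section BlockingRank.
Variables (T : finType) (e : rel T) (beta : {set T} -> {set T}) (h : nat).
Implicit Types (A B U X Y : {set T}).
Hypothesis beta_ne : forall X, #|X| <= 2 * h -> exists v, v \in beta X.
Hypothesis beta_notin : forall X v, #|X| <= 2 * h -> v \in beta X -> v \notin X.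
Hypothesis beta_connect : forall X u v, #|X| <= 2 * h -> u \in beta X -> v \in beta X ->
  connect (induced e (~: X)) u v.
Hypothesis beta_sub : forall X Y, #|X| <= 2 * h -> #|Y| <= 2 * h ->
  [disjoint beta Y & X] -> beta Y \subset beta X.

Definition reaches X a := [exists b in beta X, connect (induced e (~: X)) a b].
(** Truncation at [h]: two blockers smaller than [h] have a union of size at most [2 * h], where
    [beta] is still controlled. *)
Definition blocks X A := (h <= #|X|) || [forall a in A, (a \in X) || ~~ reaches X a].
Definition blocking_rank A := #|[arg min_(X < [set: T] | blocks X A) #|X| ]|.

Lemma blocksT A : blocks [set: T] A.
Proof. by apply/orP; right; apply/forall_inP=> a _; rewrite inE. Qed.

Lemma blocking_rankP A : exists2 X, blocks X A & blocking_rank A = #|X|.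
Proof.
by rewrite /blocking_rank; case: arg_minnP => [|X bX _]; [exact: blocksT | exists X].
Qed.

Lemma blocking_rank_le A X : blocks X A -> blocking_rank A <= #|X|.
Proof.
by rewrite /blocking_rank; case: arg_minnP => [|Y bY]; [exact: blocksT | apply].
Qed.

Lemma blocking_rank_mono A B : A \subset B -> blocking_rank A <= blocking_rank B.
Proof.
move=> sAB; have [X bX ->] := blocking_rankP B; apply: blocking_rank_le.
case/orP: bX => [hX|/forall_inP H]; first by rewrite /blocks hX.
by apply/orP; right; apply/forall_inP=> a /(subsetP sAB); apply: H.
Qed.

Lemma beta_sub_subset X Y : X \subset Y -> #|Y| <= 2 * h -> beta Y \subset beta X.
Proof.
move=> sXY cY; apply: beta_sub => //; first exact: leq_trans (subset_leq_card sXY) cY.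
rewrite disjoint_subset; apply/subsetP=> v /(beta_notin cY); rewrite inE.
by apply: contra; apply: subsetP.
Qed.

(** A walk from [U] to [beta X] could be prolonged in [G - X] to a vertex of [beta Y], which is
    contained in [beta X]; but no walk of [G - X] leaves [U]. *)
Lemma blocks_closed A U X Y : X \subset Y -> #|Y| <= 2 * h -> [disjoint U & beta Y] ->
  (forall a c, a \in U -> e a c -> c \notin X -> c \in U) -> A \subset U :|: X -> blocks X A.
Proof.
move=> sXY cY dUY cl sA; apply/orP; right; apply/forall_inP=> a /(subsetP sA).
have [//|aX] := boolP (a \in X); rewrite inE (negPf aX) orbF => aU /=.
apply/existsP=> -[b /andP[bX /= ab]].
have clc u v : u \in U -> connect (induced e (~: X)) u v -> v \in U.
  move=> uU /connectP[p pth ->]; elim: p u uU pth => //= c p IH u uU.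
  case/andP=> /and3P[euc _ cX]; apply: IH; apply: (cl u) => //; by rewrite inE in cX.
have [c cY'] := beta_ne cY.
have cX : #|X| <= 2 * h by apply: leq_trans (subset_leq_card sXY) cY.
have cXb := subsetP (beta_sub_subset sXY cY) _ cY'.
have cU : c \in U by apply: (clc a) => //; apply: connect_trans ab (beta_connect cX bX cXb).
by have /pred0P/(_ c) := dUY; rewrite /= cU cY'.
Qed.

(** Uncrossing of two minimum cuts. The sets [O X1] and [O X2] of vertices cut off by the blockers
    are closed under arcs that avoid the blocker. The corner cuts [XI] and [XU] bound their
    intersection and union, and have together no more vertices than [X1] and [X2]. *)
Lemma blocking_rank_submod A B :
  blocking_rank (A :&: B) + blocking_rank (A :|: B) <= blocking_rank A + blocking_rank B.
Proof.
have [X1 b1 e1] := blocking_rankP A; have [X2 b2 e2] := blocking_rankP B.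
have [h1|h1] := leqP h #|X1|.
  rewrite addnC leq_add //; last by apply: blocking_rank_mono; apply: subsetIr.
  by rewrite e1; apply: blocking_rank_le; rewrite /blocks h1.
have [h2|h2] := leqP h #|X2|.
  rewrite leq_add //; first by apply: blocking_rank_mono; apply: subsetIl.
  by rewrite e2; apply: blocking_rank_le; rewrite /blocks h2.
pose O X := [set a | (a \notin X) && ~~ reaches X a].
have bO X C : blocks X C -> #|X| < h -> C \subset O X :|: X.
  rewrite /blocks leqNgt => + lt; rewrite lt /= => /forall_inP H; apply/subsetP=> a /H.
  by rewrite !inE; case: (a \in X); rewrite ?orbT //= orbF.
have clO X a c : a \in O X -> e a c -> c \notin X -> c \in O X.
  rewrite !inE => /andP[aX na] eac cX; rewrite cX /=; apply: contra na.
  case/existsP=> b /andP[bX cb]; apply/existsP; exists b; rewrite bX /=.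
  by apply: connect_trans cb; apply: connect1; rewrite /induced /= eac !inE aX cX.
pose Y := X1 :|: X2.
have cY : #|Y| <= 2 * h by apply: leq_trans (leq_card_setU _ _) _; move: h1 h2; clear; lia.
have dO X : X \subset Y -> [disjoint O X & beta Y].
  move=> sX; apply/pred0P=> c /=; apply/negP=> /andP[]; rewrite inE => /andP[cX na] cY'.
  case/negP: na; apply/existsP; exists c; rewrite connect0 andbT.
  exact: (subsetP (beta_sub_subset sX cY)).
have s1 : X1 \subset Y := subsetUl _ _; have s2 : X2 \subset Y := subsetUr _ _.
have nO X a : a \in O X -> a \notin X by rewrite inE => /andP[].
pose XU := (X1 :\: O X2) :|: (X2 :\: O X1).
pose XI := (X1 :&: O X2) :|: (X2 :&: O X1) :|: (X1 :&: X2).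
have A1 := bO _ _ b1 h1; have A2 := bO _ _ b2 h2.
have bU : blocks XU (A :|: B).
  apply: (@blocks_closed _ (O X1 :|: O X2) _ Y) => //.
  - by rewrite subUset !(subset_trans (subsetDl _ _)).
  - by rewrite -setI_eq0 setIUl setU_eq0 !setI_eq0 !dO.
  - move=> a c; rewrite !in_setU !in_setD => /orP[aO|aO] eac; rewrite negb_or !negb_and !negbK.
      case: (boolP (c \in X1)) => [_ /andP[]|c1 _]; first by rewrite orbF => ->; rewrite orbT.
      by rewrite (clO _ _ _ aO eac c1).
    case: (boolP (c \in X2)) => [_ /andP[_]|c2 _]; first by rewrite orbF => ->.
    by rewrite (clO _ _ _ aO eac c2) orbT.
  rewrite subUset; apply/andP; split; apply/subsetP=> a.
    move/(subsetP A1); rewrite !in_setU !in_setD => /orP[->//|->].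
    by case: (a \in O X2); rewrite ?orbT.
  move/(subsetP A2); rewrite !in_setU !in_setD => /orP[->|->]; rewrite ?orbT //.
  by case: (a \in O X1); rewrite ?orbT.
have bI : blocks XI (A :&: B).
  apply: (@blocks_closed _ (O X1 :&: O X2) _ Y) => //.
  - rewrite !subUset (subset_trans (subsetIl _ _) s1) (subset_trans (subsetIl _ _) s2).
    exact: (subset_trans (subsetIl _ _) s1).
  - by rewrite (disjointWl (subsetIl _ _)) // dO.
  - move=> a c; rewrite !in_setU !in_setI => /andP[a1 a2] eac; rewrite !negb_or !negb_and.
    case: (boolP (c \in X1)) => [_|c1].
      case: (boolP (c \in X2)) => [_|c2] /=; first by rewrite andbF.
      by rewrite (clO _ _ _ a2 eac c2).
    rewrite (clO _ _ _ a1 eac c1) /= orbF.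
    case: (boolP (c \in X2)) => //= c2 _.
    by rewrite (clO _ _ _ a2 eac c2).
  apply/subsetP=> a; rewrite inE => /andP[/(subsetP A1) + /(subsetP A2)].
  rewrite !in_setU !in_setI => /orP[->|->] /orP[->|->]; rewrite ?orbT //.
apply: leq_trans (leq_add (blocking_rank_le bI) (blocking_rank_le bU)) _.
rewrite e1 e2 addnC -cardsUI -[X in _ <= X]cardsUI; apply: leq_add; apply: subset_leq_card.
  apply/subsetP=> a; rewrite !in_setU !in_setD !in_setI.
  by case: (a \in X1); case: (a \in X2) => //=; rewrite ?andbF.
apply/subsetP=> a; rewrite in_setI => /andP[].
rewrite !in_setU !in_setD !in_setI; have := nO X1 a; have := nO X2 a.
by case: (a \in X1); case: (a \in X2); case: (a \in O X1) => /=; case: (a \in O X2) => //= *; exfalso; auto.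
Qed.

Lemma blocking_rank_matroid : matroid_rank blocking_rank.
Proof.
split.
- apply/eqP; rewrite -leqn0 -(cards0 T); apply: blocking_rank_le.
  by apply/orP; right; apply/forall_inP=> a; rewrite inE.
- exact: blocking_rank_mono.
- move=> A x; have [X bX ->] := blocking_rankP A.
  apply: leq_trans (_ : #|x |: X| <= _); last by rewrite cardsU1; case: (x \in X).
  apply: blocking_rank_le; rewrite /blocks; have [//|lt /=] := leqP h #|x |: X|.
  have sX : X \subset x |: X := subsetUr _ _.
  have ltX := leq_ltn_trans (subset_leq_card sX) lt.
  move: bX; rewrite /blocks leqNgt ltX /= => /forall_inP H.
  apply/forall_inP=> a; rewrite !inE => /predU1P[->|/H]; first by rewrite eqxx.
  case/orP=> [->|na]; first by rewrite orbT.
  apply/orP; right; apply: contra na => /existsP[b /andP[bX ab]]; apply/existsP; exists b.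
  have cX : #|x |: X| <= 2 * h by move: lt; clear; lia.
  rewrite (subsetP (beta_sub_subset sX cX)) //=.
  by apply: connect_induced_sub ab; rewrite setCS.
exact: blocking_rank_submod.
Qed.

(** The rank rises by at most one per added element, so a subset of the independent set [I] is
    independent and has no blocker smaller than itself. *)
Lemma blocking_rank_unblocked (I : {set T}) A X :
  #|I| <= h -> blocking_rank I = #|I| -> A \subset I -> #|X| < #|A| ->
  exists2 a, a \in A & (a \notin X) && reaches X a.
Proof.
move=> cI rI sA lt.
have rU C : blocking_rank (A :|: C) <= blocking_rank A + #|C|.
  have [n] := ubnP #|C|; elim: n C => // n IH C cC.
  have [->|[x xC]] := set_0Vmem C; first by rewrite setU0 cards0 addn0.
  have [_ _ r1 _] := blocking_rank_matroid.
  rewrite -(setD1K xC) setUCA; apply: leq_trans (r1 _ _) _.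
  rewrite (cardsD1 x (x |: _)) !inE eqxx /= setU1K ?inE ?eqxx // add1n addnS ltnS; apply: IH.
  by move: cC; rewrite (cardsD1 x C) xC add1n ltnS.
have EI := setID I A; rewrite (setIidPr sA) in EI.
have := rU (I :\: A); rewrite EI rI cardsD (setIidPr sA) => le.
case: (pickP [pred a in A | (a \notin X) && reaches X a]) => [a /= /andP[aA H]|no]; first by exists a.
have bX : blocks X A.
  apply/orP; right; apply/forall_inP=> a aA; have := no a; rewrite /= aA /=.
  by case: (a \in X) => //= ->.
have := blocking_rank_le bX; move: le lt (subset_leq_card sA); clear; lia.
Qed.
End BlockingRank.

(** Only the vertex sets of the paths are recorded. Their disjointness makes [t] injective, hence a
    bijection onto [B] when [#|A| = #|B|]. *)
Definition linkage (T : finType) (e : rel T) (A B : {set T}) (V : T -> {set T}) (t : T -> T) :=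
  (forall a, a \in A -> route e (V a) a (t a) /\ t a \in B) /\
  (forall a a', a \in A -> a' \in A -> a != a' -> [disjoint V a & V a']).

(** * A path carrying a large well-linked set *)

Section WellLinkedPath.
Variables (T : finType) (e : rel T) (S : {set T}) (h : nat).
Implicit Types (A B U X Y I : {set T}).
Hypothesis haven : forall X, #|X| <= 2 * h ->
  exists2 v, v \notin X & #|S| < 2 * #|scc e X v :&: S|.

(** By [haven], the default [set0] does not occur when [#|X| <= 2 * h]. *)
Let beta X := if [pick v | (v \notin X) && (#|S| < 2 * #|scc e X v :&: S|)] is Some v
              then scc e X v else set0.

Let betaP X : #|X| <= 2 * h -> exists v, [/\ v \notin X, beta X = scc e X v & #|S| < 2 * #|beta X :&: S|].
Proof.
move=> cX; rewrite /beta; case: pickP => [v /andP[vX lt]|no]; first by exists v.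
by have [v vX lt] := haven cX; have := no v; rewrite vX lt.
Qed.

Let beta_scc X v : #|X| <= 2 * h -> v \in beta X -> beta X = scc e X v.
Proof. by move=> cX; have [u [_ -> _]] := betaP cX => vu; rewrite (scc_eq vu). Qed.

Let beta_ne X : #|X| <= 2 * h -> exists v, v \in beta X.
Proof. by move=> cX; have [u [uX E _]] := betaP cX; exists u; rewrite E scc_refl. Qed.

Let beta_notin X v : #|X| <= 2 * h -> v \in beta X -> v \notin X.
Proof. by move=> cX; have [u [uX -> _]] := betaP cX => /scc_notin. Qed.

Let beta_meet X Y : #|X| <= 2 * h -> #|Y| <= 2 * h -> exists2 v, v \in beta X & v \in beta Y.
Proof.
move=> cX cY; have [_ [_ _ lX]] := betaP cX; have [_ [_ _ lY]] := betaP cY.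
case: (set_0Vmem (beta X :&: beta Y)) => [E|[v /setIP[]]]; last by exists v.
have := subset_leq_card (_ : (beta X :&: S) :|: (beta Y :&: S) \subset S).
rewrite subUset !subsetIr cardsU setIACA E set0I cards0 subn0 => /(_ isT).
by move: lX lY; clear; lia.
Qed.

Let beta_sub X Y : #|X| <= 2 * h -> #|Y| <= 2 * h ->
  [disjoint beta Y & X] -> beta Y \subset beta X.
Proof.
move=> cX cY dj; have [v vX vY] := beta_meet cX cY.
rewrite (beta_scc cX vX) (beta_scc cY vY); apply: scc_sub; first exact: beta_notin vX.
by move=> x; rewrite -(beta_scc cY vY) => xY; apply/negP=> xX; have /pred0P/(_ x) := dj; rewrite /= xY xX.
Qed.

Let beta_connect X u v : #|X| <= 2 * h -> u \in beta X -> v \in beta X ->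
  connect (induced e (~: X)) u v.
Proof. by move=> cX uX; rewrite (beta_scc cX uX) inE => /and4P[]. Qed.

(** A strong component is strongly connected inside itself: [scc_sub] is applied with the complement
    of the component as the new removed set. *)
Let beta_connect_in X u v : #|X| <= 2 * h -> u \in beta X -> v \in beta X ->
  connect (induced e (beta X)) u v.
Proof.
move=> cX uX vX; have uS : u \notin ~: beta X by rewrite inE uX.
have : scc e X u \subset scc e (~: beta X) u.
  by apply: scc_sub => // x; rewrite -(beta_scc cX uX) inE => ->.
by move/subsetP/(_ v); rewrite -(beta_scc cX uX) vX inE setCK => /(_ isT)/and4P[].
Qed.

(* Every element of the bramble is met: the path is extended inside the last
   element it entered until it enters an element missed so far. *)
Lemma path_meeting_haven : exists x p, [/\ uniq (x :: p), path e x p &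
  forall X, #|X| <= 2 * h -> exists2 v, v \in beta X & v \in x :: p].
Proof.
have c0 : #|set0 : {set T}| <= 2 * h by rewrite cards0.
(* Invariant: the end of the path is its only vertex in [beta X0], so an extension inside [beta X0]
   does not touch the path again. *)
suff main n : forall x p X0, #|T| - size p < n -> uniq (x :: p) -> path e x p ->
    #|X0| <= 2 * h -> last x p \in beta X0 ->
    (forall u, u \in x :: p -> u \in beta X0 -> u = last x p) ->
    exists x p, [/\ uniq (x :: p), path e x p &
      forall X, #|X| <= 2 * h -> exists2 v, v \in beta X & v \in x :: p].
  have [v v0] := beta_ne c0; apply: (main #|T|.+1 v [::] set0) => //=; first by rewrite subn0.
  by move=> u; rewrite inE => /eqP.
elim: n => // n IH x p X0 lt un pth c0' yX0 only.
case: (boolP [forall X : {set T}, (#|X| <= 2 * h) ==> has (mem (beta X)) (x :: p)]).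
  move/forallP=> H; exists x, p; split=> // X cX.
  by have /hasP[v vp vX] := implyP (H X) cX; exists v.
case/forallPn=> X1; rewrite negb_imply => /andP[c1 /hasPn no].
have [z z0 z1] := beta_meet c0' c1.
have /connectP[q0 pq0 zE] := beta_connect_in c0' yX0 z0.
case/shortenP: pq0 zE => q pq uq _ zE.
have qb : {subset q <= beta X0}.
  by elim: q (last x p) pq {uq zE} => //= c q IHq y /andP[/and3P[_ _ cb] /IHq H] u; rewrite inE => /predU1P[->|/H].
have nolast u : u \in beta X1 -> u \notin x :: p by move=> u1; apply/negP=> /no; rewrite /= u1.
have hq : has (mem (beta X1)) q.
  apply/hasP; exists z => //; case: q zE {pq uq qb} => [|c q] /= zE.
    by have := nolast z z1; rewrite zE mem_last.
  by rewrite zE mem_last.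
case: (split_find hq) pq uq qb {zE} => u q1 q2 u1 no1 pq uq qb.
have uq1 : uniq (last x p :: rcons q1 u) by move: uq; rewrite -cat_cons cat_uniq => /andP[].
have pq1 : path e (last x p) (rcons q1 u).
  by move: pq; rewrite cat_path => /andP[pq _]; apply: sub_path pq => ? ? /and3P[].
apply: (IH x (p ++ rcons q1 u) X1).
- have sz : size p < #|T|.
    by have := max_card (mem (x :: p)); rewrite (card_uniqP un).
  by rewrite size_cat size_rcons; move: lt sz; clear; lia.
- rewrite -cat_cons cat_uniq un; move: uq1; rewrite cons_uniq => /andP[n1 u2]; rewrite u2 andbT /=.
  apply/hasPn=> c cq; apply/negP=> cp; case/negP: n1; rewrite -(only c cp) //.
  by apply: qb; rewrite mem_cat cq.
- by rewrite cat_path pth.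
- exact: c1.
- by rewrite last_cat last_rcons.
move=> c; rewrite last_cat last_rcons -cat_cons mem_cat mem_rcons inE => /or3P[cp|/eqP//|cq] c1'.
  by have := nolast c c1'; rewrite inE cp.
by case/hasP: no1; exists c.
Qed.

(** [r1] measures how well a set reaches the bramble and [r2], computed in the reversed digraph, how
    well it is reached. A common independent set on the path is well linked, since after the removal
    of a small [X] one can travel through [beta X]. *)
Theorem well_linked_path : exists x p I, [/\ uniq (x :: p), path e x p,
  I \subset [set v in x :: p], #|I| = h &
  forall A B, A \subset I -> B \subset I -> #|A| = #|B| -> exists V t, linkage e A B V t].
Proof.
have [x [p [un pth hit]]] := path_meeting_haven.
pose e' : rel T := [rel u v | e v u].
have revE Q u v : connect (induced e' Q) u v = connect (induced e Q) v u.
  have := connect_rev (induced e Q) u v; rewrite /= => <-.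
  by apply: eq_connect => a b; rewrite /induced /= [(a \in Q) && _]andbC.
pose r1 := blocking_rank e beta h; pose r2 := blocking_rank e' beta h.
have bc' X u v : #|X| <= 2 * h -> u \in beta X -> v \in beta X -> connect (induced e' (~: X)) u v.
  by move=> cX uX vX; rewrite revE; apply: beta_connect.
have R1 : matroid_rank r1 by apply: blocking_rank_matroid.
have R2 : matroid_rank r2 by apply: blocking_rank_matroid.
(* If both blockers are smaller than [h], the path has a vertex [v] in [beta (X1 :|: X2)], hence in
   [beta X1] and in [beta X2]. Whether [v] lies in [U] or not, one of the blockers fails to block
   it. *)
have [U _|I [sI cI i1 i2]] := @matroid_intersection _ r1 r2 [set v in x :: p] h R1 R2.
  rewrite /r1 /r2; set E := [set v in x :: p].
  have [X1 b1 ->] := blocking_rankP e beta h U.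
  have [X2 b2 ->] := blocking_rankP e' beta h (E :\: U).
  have [h1|h1] := leqP h #|X1|; first by rewrite (leq_trans h1) ?leq_addr.
  have [h2|h2] := leqP h #|X2|; first by rewrite (leq_trans h2) ?leq_addl.
  have cY : #|X1 :|: X2| <= 2 * h.
    by apply: leq_trans (leq_card_setU _ _) _; move: h1 h2; clear; lia.
  have [v vY vp] := hit _ cY.
  have vE : v \in E by rewrite inE.
  have v1 : v \in beta X1 by apply: (subsetP (beta_sub_subset beta_notin beta_sub (subsetUl X1 X2) cY)).
  have v2 : v \in beta X2 by apply: (subsetP (beta_sub_subset beta_notin beta_sub (subsetUr X1 X2) cY)).
  have := beta_notin cY vY; rewrite inE negb_or => /andP[n1 n2]; exfalso.
  move: b1 b2; rewrite /blocks leqNgt h1 leqNgt h2 /= => /forall_inP H1 /forall_inP H2.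
  case: (boolP (v \in U)) => vU.
    have := H1 v vU; rewrite (negPf n1) /= => /existsP; apply; exists v; by rewrite v1 connect0.
  have := H2 v; rewrite inE vU vE (negPf n2) /= => /(_ isT)/existsP; apply; exists v; by rewrite v2 connect0.
exists x, p, I; split=> // A B sA sB cAB.
have [|A0 [V [t [sA0 cA0 r d]]]] := @Menger _ e A B #|A|.
  (* Some vertex of [A] reaches [beta X] in [G - X], some vertex of [B] is reached from it, and
     [beta X] joins the two. *)
  move=> X sep; rewrite leqNgt; apply/negP=> lt.
  have [a aA /andP[aX /existsP[b /andP[bX ab]]]] :
    exists2 a, a \in A & (a \notin X) && reaches e beta X a.
    by apply: (@blocking_rank_unblocked _ e beta h) sA lt => //; rewrite ?cI.
  have [c cB /andP[nc /existsP[d /andP[dX cd]]]] :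
    exists2 a, a \in B & (a \notin X) && reaches e' beta X a.
    by rewrite cAB in lt; apply: (@blocking_rank_unblocked _ e' beta h) sB lt => //; rewrite ?cI.
  rewrite revE in cd; have cX : #|X| <= 2 * h.
    by move: lt (subset_leq_card sA); rewrite cI; clear; lia.
  have := sep a c aA cB aX nc; rewrite (connect_trans ab) //.
  exact: connect_trans (beta_connect cX bX dX) cd.
have A0E : A0 = A by apply/eqP; rewrite eqEcard sA0 cA0 leqnn.
rewrite {}A0E in cA0 r d.
have /fin_all_exists[W hW] : forall a, exists W : {set T}, a \in A -> W \subset V a /\ route e W a (t a).
  move=> a; case: (boolP (a \in A)) => [aA|]; last by exists set0.
  by have [aV _ c] := r a aA; have [W ? ?] := routeP aV c; exists W.
exists W, t; split.
  by move=> a aA; have [_ tB _] := r a aA; have [_ ?] := hW a aA.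
move=> a a' aA a'A naa'; have [s _] := hW a aA; have [s' _] := hW a' a'A.
by apply: disjointWl s _; apply: disjointWr s' _; apply: d.
Qed.
End WellLinkedPath.

Corollary dtw_le_or_well_linked_path (T : finType) (e : rel T) (h : nat) :
  dtw_le e (6 * h + 2) \/
  exists x p (I : {set T}), [/\ uniq (x :: p), path e x p,
    I \subset [set v in x :: p], #|I| = h &
    forall A B : {set T}, A \subset I -> B \subset I -> #|A| = #|B| ->
      exists V t, linkage e A B V t].
Proof.
have [] := dtw_le_or_haven e (2 * h); first by left; rewrite -(mulnA 3 2 h).
by case=> S hS; right; apply: well_linked_path hS.
Qed.

(** * Vertex sets containing a cycle, and chains of linked walks *)

Section Cyclic.
Variables (T : finType) (e : rel T).
Implicit Types (Q Y C : {set T}) (x y z : T).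

(** A boolean form of: the subgraph induced by [Q] contains a directed cycle. *)
Definition cyclic Q := [exists C : {set T},
  [&& C \subset Q, C != set0 & [forall x in C, [exists y in C, e x y]]]].

(** Follow a fixed out-neighbour [f] inside [C]. If the forward orbit of [x] is smallest, the orbit
    of [f x] equals it and contains [x], so the orbit of [x] is a cycle. *)
Lemma cyclicP Q : cyclic Q -> exists2 c, directed_cycle e c & {subset c <= Q}.
Proof.
case/existsP=> C /and3P[sC /set0Pn[x0 x0C] /forall_inP H].
pose f x := odflt x [pick y in C | e x y].
have fP x : x \in C -> (f x \in C) && e x (f x).
  move=> xC; rewrite /f; case: pickP => //= no.
  by have /existsP[y] := H x xC; rewrite no.
have [x xC minx] := @arg_minnP T x0 (mem C) (fun x => #|fconnect f x|) x0C.
have cf : x \in fconnect f (f x).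
  have /andP[fC _] := fP x xC; have le := minx (f x) fC.
  have sub : fconnect f (f x) \subset fconnect f x.
    by apply/subsetP=> y; rewrite !inE; apply: connect_trans; apply: fconnect1.
  have /subset_cardP : #|fconnect f (f x)| = #|fconnect f x|.
    by apply/eqP; rewrite eqn_leq le subset_leq_card.
  by move/(_ sub) => E; rewrite E inE connect0.
have oC : {subset orbit f x <= C}.
  move=> y; rewrite -fconnect_orbit => /iter_findex <-.
  by elim: (findex _ _ _) => //= n /fP/andP[].
exists (orbit f x); last by move=> y /oC; apply: subsetP.
split.
- by rewrite -size_eq0 size_orbit -lt0n order_gt0.
- exact: orbit_uniq.
have : fcycle f (orbit f x) by apply/(orbitPcycle 0 2).
apply: (@sub_in_cycle _ (mem C)); last by apply/allP.
by move=> y z yC _ /eqP <-; case/andP: (fP y yC).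
Qed.

(** Reachability by a walk with at least one arc, so that [connect_plus Q x x] yields a cycle. *)
Definition connect_plus Q x y :=
  [exists z, [&& e x z, x \in Q, z \in Q & connect (induced e Q) z y]].

Lemma connect_plus_sub Q Q' x y : Q \subset Q' -> connect_plus Q x y -> connect_plus Q' x y.
Proof.
move=> /[dup] sQ /subsetP s /existsP[z /and4P[a b c d]]; apply/existsP; exists z.
by rewrite a !s // (connect_induced_sub sQ).
Qed.

Lemma connect_plus_trans Q x y z :
  connect_plus Q x y -> connect (induced e Q) y z -> connect_plus Q x z.
Proof.
case/existsP=> u /and4P[a b c d] yz; apply/existsP; exists u.
by rewrite a b c (connect_trans d).
Qed.

Lemma connect_plusW Q x y : connect_plus Q x y -> connect (induced e Q) x y.
Proof.
case/existsP=> u /and4P[a b c d]; apply: connect_trans d.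
by apply: connect1; rewrite /induced /= a b c.
Qed.

Lemma connect_connect_plus Q x y z :
  connect (induced e Q) x y -> connect_plus Q y z -> connect_plus Q x z.
Proof.
case/connectP=> p; elim: p x => [|u p IH] x /=; first by move=> _ ->.
case/andP=> /and3P[a b c] pth E /(IH _ pth E) /connect_plusW d; apply/existsP; exists u.
by rewrite a b c d.
Qed.

Lemma connect_neq_plus Q x y : connect (induced e Q) x y -> x != y -> connect_plus Q x y.
Proof.
case/connectP=> [[|u p]] /=; first by move=> _ ->; rewrite eqxx.
case/andP=> /and3P[a b c] pth E _; apply/existsP; exists u; rewrite a b c E /=.
by apply/connectP; exists p.
Qed.

Lemma connect_plus_mem Q x y : connect_plus Q x y -> (x \in Q) && (y \in Q).
Proof.
by case/existsP=> u /and4P[a b c d]; rewrite b (connect_induced_end d).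
Qed.

Lemma cyclic_of_connect_plus Q Y y0 : y0 \in Y ->
  (forall y, y \in Y -> exists2 y', y' \in Y & connect_plus Q y y') -> cyclic Q.
Proof.
move=> y0Y H; pose C := [set z in Q | [exists y in Y, connect (induced e Q) z y]].
have YC y : y \in Y -> y \in C.
  move=> yY; have [y' y'Y yy'] := H y yY; rewrite inE; case/andP: (connect_plus_mem yy') => -> _.
  by apply/existsP; exists y; rewrite yY connect0.
apply/existsP; exists C; apply/and3P; split.
- by apply/subsetP=> z; rewrite inE => /andP[].
- by apply/set0Pn; exists y0; apply: YC.
apply/forall_inP=> z; rewrite inE => /andP[zQ /existsP[y /andP[yY zy]]].
have [y' y'Y yy'] := H y yY.
have /existsP[u /and4P[a b c d]] := connect_connect_plus zy yy'.
apply/existsP; exists u; rewrite a andbT inE c; apply/existsP; exists y'.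
by rewrite y'Y.
Qed.

Lemma cyclic_of_loop Q x : connect_plus Q x x -> cyclic Q.
Proof.
by move=> xx; apply: (@cyclic_of_connect_plus Q [set x] x); rewrite ?inE // => y /set1P->; exists x; rewrite ?inE.
Qed.

Definition packing k p := exists Qs : seq {set T},
  [/\ size Qs = k, all cyclic Qs & forall v, count (fun Q => v \in Q) Qs <= p].

Lemma packing_has_cycle_family k p : packing k p -> has_cycle_family e k p.
Proof.
case=> Qs [sz cyc cnt].
suff [F [sF cF le]] : exists F : seq (seq T), [/\ size F = size Qs,
    forall c, c \in F -> directed_cycle e c &
    forall v, count (fun c => v \in c) F <= count (fun Q : {set T} => v \in Q) Qs].
  by exists F; split; rewrite -?sz // => v; apply: leq_trans (le v) (cnt v).
elim: Qs {sz cnt} cyc => [|Q Qs IH] /=; first by exists [::].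
case/andP=> /cyclicP[c dc sc] /IH[F [sF cF le]]; exists (c :: F); split.
- by rewrite /= sF.
- by move=> d; rewrite inE => /predU1P[->|/cF].
move=> v /=; apply: leq_add => //.
by case: (boolP (v \in c)) => // /sc ->.
Qed.

Section Chains.
Variables (U : eqType) (R : U -> {set T}).
Implicit Types (c : seq U) (u v : U).

(** The units [R u] stand for walks, and [link u v] says that the walk [R u] can be continued by the
    walk [R v]. *)
Definition link u v := [forall x in R u, [forall y in R v, connect_plus (R u :|: R v) x y]].
Definition span c : {set T} := \bigcup_(u <- c) R u.

Lemma mem_span c x : (x \in span c) = has (fun u => x \in R u) c.
Proof.
by rewrite /span; elim: c => [|u c IH] /=; rewrite ?big_nil ?inE // big_cons inE IH.
Qed.

Lemma sub_span c u : u \in c -> R u \subset span c.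
Proof. by move=> uc; apply/subsetP=> x xu; rewrite mem_span; apply/hasP; exists u. Qed.

Lemma span_subset c c' : {subset c <= c'} -> span c \subset span c'.
Proof.
move=> s; apply/subsetP=> x; rewrite !mem_span => /hasP[u uc xu]; apply/hasP; exists u => //.
exact: s.
Qed.

Lemma linkP u v x y : link u v -> x \in R u -> y \in R v -> connect_plus (R u :|: R v) x y.
Proof. by move/forall_inP=> H xu yv; have /forall_inP := H x xu; apply. Qed.

Lemma connect_plus_head u c v x y : path link u c -> (forall w, w \in c -> R w != set0) ->
  v \in c -> x \in R u -> y \in R v -> connect_plus (span (u :: c)) x y.
Proof.
elim: c u x => // w c IH u x /= /andP[uw pth] ne vc xu yv.
have /set0Pn[z zw] : R w != set0 by apply: ne; rewrite mem_head.
have s1 : R u :|: R w \subset span [:: u, w & c].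
  by rewrite subUset !sub_span // !inE eqxx ?orbT.
have s2 : span (w :: c) \subset span [:: u, w & c].
  by apply: span_subset => a ac; rewrite inE ac orbT.
move: vc; rewrite inE => /predU1P[vw|vc].
  by apply: connect_plus_sub s1 _; apply: linkP; rewrite // -vw.
apply: connect_plus_trans (connect_plus_sub s1 (linkP uw xu zw)) _.
apply: connect_plusW; apply: connect_plus_sub s2 _; apply: IH => //.
by move=> a ac; apply: ne; rewrite inE ac orbT.
Qed.

Lemma connect_plus_chain c u v x y : sorted link c -> (forall w, w \in c -> R w != set0) ->
  subseq [:: u; v] c -> x \in R u -> y \in R v -> connect_plus (span c) x y.
Proof.
elim: c => // w c IH /= pth ne.
have pc : sorted link c by case: c pth {IH ne} => //= a c /andP[].
have ne' a : a \in c -> R a != set0 by move=> ac; apply: ne; rewrite inE ac orbT.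
case: eqP => [E|_].
  by rewrite sub1seq E => vc xu yv; apply: (connect_plus_head pth ne' vc).
move=> s xu yv; apply: connect_plus_sub (IH pc ne' s xu yv).
by apply: span_subset => a ac; rewrite inE ac orbT.
Qed.

Lemma cyclic_closed_chain u c : path link u (rcons c u) -> (forall w, w \in u :: c -> R w != set0) ->
  cyclic (span (u :: c)).
Proof.
move=> pth ne; have /set0Pn[x xu] : R u != set0 by apply: ne; rewrite mem_head.
apply: (@cyclic_of_loop _ x).
have := @connect_plus_head u (rcons c u) u x x pth; rewrite mem_rcons mem_head => H.
apply: connect_plus_sub (H _ _ xu xu) => //; last by move=> w; rewrite mem_rcons; apply: ne.
by apply: span_subset => a; rewrite inE mem_rcons => /predU1P[->|//]; rewrite mem_head.
Qed.
End Chains.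

(** Follow the first chain from the meeting of [u] and [v] to that of [u'] and [v'], and the second
    chain back. *)
Lemma cyclic_inversion (U U' : eqType) (R : U -> {set T}) (R' : U' -> {set T}) c c' u u' v v' :
  sorted (link R) c -> sorted (link R') c' ->
  (forall w, w \in c -> R w != set0) -> (forall w, w \in c' -> R' w != set0) ->
  subseq [:: u; u'] c -> subseq [:: v'; v] c' ->
  ~~ [disjoint R u & R' v] -> ~~ [disjoint R u' & R' v'] -> cyclic (span R c :|: span R' c').
Proof.
move=> sc sc' ne ne' s s' /pred0Pn[x /andP[xu xv]] /pred0Pn[y /andP[yu yv]].
have xy := connect_plus_chain sc ne s xu yu.
have yx := connect_plus_chain sc' ne' s' yv xv.
apply: (@cyclic_of_loop _ x); apply: connect_plus_trans (connect_plus_sub (subsetUl _ _) xy) _.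
by apply: connect_plusW; apply: connect_plus_sub yx; apply: subsetUr.
Qed.

(** The mirror image of [cyclic_of_connect_plus]. A [y] with the fewest ancestors in [Y] has the
    same ancestors as its predecessor, so [y] is itself an ancestor of that predecessor. *)
Lemma cyclic_of_predecessors Q Y y0 : y0 \in Y ->
  (forall y, y \in Y -> exists2 y', y' \in Y & connect_plus Q y' y) -> cyclic Q.
Proof.
move=> y0Y H; pose anc y := [set z in Y | connect (induced e Q) z y].
have [y yY miny] := @arg_minnP T y0 (mem Y) (fun y => #|anc y|) y0Y.
have [y' y'Y y'y] := H y yY.
have sub : anc y' \subset anc y.
  apply/subsetP=> z; rewrite !inE => /andP[-> zy'] /=.
  exact: connect_trans zy' (connect_plusW y'y).
have /setP/(_ y) : anc y' = anc y by apply/eqP; rewrite eqEcard sub miny.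
have yY0 : y \in Y := yY; rewrite !inE yY0 connect0 /= => yy'.
by apply: (@cyclic_of_loop _ y'); apply: connect_plus_trans y'y yy'.
Qed.
End Cyclic.

(** * Counting meetings and cutting chains into intervals *)

Lemma sum_const_seq (E : eqType) (s : seq E) (P : pred E) n :
  \sum_(i <- s | P i) n = count P s * n.
Proof. by rewrite big_const_seq iter_addn_0 mulnC. Qed.

Lemma sum_uniq_sub (E : eqType) (D s : seq E) (f : E -> nat) :
  uniq D -> {subset D <= s} -> \sum_(c <- D) f c <= \sum_(c <- s) f c.
Proof.
elim: D s => [|c D IH] s /=; first by rewrite big_nil.
case/andP=> cD uD sD; rewrite big_cons [X in _ <= X](big_rem c) /=; last by apply: sD; rewrite mem_head.
rewrite leq_add2l; apply: IH => // d dD.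
have ds : d \in s by apply: sD; rewrite inE dD orbT.
have := perm_mem (perm_to_rem (sD c (mem_head _ _))) d; rewrite ds inE.
by case: eqP => [dc|_] /=; [rewrite -dc dD in cD | move=> <-].
Qed.

(** Without inverted pairs the ones of the matrix [M] follow a monotone staircase. If row [x] has a
    one beyond the first column [y], then [y] has none in the later rows and column [y] can be
    deleted; otherwise row [x] can. Each deletion costs at most one. *)
Lemma sum_staircase (E F : eqType) (s1 : seq E) (s2 : seq F) (M : E -> F -> bool) :
  (forall x x' y y', subseq [:: x; x'] s1 -> subseq [:: y'; y] s2 ->
     M x y -> M x' y' -> False) ->
  \sum_(x <- s1) \sum_(y <- s2) M x y <= size s1 + size s2.
Proof.
elim: s1 s2 => [|x u IH1]; first by move=> s2 _; rewrite big_nil.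
elim=> [|y v IH2] H; first by rewrite big1 // => i _; rewrite big_nil.
have [hv|nv] := boolP (has (M x) v).
  case/hasP: hv => y1 y1v My1.
  have no x' : x' \in u -> M x' y = false.
    move=> x'u; apply/negP=> Mx'; apply: (H x x' y1 y) => //=; rewrite eqxx sub1seq //.
  have -> : \sum_(a <- x :: u) \sum_(b <- y :: v) M a b =
      M x y + \sum_(a <- x :: u) \sum_(b <- v) M a b.
    under eq_bigr do rewrite big_cons.
    rewrite big_split /=; congr (_ + _); rewrite big_cons big_seq big1 ?addn0 // => a /no -> //.
  rewrite /= addnS; apply: (@leq_add _ _ 1) => //; first by case: (M x y).
  apply: IH2 => a a' b b' sa sb; apply: H sa _.
  by apply: subseq_trans sb _; apply: subseq_cons.
rewrite big_cons; have -> : \sum_(b <- y :: v) M x b = M x y.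
  rewrite big_cons big_seq big1 ?addn0 // => b bv; apply/eqP; rewrite eqb0.
  by apply: contra nv => Mb; apply/hasP; exists b.
rewrite /= addSn; apply: (@leq_add _ _ 1) => //; first by case: (M x y).
apply: IH1 => a a' b b' sa; apply: H.
by apply: subseq_trans sa _; apply: subseq_cons.
Qed.

Lemma greedy_selection (E : eqType) (P : seq E) (clash : rel E) k :
  (exists S, [/\ size S = k, {subset S <= P} & pairwise (fun a b => ~~ clash a b) S]) \/
  (exists S, [/\ size S < k, {subset S <= P} & forall p, p \in P -> has (clash p) S]).
Proof.
elim: k => [|k [[S [sz sub pw]]|[S [sz sub cov]]]]; first by left; exists [::].
  have [/allP cov|] := boolP (all (fun p => has (clash p) S) P).
    by right; exists S; rewrite sz.
  case/allPn=> p pP np; left; exists (p :: S); split => /=.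
  - by rewrite sz.
  - by move=> q; rewrite inE => /predU1P[->|/sub].
  by rewrite pw andbT all_predC.
by right; exists S; rewrite ltnW.
Qed.

(** Greedy from the right: the leading interval is extended until its weight reaches [theta]. Hence
    only the first interval [c] may be lighter than [theta], and it is left out of the last
    estimate. *)
Lemma split_by_weight (U : eqType) (wt : U -> nat) (M theta : nat) (u : U) (s : seq U) :
  (forall v, v \in u :: s -> wt v <= M) ->
  exists c cs, [/\ flatten (c :: cs) = u :: s, all (fun c => c != [::]) (c :: cs),
    forall d, d \in c :: cs -> \sum_(v <- d) wt v <= theta + M &
    size cs * theta <= \sum_(v <- flatten cs) wt v].
Proof.
elim: s u => [|u' s IH] u H.
  exists [:: u], [::]; split=> //=.
  move=> d; rewrite inE => /eqP->; rewrite big_seq1 (leq_trans (H u _)) ?leq_addl //.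
  by rewrite mem_head.
have [v vs|c [cs [fl ne wts sz]]] := IH u'; first by apply: H; rewrite inE vs orbT.
have uM : wt u <= M by apply: H; rewrite mem_head.
have [lt|ge] := ltnP (\sum_(v <- c) wt v) theta.
  exists (u :: c), cs; split=> //=.
  - by rewrite -fl.
  - by case/andP: ne.
  move=> d; rewrite inE => /predU1P[->|dcs]; last by apply: wts; rewrite inE dcs orbT.
  by rewrite big_cons addnC leq_add // ltnW.
exists [:: u], (c :: cs); split=> //.
- by rewrite -fl.
- move=> d; rewrite inE => /predU1P[->|]; last exact: wts.
  by rewrite big_seq1 (leq_trans uM) // leq_addl.
by rewrite /= mulSn big_cat leq_add.
Qed.

Lemma flatten_flatten (U : Type) (css : seq (seq (seq U))) :
  flatten (flatten css) = flatten [seq flatten cs | cs <- css].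
Proof. by elim: css => //= cs css <-; rewrite flatten_cat. Qed.

Lemma sorted_flatten (U : eqType) (r : rel U) cs c :
  sorted r (flatten cs) -> c \in cs -> sorted r c.
Proof.
elim: cs => //= d cs IH sd; rewrite inE => /predU1P[->|]; first by case/cat_sorted2: sd.
by apply: IH; case/cat_sorted2: sd.
Qed.

Lemma uniq_of_flatten (U : eqType) (cs : seq (seq U)) :
  uniq (flatten cs) -> (forall d, d \in cs -> d != [::]) -> uniq cs.
Proof.
elim: cs => //= c l IH; rewrite cat_uniq => /and3P[_ /hasPn nh ul] nel.
rewrite IH // ?andbT; last by move=> d dl; apply: nel; rewrite inE dl orbT.
apply/negP=> cl; have : c != [::] by apply: nel; rewrite mem_head.
case: c cl nh {nel} => // a c cl nh _.
have /nh/negP[] : a \in flatten l by apply/flattenP; exists (a :: c); rewrite ?mem_head.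
exact: mem_head.
Qed.

(** The possibly light first interval of each chain accounts for the term [size chains * theta]. *)
Lemma split_chains (U : eqType) (r : rel U) (wt : U -> nat) (M theta : nat) (chains : seq (seq U)) :
  (forall v, v \in flatten chains -> wt v <= M) -> all (sorted r) chains ->
  exists css, [/\ [seq flatten cs | cs <- css] = chains,
    forall d, d \in flatten css -> [/\ d != [::], sorted r d & \sum_(v <- d) wt v <= theta + M] &
    size (flatten css) * theta <= \sum_(v <- flatten chains) wt v + size chains * theta].
Proof.
elim: chains => [|ch chains IH] H /=; first by exists [::].
case/andP=> sch sall.
have [v vs|css [fl ok sz]] := IH _ sall; first by apply: H; rewrite /= mem_cat vs orbT.
case: ch sch H => [_ _|u s sch H].
  exists ([::] :: css); split=> //=; first by rewrite fl.
  by apply: leq_trans sz _; rewrite leq_add2l leq_mul2r leqnSn orbT.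
have [v vs|c [cs [fl' ne wts sz']]] := @split_by_weight _ wt M theta u s.
  by apply: H; rewrite /= -cat_cons mem_cat vs.
exists ((c :: cs) :: css); split=> /=.
- by rewrite fl -fl'.
- move=> d; rewrite -cat_cons mem_cat => /orP[dc|/ok//]; split; last exact: wts.
    exact: (allP ne).
  by apply: (@sorted_flatten _ _ (c :: cs)) => //; rewrite fl'.
rewrite size_cat !mulSn mulnDl big_cons big_cat /=.
have : \sum_(v <- flatten cs) wt v <= wt u + \sum_(v <- s) wt v.
  have := big_cons 0 addn u s xpredT wt; rewrite /= => <-.
  by rewrite -fl' /= big_cat leq_addl.
by move: sz sz'; clear; lia.
Qed.

(** * Disjoint cyclic pairs of intervals in a dense system of chains *)

Section DensePacking.
Variables (T : finType) (e : rel T) (U : eqType) (R : U -> {set T}).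
Implicit Types (c : seq U) (u v : U).

Definition meets u v := ~~ [disjoint R u & R v].
Definition crossings (W W' : pred U) c c' := \sum_(u <- c | W u) \sum_(v <- c' | W' v) meets u v.

Lemma crossings_le W W' c c' : sorted (link e R) c -> sorted (link e R) c' ->
  (forall w, w \in c -> R w != set0) -> (forall w, w \in c' -> R w != set0) ->
  ~~ cyclic e (span R c :|: span R c') -> crossings W W' c c' <= count W c + count W' c'.
Proof.
move=> sc sc' ne ne' nc; rewrite /crossings -big_filter.
under eq_bigr do rewrite -big_filter.
rewrite -!size_filter; apply: sum_staircase => x x' y y' sx sy mx my; case/negP: nc.
apply: (@cyclic_inversion _ _ _ _ _ _ _ _ x x' y y') => //.
- exact: subseq_trans sx (filter_subseq _ _).
- exact: subseq_trans sy (filter_subseq _ _).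
Qed.

Lemma crossingsC W c c' : crossings W W c c' = crossings W W c' c.
Proof.
rewrite /crossings exchange_big /=; apply: eq_bigr => u _; apply: eq_bigr => v _.
by rewrite /meets disjoint_sym.
Qed.

Lemma crossings_flattenr W W' c cs : crossings W W' c (flatten cs) = \sum_(c' <- cs) crossings W W' c c'.
Proof.
rewrite /crossings [RHS]exchange_big /=; apply: eq_bigr => u _.
by rewrite big_flatten.
Qed.

Lemma crossings_flattenl W W' c cs : crossings W W' (flatten cs) c = \sum_(c' <- cs) crossings W W' c' c.
Proof. by rewrite /crossings big_flatten. Qed.

Lemma count_flatten_sum (a : pred U) cs : count a (flatten cs) = \sum_(c <- cs) count a c.
Proof. by rewrite count_flatten sumnE big_map. Qed.

Lemma count_span_le x c : (x \in span R c) <= count (fun u => x \in R u) c.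
Proof. by rewrite mem_span has_count; case: (count _ _). Qed.

(** Cut the chains into at most [65 * k] intervals of bounded weight. Pairs of intervals without a
    cycle have few crossings by [crossings_le]. If a maximal family of disjoint pairs with a cycle
    had fewer than [k] members, at most [2 * k] intervals would touch every such pair; both
    contributions are too small for the density. *)
Theorem dense_packing (chains : seq (seq U)) (W : pred U) k :
  uniq (flatten chains) -> (forall u, u \in flatten chains -> R u != set0) ->
  all (sorted (link e R)) chains -> size chains <= k -> 0 < k -> 0 < count W (flatten chains) ->
  200 * k * count W (flatten chains) <= crossings W W (flatten chains) (flatten chains) ->
  exists Qs : seq {set T}, [/\ size Qs = k, all (cyclic e) Qs &
    forall x, count (fun Q : {set T} => x \in Q) Qs <= count (fun u => x \in R u) (flatten chains)].
Proof.
set s := flatten chains; set m := crossings _ _ _ _; set nW := count W s.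
move=> us ne srt szc k0 n0 dense.
pose theta := m %/ (32 * k).
pose wt u := if W u then \sum_(v <- s | W v) meets u v else 0.
have wtM u : u \in s -> wt u <= nW.
  move=> _; rewrite /wt; case: (W u) => //; rewrite /nW -sum1_count.
  by apply: leq_sum => v _; case: (meets u v).
have [css [fl ok sz]] := @split_chains _ (link e R) wt nW theta chains wtM srt.
pose cs := flatten css.
have fcs : flatten cs = s by rewrite /cs flatten_flatten fl.
have wtE c : \sum_(v <- c) wt v = crossings W W c s by rewrite /crossings [RHS]big_mkcond.
rewrite -/s wtE -/m -/cs in sz.
have ucs : uniq cs by apply: uniq_of_flatten; [rewrite fcs | move=> d /ok[]].
have incs c u : c \in cs -> u \in c -> u \in s.
  by move=> cc uc; rewrite -fcs; apply/flattenP; exists c.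
have nec c : c \in cs -> forall u, u \in c -> R u != set0 by move=> cc u uc; apply: ne; apply: (incs c).
pose good (p : seq U * seq U) := cyclic e (span R p.1 :|: span R p.2).
pose clash (p q : seq U * seq U) := [|| p.1 == q.1, p.1 == q.2, p.2 == q.1 | p.2 == q.2].
pose P := [seq p <- [seq (c, c') | c <- cs, c' <- cs] | good p].
have inP c c' : c \in cs -> c' \in cs -> good (c, c') -> (c, c') \in P.
  by move=> h1 h2 h3; rewrite mem_filter h3; apply/allpairsP; exists (c, c').
have Pin p : p \in P -> [/\ p.1 \in cs, p.2 \in cs & good p].
  by rewrite mem_filter => /andP[h /allpairsP[[a b] /= [h1 h2 E]]]; rewrite E in h *.
have [[S [szS subS pwS]]|[S [szS subS cov]]] := greedy_selection P clash k.
  exists [seq span R p.1 :|: span R p.2 | p <- S]; split.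
  - by rewrite size_map.
  - by apply/allP=> _ /mapP[p /subS/Pin[_ _ gp] ->].
  move=> x; rewrite count_map -fcs count_flatten_sum.
  (* A pair may consist of the same interval twice, which is then charged only once. *)
  pose cl (p : seq U * seq U) := if p.1 == p.2 then [:: p.1] else [:: p.1; p.2].
  have clE p c : (c \in cl p) = (c == p.1) || (c == p.2).
    by rewrite /cl; case: eqP => [->|_]; rewrite !inE ?orbb.
  apply: leq_trans (_ : \sum_(c <- flatten (map cl S)) count (fun u => x \in R u) c <= _).
    rewrite big_flatten big_map -sum1_count [X in X <= _]big_mkcond /=; apply: leq_sum => p _.
    rewrite inE /cl; case: (eqVneq p.1 p.2) => [->|_]; rewrite ?big_seq1 ?big_cons ?big_nil ?addn0.
      by rewrite orbb; have := count_span_le x p.2; case: (_ \in _).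
    have := count_span_le x p.1; have := count_span_le x p.2.
    by case: (_ \in _); case: (_ \in _) => //=; clear; lia.
  apply: sum_uniq_sub.
    elim: S pwS {szS subS} => //= p S IH /andP[/allP np pw]; rewrite cat_uniq IH // andbT.
    apply/andP; split; first by rewrite /cl; case: eqP => //= /eqP h; rewrite inE h.
    apply/hasPn=> c /flattenP[_ /mapP[q qS ->] cq]; apply/negP=> cp.
    have := np q qS; rewrite /clash; move: cp cq; rewrite !clE.
    by case/orP=> /eqP <- /orP[] /eqP <-; rewrite eqxx ?orbT.
  move=> c /flattenP[_ /mapP[p /subS/Pin[h1 h2 _] ->]]; rewrite clE.
  by case/orP=> /eqP->.
exfalso.
pose Cv := flatten [seq [:: p.1; p.2] | p <- S].
have szCv : size Cv <= 2 * k.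
  suff -> : size Cv = 2 * size S by rewrite leq_mul2l ltnW.
  by rewrite /Cv; elim: (S) => //= p l ->; rewrite mulnS.
have cover c c' : c \in cs -> c' \in cs -> good (c, c') -> (c \in Cv) || (c' \in Cv).
  move=> h1 h2 h3; have /hasP[q qS] := cov _ (inP _ _ h1 h2 h3).
  have inCv d : (d == q.1) || (d == q.2) -> d \in Cv.
    by move=> hd; apply/flattenP; exists [:: q.1; q.2]; [apply: map_f | rewrite !inE].
  by rewrite /clash /= => /or4P[] h; apply/orP; [left|left|right|right]; apply: inCv; rewrite h ?orbT.
pose N c c' := crossings W W c c'.
have Nle c c' : c \in cs -> c' \in cs ->
    N c c' <= (count W c + count W c') + ((c \in Cv) * N c c' + (c' \in Cv) * N c c').
  move=> h1 h2; have [g|b] := boolP (good (c, c')).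
    apply: leq_trans (leq_addl _ _); have := cover _ _ h1 h2 g.
    by case: (c \in Cv); case: (c' \in Cv) => //= _; rewrite !mul1n ?leq_addl ?leq_addr.
  apply: leq_trans (leq_addr _ _); have [_ s1 _] := ok c h1; have [_ s2 _] := ok c' h2.
  by apply: crossings_le => //; apply: nec.
have part1 : \sum_(c <- cs) \sum_(c' <- cs) (count W c + count W c') = 2 * (size cs * nW).
  under eq_bigr => c _ do rewrite big_split /= sum_const_seq count_predT -count_flatten_sum fcs -/nW.
  rewrite big_split /= sum_const_seq count_predT -big_distrr /= -count_flatten_sum fcs -/nW; clear; lia.
have cntCv : count (mem Cv) cs <= 2 * k.
  apply: leq_trans szCv; rewrite -size_filter; apply: uniq_leq_size; first by rewrite filter_uniq.
  by move=> c; rewrite mem_filter => /andP[].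
have part2 : \sum_(c <- cs) \sum_(c' <- cs) (c \in Cv) * N c c' <= 2 * k * (theta + nW).
  apply: leq_trans (_ : \sum_(c <- cs | c \in Cv) (theta + nW) <= _).
    rewrite [X in _ <= X]big_mkcond /= big_seq [X in _ <= X]big_seq; apply: leq_sum => c cc.
    rewrite -big_distrr /= -crossings_flattenr fcs -wtE.
    by case: (c \in Cv); rewrite ?mul0n // mul1n; have [] := ok c cc.
  by rewrite sum_const_seq leq_mul2r cntCv orbT.
have part3 : \sum_(c <- cs) \sum_(c' <- cs) (c' \in Cv) * N c c' <= 2 * k * (theta + nW).
  rewrite exchange_big /=; apply: leq_trans part2; apply: eq_leq.
  by apply: eq_bigr => c _; apply: eq_bigr => c' _; rewrite /N crossingsC.
have mle : m <= 2 * (size cs * nW) + (2 * k * (theta + nW) + 2 * k * (theta + nW)).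
  rewrite /m -{1}fcs crossings_flattenl.
  apply: leq_trans (_ : \sum_(c <- cs) \sum_(c' <- cs)
     ((count W c + count W c') + ((c \in Cv) * N c c' + (c' \in Cv) * N c c')) <= _).
    rewrite big_seq [X in _ <= X]big_seq; apply: leq_sum => c cc.
    rewrite -fcs crossings_flattenr big_seq [X in _ <= X]big_seq; apply: leq_sum => c' cc'.
    exact: Nle.
  have splitE (F G H : seq U -> seq U -> nat) : \sum_(c <- cs) \sum_(c' <- cs) (F c c' + (G c c' + H c c')) =
      \sum_(c <- cs) \sum_(c' <- cs) F c c' + (\sum_(c <- cs) \sum_(c' <- cs) G c c' +
      \sum_(c <- cs) \sum_(c' <- cs) H c c').
    by rewrite -!big_split; apply: eq_bigr => c _; rewrite -!big_split.
  by rewrite splitE part1 leq_add2l leq_add.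
(* With [size cs <= 65 * k], the bound [mle] gives [m <= 134 * k * nW + m / 8], contradicting
   [m >= 200 * k * nW]. *)
have t1 : theta * (32 * k) <= m := leq_trunc_div _ _.
have t2 : m < (theta + 1) * (32 * k).
  by rewrite addn1 ltn_ceil // muln_gt0.
have t3 : 0 < theta.
  rewrite divn_gt0 ?muln_gt0 //; apply: leq_trans dense.
  by rewrite -mulnA; move: (leq_pmulr k n0); clear; lia.
have csle : size cs <= 65 * k.
  have : size cs * theta <= (65 * k) * theta.
    apply: leq_trans sz _; have : size chains * theta <= k * theta by rewrite leq_mul2r szc orbT.
    move: t2 (leq_pmulr k t3); clear; nia.
  by rewrite leq_pmul2r.
have csn : size cs * nW <= 65 * (k * nW) by rewrite mulnA leq_mul2r csle orbT.
have kn0 : 0 < k * nW by rewrite muln_gt0 k0.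
move: mle t1 csn dense kn0; clear; nia.
Qed.
End DensePacking.

(** * Closed systems of walks permuted by a successor map *)

Lemma orbit_chains (T : finType) (f : T -> T) (A : {set T}) :
  injective f -> (forall a, a \in A -> f a \in A) ->
  exists chains : seq (seq T), [/\ uniq (flatten chains),
    (forall a, (a \in flatten chains) = (a \in A)) &
    forall c, c \in chains -> exists u c', c = u :: c' /\ path (frel f) u (rcons c' u)].
Proof.
move=> fI; have [n] := ubnP #|A|; elim: n A => // n IH A cA clA.
have [->|[x xA]] := set_0Vmem A.
  by exists [::]; split=> // a; rewrite inE.
have oA : {subset orbit f x <= A}.
  move=> y; rewrite -fconnect_orbit => /iter_findex <-.
  by elim: (findex _ _ _) => //= m; apply: clA.
pose A' := A :\: [set y in orbit f x].
have [||chains [un mem ok]] := IH A'.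
- apply: leq_trans (_ : #|A| <= _); last by rewrite -ltnS.
  apply: proper_card; rewrite properE subsetDl /=; apply/subsetPn; exists x => //.
  by rewrite !inE -fconnect_orbit connect0.
- move=> a; rewrite !inE -!fconnect_orbit => /andP[na /clA ->]; rewrite andbT.
  apply: contra na => xf; apply: connect_trans xf _.
  by rewrite fconnect_sym // fconnect1.
exists (orbit f x :: chains); split=> /=.
- rewrite cat_uniq orbit_uniq un andbT /=; apply/hasPn=> y; rewrite mem !inE.
  by case/andP.
- move=> a; rewrite mem_cat mem !inE; case: (boolP (a \in orbit f x)) => //= /oA ->.
  by [].
move=> c; rewrite inE => /predU1P[->|/ok//].
have := cycle_orbit fI x; have : orbit f x != [::] by rewrite -size_eq0 size_orbit -lt0n order_gt0.
by case: (orbit f x) => // u c' _ cyc; exists u, c'.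
Qed.

Section ClosedSystems.
Variables (T : finType) (e : rel T).
Implicit Types (Q V : {set T}) (a b x y : T).

(** Weaker than [route]: vertices may be revisited, so the notion is kept when paths that intersect
    are concatenated. *)
Definition walk_set Q a b :=
  a \in Q /\ forall x, x \in Q -> connect (induced e Q) a x /\ connect (induced e Q) x b.

Lemma walk_set_end Q a b : walk_set Q a b -> b \in Q.
Proof. by move=> [aQ /(_ a aQ)[_ ab]]; apply: connect_induced_end ab aQ. Qed.

Lemma walk_set_route V a b : route e V a b -> walk_set V a b.
Proof.
move=> [aV ab p1 p2]; split=> // x xV; split.
  have [->//|xb] := eqVneq x b.
  by apply: connect_induced_sub (p1 x xV xb); apply: subsetDl.
have [->//|xa] := eqVneq x a.
by apply: connect_induced_sub (p2 x xV xa); apply: subsetDl.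
Qed.

Lemma walk_set_cat Q Q' a b c : walk_set Q a b -> walk_set Q' b c -> walk_set (Q :|: Q') a c.
Proof.
move=> [aQ h] [bQ' h']; split=> [|x]; first by rewrite inE aQ.
have s1 := subsetUl Q Q'; have s2 := subsetUr Q Q'.
rewrite inE => /orP[/h[ax xb]|/h'[bx xc]]; split.
- exact: connect_induced_sub ax.
- apply: connect_trans (connect_induced_sub s1 xb) (connect_induced_sub s2 _).
  by case: (h' b bQ').
- apply: connect_trans (connect_induced_sub s1 _) (connect_induced_sub s2 bx).
  by case: (h a aQ).
- exact: connect_induced_sub xc.
Qed.

(** A unit is a walk to [m] followed by a return route to [a'], without [a'] itself. As [m != a'],
    every vertex of the unit has a nonempty walk to [a'], the start of the next unit; keeping [a']
    in both units could break this. *)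
Lemma link_units (Q Q' : {set T}) V V' a m a' m' a'' :
  walk_set Q a m -> route e V m a' -> m != a' ->
  walk_set Q' a' m' -> route e V' m' a'' ->
  forall x y, x \in Q :|: (V :\ a') -> y \in Q' :|: (V' :\ a'') ->
    connect_plus e ((Q :|: (V :\ a')) :|: (Q' :|: (V' :\ a''))) x y.
Proof.
move=> wQ rV nm wQ' rV' x y xR yR.
set R1 := Q :|: _; set R2 := Q' :|: _.
have [mV ma' _ p2] := rV; have wV := walk_set_route rV.
have a'R2 : a' \in R2 by rewrite inE; case: wQ' => ->.
have sV : V \subset R1 :|: R2.
  apply/subsetP=> z zV; rewrite in_setU; have [->|za] := eqVneq z a'; first by rewrite a'R2 orbT.
  by rewrite /R1 in_setU in_setD1 za zV orbT.
have sQ : Q \subset R1 :|: R2 by rewrite -setUA subsetUl.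
have xa' : connect_plus e (R1 :|: R2) x a'.
  move: xR; rewrite inE => /orP[xQ|/setD1P[xa xV]].
    have xm := (wQ.2 x xQ).2.
    apply: connect_connect_plus (connect_induced_sub sQ xm) _.
    by apply: connect_plus_sub sV _; apply: connect_neq_plus.
  by apply: connect_plus_sub sV _; apply: connect_neq_plus => //; case: (wV.2 x xV).
apply: connect_plus_trans xa' _; apply: (@connect_induced_sub _ _ R2); first exact: subsetUr.
move: yR; rewrite inE => /orP[yQ|/setD1P[ya yV]].
  by apply: connect_induced_sub (wQ'.2 y yQ).1; apply: subsetUl.
have [m'V _ p1 _] := rV'.
apply: connect_trans (_ : connect _ a' m') _.
  apply: connect_induced_sub (wQ'.2 a' wQ'.1).2; exact: subsetUl.
by apply: connect_induced_sub (p1 y yV ya); apply: subsetUr.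
Qed.

Definition subpacking (A : {set T}) (R : T -> {set T}) k := exists Qs : seq {set T},
  [/\ size Qs = k, all (cyclic e) Qs &
      forall x, count (fun Q : {set T} => x \in Q) Qs <= #|[set a in A | x \in R a]|].

Lemma count_flatten_card (chains : seq (seq T)) (A : {set T}) (P : pred T) :
  uniq (flatten chains) -> (forall a, (a \in flatten chains) = (a \in A)) ->
  count P (flatten chains) = #|[set a in A | P a]|.
Proof.
move=> un mem; have u' : uniq (filter P (flatten chains)) by rewrite filter_uniq.
rewrite -size_filter -(card_uniqP u'); apply: eq_card => a.
by rewrite inE mem_filter mem andbC.
Qed.

(** The cycles of the permutation [f] are closed chains. If there are [k] of them, each spans a
    cycle and no unit is used twice. *)
Lemma closed_system_chains (A : {set T}) (R : T -> {set T}) (f : T -> T) k :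
  {in A &, injective f} -> (forall a, a \in A -> f a \in A) ->
  (forall a, a \in A -> R a != set0) -> (forall a, a \in A -> link e R a (f a)) ->
  subpacking A R k \/
  exists chains : seq (seq T), [/\ uniq (flatten chains),
    (forall a, (a \in flatten chains) = (a \in A)),
    all (sorted (link e R)) chains & size chains < k].
Proof.
move=> fI fA ne lk; pose g x := if x \in A then f x else x.
have gI : injective g.
  move=> x y; rewrite /g; case: (boolP (x \in A)) => xA; case: (boolP (y \in A)) => yA //.
  - exact: fI.
  - by move=> E; rewrite -E fA in yA.
  - by move=> E; rewrite E fA in xA.
have gA a : a \in A -> g a \in A by move=> aA; rewrite /g aA fA.
have [chains [un mem ok]] := orbit_chains gI gA.
have inA c u : c \in chains -> u \in c -> u \in A.
  by move=> cc uc; rewrite -mem; apply/flattenP; exists c.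
have pth c : c \in chains -> exists u c', c = u :: c' /\ path (link e R) u (rcons c' u).
  move=> cc; have [u [c' [E pg]]] := ok c cc; exists u, c'; split=> //.
  have sub : {in A &, subrel (frel g) (link e R)}.
    by move=> x y xA _ /eqP <-; rewrite /g xA; apply: lk.
  apply: (sub_in_path sub) pg; apply/allP=> z zc; apply: (inA c) => //; rewrite E.
  by move: zc; rewrite !in_cons mem_rcons in_cons orbA orbb.
have [le|lt] := leqP k (size chains); last first.
  right; exists chains; split=> //; apply/allP=> c /pth[u [c' [-> p]]] /=.
  by move: p; rewrite rcons_path => /andP[].
left; exists (take k [seq span R c | c <- chains]); split.
- by rewrite size_takel // size_map.
- apply/allP=> _ /mem_take/mapP[c cc ->]; have [u [c' [E p]]] := pth c cc; rewrite E.
  by apply: cyclic_closed_chain => // w wc; apply: ne; apply: (inA c) => //; rewrite E.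
move=> x; rewrite -(count_flatten_card _ un mem).
apply: leq_trans (_ : count (fun Q : {set T} => x \in Q) [seq span R c | c <- chains] <= _).
  by rewrite -{2}(cat_take_drop k [seq span R c | c <- chains]) count_cat leq_addr.
rewrite count_flatten_sum count_map -sum1_count big_mkcond /=; apply: leq_sum => c _.
by have := count_span_le R x c; case: (_ \in _).
Qed.

Theorem closed_system_dense (A : {set T}) (R : T -> {set T}) (f : T -> T) k :
  {in A &, injective f} -> (forall a, a \in A -> f a \in A) ->
  (forall a, a \in A -> R a != set0) -> (forall a, a \in A -> link e R a (f a)) ->
  0 < k -> 0 < #|A| -> 200 * k * #|A| <= \sum_(a in A) \sum_(b in A) meets R a b ->
  subpacking A R k.
Proof.
move=> fI fA ne lk k0 A0 dense.
have [//|[chains [un mem srt sz]]] := closed_system_chains k fI fA ne lk.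
have cA : count xpredT (flatten chains) = #|A|.
  by rewrite (count_flatten_card _ un mem) -cardsE; apply: eq_card => a; rewrite !inE andbT.
have sumE (F : T -> nat) : \sum_(a <- flatten chains) F a = \sum_(a in A) F a.
  rewrite -[RHS]big_enum; apply: perm_big; apply: uniq_perm => //; first exact: enum_uniq.
  by move=> a; rewrite mem mem_enum.
have [|||Qs [h1 h2 h3]] := @dense_packing _ e _ R chains xpredT k un _ srt (ltnW sz) k0.
- by move=> u; rewrite mem; apply: ne.
- by rewrite cA.
- rewrite cA; apply: leq_trans dense _; rewrite /crossings sumE; apply: eq_leq.
  by apply: eq_bigr => a _; rewrite sumE.
by exists Qs; split=> // x; rewrite -(count_flatten_card _ un mem).
Qed.
End ClosedSystems.

(** * Averaging over choices of one path per linkage *)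

Fixpoint pair_sum (J : Type) (F : J -> J -> nat) (s : seq J) : nat :=
  if s is i :: s' then \sum_(j <- s') F i j + pair_sum F s' else 0.

Lemma pair_sum_le (J : eqType) (F : J -> J -> nat) c (s : seq J) :
  uniq s -> (forall i j, i \in s -> j \in s -> i != j -> F i j <= c) ->
  2 * pair_sum F s <= c * (size s * size s).
Proof.
elim: s => //= i s IH /andP[ni us] H.
have h1 : \sum_(j <- s) F i j <= size s * c.
  rewrite -[size s]count_predT -sum_const_seq big_seq [X in _ <= X]big_seq; apply: leq_sum => j js.
  apply: H; rewrite ?mem_head //; first by rewrite inE js orbT.
  by apply: contraNneq ni => ->.
have h2 : 2 * pair_sum F s <= c * (size s * size s).
  by apply: IH => // a b ha hb; apply: H; rewrite inE ?ha ?hb orbT.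
by move: h1 h2; clear; nia.
Qed.

Lemma pair_sum_mul (J : Type) (F : J -> J -> nat) c (s : seq J) :
  pair_sum (fun i j => c * F i j) s = c * pair_sum F s.
Proof. by elim: s => [|i s IH] /=; rewrite ?muln0 // IH mulnDr big_distrr. Qed.

Lemma eq_pair_sum (J : eqType) (F G : J -> J -> nat) (s : seq J) :
  (forall i j, i \in s -> j \in s -> F i j = G i j) -> pair_sum F s = pair_sum G s.
Proof.
elim: s => //= i s IH H; congr (_ + _).
  by apply: eq_big_seq => j js; apply: H; rewrite inE ?eqxx // js orbT.
by apply: IH => a b ha hb; apply: H; rewrite inE ?ha ?hb orbT.
Qed.

(** Deletion method: drop the earlier element of each clashing pair. *)
Lemma independent_subseq (J : eqType) (clash : rel J) (s : seq J) :
  exists s', [/\ subseq s' s, pairwise (fun i j => ~~ clash i j) s' &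
    size s <= size s' + pair_sum clash s].
Proof.
elim: s => [|i s [s' [sub pw sz]]] /=; first by exists [::].
have [h|h] := boolP (has (clash i) s).
  exists s'; split=> //; first exact: subseq_trans sub (subseq_cons _ _).
  have : 0 < \sum_(j <- s) clash i j.
    by case/hasP: h => j js cij; rewrite (big_rem j) //= cij.
  by move: sz; clear; lia.
exists (i :: s'); split=> /=; rewrite ?eqxx //.
  rewrite pw andbT; apply/allP=> j /(mem_subseq sub) js.
  by apply: contra h => cij; apply/hasP; exists j.
by rewrite addSn ltnS (leq_trans sz) // leq_add2l leq_addl.
Qed.

(* Method of conditional expectations. *)
Lemma choice_below_average (J T : finType) (B : J -> {set T}) b (s : seq J)
    (E : J -> J -> T -> T -> nat) (c : J -> T -> nat) :
  0 < b -> (forall j, #|B j| = b) -> uniq s ->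
  exists f : J -> T, (forall j, f j \in B j) /\
    b * b * (\sum_(j <- s) c j (f j) + pair_sum (fun i j => E i j (f i) (f j)) s) <=
    b * \sum_(j <- s) \sum_(a in B j) c j a +
    pair_sum (fun i j => \sum_(a in B i) \sum_(a' in B j) E i j a a') s.
Proof.
move=> b0 cB.
have ne j : exists a, a \in B j by apply/card_gt0P; rewrite cB.
elim: s c => [|i s IH] c /=.
  move=> _; have [f hf] := @fin_all_exists J (fun=> T) (fun j a => a \in B j) ne.
  by exists f; split=> //; rewrite !big_nil !muln0.
case/andP=> ni us.
(* Up to scaling, [g a] is the expected cost caused by [i] once [a] is chosen. After the best [a] is
   fixed, its cost with the later indices is moved into the linear terms. *)
pose g a := b * c i a + \sum_(j <- s) \sum_(a' in B j) E i j a a'.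
have [a0 a0B] := ne i.
have [a aB mina] := @arg_minnP T a0 (mem (B i)) g a0B.
have avg : b * g a <= \sum_(x in B i) g x.
  by rewrite -(cB i) -sum_nat_const; apply: leq_sum => x xB; apply: mina.
have [f [fB fle]] := IH (fun j x => c j x + E i j a x) us.
exists (fun j => if j == i then a else f j); split.
  by move=> j; case: eqP => [->|].
rewrite !big_cons eqxx.
have E1 : \sum_(j <- s) c j (if j == i then a else f j) = \sum_(j <- s) c j (f j).
  by apply: eq_big_seq => j js; case: eqP => // ji; rewrite -ji js in ni.
have E2 : \sum_(j <- s) E i j a (if j == i then a else f j) = \sum_(j <- s) E i j a (f j).
  by apply: eq_big_seq => j js; case: eqP => // ji; rewrite -ji js in ni.
have E3 : pair_sum (fun x j => E x j (if x == i then a else f x) (if j == i then a else f j)) s =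
    pair_sum (fun x j => E x j (f x) (f j)) s.
  apply: eq_pair_sum => x j xs js; case: eqP => [h|_]; first by rewrite -h xs in ni.
  by case: eqP => // h; rewrite -h js in ni.
rewrite E1 E2 E3 {E1 E2 E3}.
rewrite big_split /= in fle.
have E4 : \sum_(j <- s) \sum_(x in B j) (c j x + E i j a x) =
   \sum_(j <- s) \sum_(x in B j) c j x + \sum_(j <- s) \sum_(x in B j) E i j a x.
  by rewrite -big_split; apply: eq_bigr => j _; rewrite big_split.
rewrite E4 in fle.
have E5 : \sum_(x in B i) g x = b * (\sum_(x in B i) c i x) +
   \sum_(j <- s) \sum_(x in B i) \sum_(a' in B j) E i j x a'.
  rewrite /g big_split /= big_distrr /=; congr (_ + _).
  by rewrite exchange_big.
rewrite E5 /g in avg; move: fle avg; clear.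
set x1 := c i a; set x2 := \sum_(j <- s) c j (f j); set x3 := \sum_(j <- s) E i j a (f j).
set x4 := pair_sum _ s; set x5 := \sum_(j <- s) \sum_(x in B j) c j x.
set x6 := \sum_(j <- s) \sum_(x in B j) E i j a x; set x7 := pair_sum _ s.
set x8 := \sum_(x in B i) c i x; set x9 := \sum_(j <- s) _.
rewrite !mulnDr !mulnA; lia.
Qed.

(** If every two of the [2 * k] families have density at most [1 / (2 * k)], some choice has at most
    [k] clashing pairs; deleting one index from each leaves [k] disjoint members. *)
Lemma disjoint_transversal_or_dense (J T : finType) (B : J -> {set T}) b k (V : J -> T -> {set T}) :
  0 < b -> (forall j, #|B j| = b) -> #|J| = 2 * k ->
  (exists (f : J -> T) (s : seq J), [/\ forall j, f j \in B j, size s = k, uniq s &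
     forall i j, i \in s -> j \in s -> i != j -> [disjoint V i (f i) & V j (f j)]]) \/
  exists i j, i != j /\
    b * b < 2 * k * \sum_(a in B i) \sum_(a' in B j) ~~ [disjoint V i a & V j a'].
Proof.
move=> b0 cB cJ.
pose E i j a a' : nat := ~~ [disjoint V i a & V j a'].
pose D i j := \sum_(a in B i) \sum_(a' in B j) E i j a a'.
case: (pickP [pred p : J * J | (p.1 != p.2) && (b * b < 2 * k * D p.1 p.2)]) => [[i j] /= /andP[h1 h2]|no].
  by right; exists i, j.
left; have le i j : i != j -> 2 * k * D i j <= b * b.
  by move=> ij; have := no (i, j); rewrite /= ij /= => /negbT; rewrite -leqNgt.
have [f [fB fle]] := @choice_below_average J T B b (enum J) E (fun _ _ => 0) b0 cB (enum_uniq _).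
exists f; pose clash i j := ~~ [disjoint V i (f i) & V j (f j)].
have [s' [sub pw sz]] := independent_subseq clash (enum J).
have us' : uniq s' := subseq_uniq sub (enum_uniq _).
have szJ : size (enum J) = 2 * k by rewrite -cardE -cJ cardT -cardE.
have ps : pair_sum clash (enum J) <= k.
  have [k0|k0] := posnP k.
    by rewrite k0 muln0 in szJ; move/size0nil: szJ => ->.
  have h1 : 2 * pair_sum (fun i j => 2 * k * D i j) (enum J) <= b * b * (2 * k * (2 * k)).
    rewrite -szJ; apply: pair_sum_le; first exact: enum_uniq.
    by move=> i j _ _; rewrite szJ; apply: le.
  rewrite pair_sum_mul in h1.
  have h2 : b * b * pair_sum clash (enum J) <= pair_sum D (enum J).
    apply: leq_trans (leq_trans _ fle) _; first by rewrite leq_mul2l leq_addl orbT.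
    by rewrite big1 ?muln0 // => j _; rewrite big1.
  have b2 : 0 < b * b by rewrite muln_gt0 b0.
  rewrite -(leq_pmul2l b2); move: h1 h2 k0; clear; nia.
have szs : k <= size s' by have := leq_trans sz (leq_add (leqnn _) ps); rewrite szJ; clear; lia.
exists (take k s'); split=> //.
- by rewrite size_takel.
- by rewrite take_uniq.
move=> i j /mem_take is' /mem_take js' ij.
have clsym : symmetric (fun i j => ~~ clash i j).
  by move=> x y; rewrite /clash disjoint_sym.
have : ~~ clash i j.
  elim: s' us' pw is' js' {sub sz szs} => //= x s IH /andP[nx us] /andP[/allP nc pw].
  rewrite !inE => /predU1P[ix|iS] /predU1P[jx|jS].
  - by rewrite ix jx eqxx in ij.
  - by rewrite ix; apply: nc.
  - by rewrite clsym jx; apply: nc.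
  by apply: IH.
by rewrite negbK.
Qed.

(** * From a well-linked path to two linkages that meet densely *)

Lemma split_count (T : eqType) (P : pred T) (s : seq T) n :
  n <= count P s -> exists s1 s2, s = s1 ++ s2 /\ count P s1 = n.
Proof.
elim: s n => [|x s IH] [|n] /=; try by exists [::], [::].
- by exists [::], (x :: s).
have [px le|px le] := boolP (P x).
  have [s1 [s2 [-> c]]] := IH n le; exists (x :: s1), s2; by rewrite /= px c.
have [s1 [s2 [-> c]]] := IH n.+1 le; exists (x :: s1), s2; by rewrite /= (negPf px) c.
Qed.

Lemma split_pieces (T : eqType) (P : pred T) (r : rel T) (s : seq T) N m :
  uniq s -> sorted r s -> N * m <= count P s ->
  exists ps : seq (seq T), [/\ size ps = N, uniq (flatten ps) &
    forall d, d \in ps -> sorted r d /\ count P d = m].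
Proof.
move=> us ss le; suff [ps [h1 h2 h3 _]] : exists ps : seq (seq T), [/\ size ps = N, uniq (flatten ps),
    (forall d, d \in ps -> sorted r d /\ count P d = m) & {subset flatten ps <= s}] by exists ps.
elim: N s us ss le => [|N IH] s us ss le; first by exists [::].
rewrite mulSn in le; have [s1 [s2 [E c1]]] := split_count (leq_trans (leq_addr _ _) le).
rewrite E in us ss; have [ss1 ss2] := cat_sorted2 ss.
move: (us); rewrite cat_uniq => /and3P[us1 /hasPn dj us2].
have [|ps [h1 h2 h3 h4]] := IH s2 us2 ss2.
  by move: le; rewrite E count_cat c1 leq_add2l.
exists (s1 :: ps); split=> /=; first by rewrite h1.
- by rewrite cat_uniq us1 h2 andbT /=; apply/hasPn=> x /h4; apply: dj.
- by move=> d; rewrite inE => /predU1P[->|/h3].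
by move=> x; rewrite E !mem_cat => /orP[->//|/h4 ->]; rewrite orbT.
Qed.

Lemma connect_sorted (T : finType) (e : rel T) (s1 s2 : seq T) x y :
  sorted e (s1 ++ s2) -> x \in s1 -> y \in s2 ->
  connect (induced e [set z in s1 ++ s2]) x y.
Proof.
move=> ss xs ys; case/splitPr: xs ss => p1 p2; rewrite -catA /= => /cat_sorted2[_ /= pth].
case/splitPr: ys pth => q1 q2; rewrite -cat_rcons catA cat_path => /andP[pth _].
have := @path_connect_induced _ e [set z in p1 ++ x :: p2 ++ rcons q1 y ++ q2] x (p2 ++ rcons q1 y) pth.
rewrite last_cat last_rcons -!catA cat_rcons; apply=> z; rewrite !(inE, mem_cat, mem_rcons).
by case: (z == x); case: (z \in p1); case: (z \in p2); case: (z \in q1); case: (z == y).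
Qed.

Lemma card_seq_set (T : finType) (I : {set T}) (d : seq T) :
  uniq d -> #|[set x in d | x \in I]| = count (mem I) d.
Proof.
move=> ud; have u' : uniq (filter (mem I) d) by rewrite filter_uniq.
rewrite -size_filter -(card_uniqP u'); apply: eq_card => x.
by rewrite inE mem_filter andbC.
Qed.

Definition well_linked (T : finType) (e : rel T) (I : {set T}) :=
  forall A B : {set T}, A \subset I -> B \subset I -> #|A| = #|B| -> exists V t, linkage e A B V t.

Lemma linkage_inj (T : finType) (e : rel T) (A B : {set T}) V t :
  linkage e A B V t -> {in A &, injective t}.
Proof.
move=> [r d] a a' aA a'A tt; apply/eqP; apply/negPn/negP=> naa'.
have [ra _] := r a aA; have [ra' _] := r a' a'A.
have /pred0P/(_ (t a)) := d a a' aA a'A naa'.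
by rewrite /= (walk_set_end (walk_set_route ra)) tt (walk_set_end (walk_set_route ra')).
Qed.

Definition dense_pair (T : finType) (e : rel T) k b (X Y X' Y' : {set T}) (L K : T -> {set T}) (t t' : T -> T) :=
  [/\ well_linked e (X :|: Y :|: X' :|: Y'),
      [/\ #|X| = b, #|Y| = b, #|X'| = b & #|Y'| = b],
      [/\ [disjoint X & Y], [disjoint X' & Y'] & [disjoint X :|: Y & X' :|: Y']],
      linkage e X Y L t /\ linkage e X' Y' K t' &
      b * b < 2 * k * \sum_(a in X) \sum_(a' in X') ~~ [disjoint L a & K a']].

Theorem dtw_le_or_dense_pair (T : finType) (e : rel T) k b : 0 < b ->
  [\/ dtw_le e (24 * k * b + 2), packing e k 2 |
      exists X Y X' Y' L K t t', dense_pair e k b X Y X' Y' L K t t'].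
Proof.
(* There are [2 * k] pieces with [2 * b] points each, half of them for either end of the back
   linkage; [6 * h + 2] becomes [24 * k * b + 2]. *)
move=> b0; have [|[x [p [I [un pth sI cI wl]]]]] := dtw_le_or_well_linked_path e (2 * k * (2 * b)).
  have -> : 6 * (2 * k * (2 * b)) = 24 * k * b by clear; lia.
  by constructor 1.
have cnt : count (mem I) (x :: p) = 2 * k * (2 * b).
  rewrite -cI -(card_seq_set I un); apply: eq_card => z; rewrite inE andbC.
  by case: (boolP (z \in I)) => //= /(subsetP sI); rewrite inE.
have [|ps [szps ups okps]] := @split_pieces _ (mem I) e (x :: p) (2 * k) (2 * b) un pth.
  by rewrite cnt.
pose J := 'I_(2 * k).
pose d (j : J) := nth [::] ps j.
have dps j : d j \in ps by apply: mem_nth; rewrite szps.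
have udj j : uniq (d j).
  suff aux (l : seq (seq T)) q : uniq (flatten l) -> q \in l -> uniq q by apply: (aux ps).
  elim: l => //= c l IH; rewrite cat_uniq => /and3P[uc _ ul].
  by rewrite inE => /predU1P[->|]; [exact: uc | exact: IH].
have djd i j z : i != j -> z \in d i -> z \in d j -> False.
  move=> ij zi zj.
  have aux l (m n : nat) : uniq (flatten l) -> m < n -> z \in nth [::] l m -> z \in nth [::] l n -> False.
    elim: l m n => [|c l IH] m n /=; first by rewrite !nth_nil.
    rewrite cat_uniq => /and3P[_ /hasPn nh ul]; case: n => // n; case: m => [|m] /= mn zm zn.
      have [nl|nl] := ltnP n (size l); last by rewrite nth_default in zn.
      have /nh/negP[] // : z \in flatten l by apply/flattenP; exists (nth [::] l n); rewrite ?mem_nth.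
    exact: (IH m n).
  have [lt|gt|E] := ltngtP (i : nat) j; first exact: (aux ps i j).
    exact: (aux ps j i).
  by case/eqP: ij; apply: val_inj.
have /fin_all_exists[dd hdd] : forall j : J, exists dd : seq T * seq T,
    d j = dd.1 ++ dd.2 /\ count (mem I) dd.1 = b.
  move=> j; have [_ c] := okps _ (dps j).
  have [|s1 [s2 [E c1]]] := @split_count _ (mem I) (d j) b; first by rewrite c; clear; lia.
  by exists (s1, s2).
have cd2 j : count (mem I) (dd j).2 = b.
  have [_] := okps _ (dps j); have [-> c1] := hdd j; rewrite count_cat c1 mul2n -addnn => /eqP.
  by rewrite eqn_add2l => /eqP.
(* The path runs from [Y j] to [X j] within the piece; the linkage leads back from [X j] to
   [Y j]. *)
pose Y j := [set z in (dd j).1 | z \in I]; pose X j := [set z in (dd j).2 | z \in I].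
have YI j : Y j \subset I by apply/subsetP=> z; rewrite inE => /andP[].
have XI j : X j \subset I by apply/subsetP=> z; rewrite inE => /andP[].
have [u1 u2 u12] : [/\ forall j, uniq (dd j).1, forall j, uniq (dd j).2 &
    forall j z, z \in (dd j).1 -> z \in (dd j).2 -> False].
  have H j : [/\ uniq (dd j).1, ~~ has (mem (dd j).1) (dd j).2 & uniq (dd j).2].
    by apply/and3P; rewrite -cat_uniq; have [<- _] := hdd j.
  split=> j; try by case: (H j).
  by move=> z z1 z2; case: (H j) => _ /hasPn/(_ z z2); rewrite /= z1.
have cY j : #|Y j| = b by rewrite card_seq_set //; have [] := hdd j.
have cX j : #|X j| = b by rewrite card_seq_set.
have dXY j : [disjoint X j & Y j].
  apply/pred0P=> z /=; rewrite !inE; apply/negP=> /andP[/andP[z2 _] /andP[z1 _]].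
  exact: (u12 j z).
have sX j z : z \in X j -> z \in d j.
  by have [-> _] := hdd j; rewrite inE mem_cat => /andP[-> _]; rewrite orbT.
have sY j z : z \in Y j -> z \in d j.
  by have [-> _] := hdd j; rewrite inE mem_cat => /andP[-> _].
have YX j y z : y \in Y j -> z \in X j -> connect (induced e [set u in d j]) y z.
  rewrite !inE => /andP[yd _] /andP[zd _]; have [E _] := hdd j; rewrite E.
  by apply: connect_sorted => //; rewrite -E; case: (okps _ (dps j)).
have /fin_all_exists[Lt hLt] : forall j : J, exists Lt : {ffun T -> {set T}} * {ffun T -> T},
    linkage e (X j) (Y j) Lt.1 Lt.2.
  move=> j; have [|V [t [r dj]]] := wl (X j) (Y j) (XI j) (YI j); first by rewrite cX cY.
  exists ([ffun a => V a], [ffun a => t a]); split=> /=.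
    by move=> a /r; rewrite !ffunE.
  by move=> a a' h1 h2 h3; rewrite !ffunE; apply: dj.
have [[f [s [fX szs us dj]]]|[i [j [ij dense]]]] :=
  @disjoint_transversal_or_dense J T X b k (fun j => (Lt j).1) b0 cX (card_ord _); last first.
  constructor 3; exists (X i), (Y i), (X j), (Y j), (Lt i).1, (Lt j).1, (Lt i).2, (Lt j).2.
  split=> //.
    move=> A B sA sB; apply: wl.
      by apply: subset_trans sA _; rewrite !subUset !XI !YI.
    by apply: subset_trans sB _; rewrite !subUset !XI !YI.
  split=> //; apply/pred0P=> z /=; apply/negP=> /andP[zi zj]; apply: (djd i j z ij).
    by move: zi; rewrite in_setU => /orP[/sX|/sY].
  by move: zj; rewrite in_setU => /orP[/sX|/sY].
(* Each back path closes up with its piece. The pieces are disjoint, and so are the chosen back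
   paths, whence congestion two. *)
constructor 2; exists [seq [set u in d j] :|: (Lt j).1 (f j) | j <- s]; split.
- by rewrite size_map.
- apply/allP=> _ /mapP[j js ->]; have [r _] := hLt j; have [rj tY] := r _ (fX j).
  set Q := [set u in d j] :|: _; set a := f j in rj tY *; set y := (Lt j).2 a in rj tY.
  apply: (@cyclic_of_loop _ _ _ a).
  have ay : a != y.
    apply/eqP=> E; have /pred0P/(_ a) := dXY j; by rewrite /= fX E tY.
  apply: (@connect_plus_trans _ _ _ _ y).
    by apply: connect_neq_plus => //; apply: (@connect_induced_sub _ _ ((Lt j).1 a)); [exact: subsetUr | case: rj].
  by apply: (@connect_induced_sub _ _ [set u in d j]); [exact: subsetUl | exact: (YX j y a tY (fX j))].
move=> v; rewrite count_map.
apply: leq_trans (_ : count (fun j => v \in d j) s + count (fun j => v \in (Lt j).1 (f j)) s <= _).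
  by rewrite -count_predUI; apply: leq_trans (leq_addr _ _); apply: eq_leq; apply: eq_count => j /=; rewrite !inE.
have count1 (q : pred J) : (forall i j, i \in s -> j \in s -> q i -> q j -> i = j) -> count q s <= 1.
  move=> H; rewrite -size_filter.
  have uf : uniq (filter q s) by rewrite filter_uniq.
  have Hf i j : i \in filter q s -> j \in filter q s -> i = j.
    by rewrite !mem_filter => /andP[qi si] /andP[qj sj]; apply: H.
  case: (filter q s) uf Hf => [|i [|j l]] //= /andP[ni _] Hf.
  by rewrite (Hf i j) ?inE ?eqxx ?orbT in ni.
apply: (@leq_add _ _ 1 1); apply: count1 => i j si sj qi qj; apply/eqP; apply/negPn/negP=> ij.
  exact: (djd i j v).
by have /pred0P/(_ v) := dj i j si sj ij; rewrite /= qi qj.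
Qed.

(** * Congestion four: a closed system of four linkages *)

Section LinkageFacts.
Variables (T : finType) (e : rel T) (A B : {set T}) (V : T -> {set T}) (t : T -> T).
Hypothesis lk : linkage e A B V t.

Lemma linkage_end a : a \in A -> t a \in B.
Proof. by move=> aA; case: (lk.1 a aA). Qed.

Lemma linkage_route a : a \in A -> route e (V a) a (t a).
Proof. by move=> aA; case: (lk.1 a aA). Qed.

Lemma linkage_walk a : a \in A -> walk_set e (V a) a (t a).
Proof. by move=> aA; apply: walk_set_route; apply: linkage_route. Qed.

Lemma linkage_load (A' : {set T}) (g : T -> T) x :
  {in A' &, injective g} -> (forall a, a \in A' -> g a \in A) ->
  #|[set a in A' | x \in V (g a)]| <= 1.
Proof.
move=> gI gA; apply/card_le1_eqP=> a a'; rewrite !inE => /andP[aA xa] /andP[a'A xa'].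
apply/eqP/negPn/negP=> n; have {}n : g a != g a' by apply: contra n => /eqP/gI ->.
by have /pred0P/(_ x) := lk.2 _ _ (gA _ aA) (gA _ a'A) n; rewrite /= xa xa'.
Qed.
End LinkageFacts.

Lemma neq_of_disjoint (T : finType) (A B : {set T}) a b :
  [disjoint A & B] -> a \in A -> b \in B -> a != b.
Proof.
by move=> /pred0P d aA bB; apply/eqP=> ab; have := d a; rewrite /= aA ab bB.
Qed.

Lemma card_setU_pred (T : finType) (A : {set T}) (P Q : pred T) :
  #|[set a in A | P a || Q a]| <= #|[set a in A | P a]| + #|[set a in A | Q a]|.
Proof.
apply: leq_trans (leq_card_setU _ _); apply: subset_leq_card; apply/subsetP=> a.
by rewrite !inE => /andP[-> /orP[->|->]]; rewrite ?orbT.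
Qed.

Lemma card_sub_pred (T : finType) (A : {set T}) (P Q : pred T) :
  (forall a, a \in A -> P a -> Q a) -> #|[set a in A | P a]| <= #|[set a in A | Q a]|.
Proof.
move=> H; apply: subset_leq_card; apply/subsetP=> a; rewrite !inE => /andP[aA Pa].
by rewrite aA H.
Qed.

Lemma subpacking_packing (T : finType) (e : rel T) (A : {set T}) R k p :
  subpacking e A R k -> (forall x, #|[set a in A | x \in R a]| <= p) -> packing e k p.
Proof. by move=> [Qs [h1 h2 h3]] le; exists Qs; split=> // x; apply: leq_trans (h3 x) (le x). Qed.

(** The units run through [L], [S], [K] and [S'], from [X] to [Y] to [X'] to [Y'] and back to [X].
    The number of meetings exceeds [b * b / (2 * k)], which is at least the [200 * k * b] required
    by [closed_system_dense] because [b >= 400 * k ^ 2]. *)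
Theorem dense_pair_packing4 (T : finType) (e : rel T) k b X Y X' Y' L K t t' :
  0 < k -> 400 * k ^ 2 <= b -> dense_pair e k b X Y X' Y' L K t t' -> packing e k 4.
Proof.
move=> k0 kb [wl [cX cY cX' cY'] [dXY dXY' dXX'] [lL lK] dense].
have [sX sY sX' sY'] : [/\ X \subset X :|: Y :|: X' :|: Y', Y \subset X :|: Y :|: X' :|: Y',
    X' \subset X :|: Y :|: X' :|: Y' & Y' \subset X :|: Y :|: X' :|: Y'].
  by split; apply/subsetP=> z zz; rewrite !inE zz ?orbT.
have [|S [tS lS]] := wl Y X' sY sX'; first by rewrite cY.
have [|S' [tS' lS']] := wl Y' X sY' sX; first by rewrite cY'.
pose g a := tS (t a); pose m a := t' (g a); pose f a := tS' (m a).
have tY a : a \in X -> t a \in Y by apply: (linkage_end lL).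
have gX a : a \in X -> g a \in X' by move/tY; apply: (linkage_end lS).
have mY a : a \in X -> m a \in Y' by move/gX; apply: (linkage_end lK).
have fX a : a \in X -> f a \in X by move/mY; apply: (linkage_end lS').
have gI : {in X &, injective g}.
  by move=> a a' aX a'X /(linkage_inj lS (tY a aX) (tY a' a'X)); apply: (linkage_inj lL aX a'X).
have mI : {in X &, injective m}.
  by move=> a a' aX a'X /(linkage_inj lK (gX a aX) (gX a' a'X)); apply: gI.
have fI : {in X &, injective f}.
  by move=> a a' aX a'X /(linkage_inj lS' (mY a aX) (mY a' a'X)); apply: mI.
pose Q a := L a :|: S (t a) :|: K (g a).
pose R a := Q a :|: (S' (m a) :\ f a).
have wQ a : a \in X -> walk_set e (Q a) a (m a).
  move=> aX; apply: walk_set_cat (walk_set_cat (linkage_walk lL aX) (linkage_walk lS (tY a aX))) _.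
  exact: (linkage_walk lK (gX a aX)).
have rS a : a \in X -> route e (S' (m a)) (m a) (f a) by move/mY; apply: (linkage_route lS').
have dYX : [disjoint Y' & X].
  rewrite disjoint_sym; apply: disjointWl (disjointWr _ dXX'); [exact: subsetUl|exact: subsetUr].
have mf a : a \in X -> m a != f a.
  by move=> aX; apply: neq_of_disjoint dYX (mY a aX) (fX a aX).
have b0 : 0 < b by apply: leq_trans kb; rewrite muln_gt0 expn_gt0 k0.
apply: (@subpacking_packing _ _ X R).
  apply: (@closed_system_dense _ _ _ _ f) => //.
  - by move=> a aX; apply/set0Pn; exists a; rewrite inE; case: (wQ a aX) => ->.
  - move=> a aX; apply/forall_inP=> x xR; apply/forall_inP=> y yR.
    exact: link_units (wQ a aX) (rS a aX) (mf a aX) (wQ _ (fX a aX)) (rS _ (fX a aX)) x y xR yR.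
  - by rewrite cX.
  (* All of [X'] is reached, so every path of [K] belongs to a unit and each meeting of [L] with [K]
     is a meeting of units. *)
  have gim : g @: X = X'.
    apply/eqP; rewrite eqEcard card_in_imset // cX cX' leqnn andbT.
    by apply/subsetP=> _ /imsetP[a aX ->]; apply: gX.
  apply: leq_trans (_ : \sum_(a in X) \sum_(a' in X') ~~ [disjoint L a & K a'] <= _); last first.
    apply: leq_sum => a aX; rewrite -gim big_imset //=; apply: leq_sum => a' a'X.
    rewrite /meets; case: (boolP [disjoint R a & R a']) => dR; last by case: [disjoint _ & _].
    have -> // : [disjoint L a & K (g a')].
    apply: disjointWl (disjointWr _ dR); first by rewrite /R /Q -!setUA subsetUl.
    by apply/subsetP=> z zK; rewrite !inE zK !orbT.
  rewrite cX; move: dense kb k0 b0; set E := \sum_(a in X) _; clear; rewrite -mulnn; nia.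
move=> x.
apply: leq_trans (_ : #|[set a in X | [|| x \in L a, x \in S (t a), x \in K (g a) | x \in S' (m a)]]| <= _).
  apply: card_sub_pred => a aX; rewrite !inE.
  by case/orP=> [/orP[/orP[|]|]|/andP[_]] ->; rewrite ?orbT.
have l1 := @linkage_load _ _ _ _ _ _ lL X id x (in2W (@inj_id _)) (fun a h => h).
have l2 := linkage_load lS x (linkage_inj lL) tY.
have l3 := linkage_load lK x gI gX.
have l4 := linkage_load lS' x mI mY.
apply: leq_trans (card_setU_pred _ _ _) _; apply: (@leq_add _ _ 1 3) => //.
apply: leq_trans (card_setU_pred _ _ _) _; apply: (@leq_add _ _ 1 2) => //.
by apply: leq_trans (card_setU_pred _ _ _) _; apply: (@leq_add _ _ 1 1).
Qed.

(** * Congestion three: colouring a digraph of large minimum degree *)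

(** Vertices of degree below [d] are removed one by one; each removal destroys fewer than [d] edges,
    so the edges cannot run out. *)
Lemma min_degree_core (T : finType) (M : T -> T -> bool) d (X X' : {set T}) :
  d * (#|X| + #|X'|) < \sum_(a in X) \sum_(c in X') M a c ->
  exists A C : {set T}, [/\ A \subset X, C \subset X', A != set0,
    forall a, a \in A -> d <= \sum_(c in C) M a c & forall c, c \in C -> d <= \sum_(a in A) M a c].
Proof.
have [n] := ubnP (#|X| + #|X'|); elim: n X X' => // n IH X X' lt H.
case: (pickP [pred a in X | \sum_(c in X') M a c < d]) => [a /= /andP[aX low]|h1].
  have [||A [C [sA sC ne dA dC]]] := IH (X :\ a) X'.
  - by move: lt; rewrite (cardsD1 a X) aX; clear; lia.
  - move: H; rewrite (cardsD1 a X) aX (big_setD1 a aX) /=; move: low; clear; nia.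
  by exists A, C; split=> //; apply: subset_trans sA (subsetDl _ _).
case: (pickP [pred c in X' | \sum_(a in X) M a c < d]) => [c /= /andP[cX low]|h2].
  have [||A [C [sA sC ne dA dC]]] := IH X (X' :\ c).
  - by move: lt; rewrite (cardsD1 c X') cX; clear; lia.
  - move: H; rewrite (cardsD1 c X') cX exchange_big /= (big_setD1 c cX) /= exchange_big /=.
    by move: low; clear; nia.
  by exists A, C; split=> //; apply: subset_trans sC (subsetDl _ _).
exists X, X'; split=> //.
- by apply/eqP=> X0; move: H; rewrite X0 big_set0.
- by move=> a aX; have := h1 a; rewrite /= aX /= => /negbT; rewrite -leqNgt.
by move=> c cX; have := h2 c; rewrite /= cX /= => /negbT; rewrite -leqNgt.
Qed.

Lemma card_ffun_avoiding (U : finType) k (c : 'I_k) (N : {set U}) :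
  #|[set f : {ffun U -> 'I_k} | [forall u in N, f u != c]]| = k.-1 ^ #|N| * k ^ (#|U| - #|N|).
Proof.
pose F u : pred 'I_k := if u \in N then predC1 c else predT.
have -> : #|[set f : {ffun U -> 'I_k} | [forall u in N, f u != c]]| = #|family F|.
  apply: eq_card => f; rewrite inE; apply/forall_inP/familyP=> H u.
    by rewrite /F; case: (boolP (u \in N)) => // /H; rewrite !inE.
  by move=> uN; have := H u; rewrite /F uN.
rewrite card_family foldrE big_image /= (bigID (mem N)) /=.
rewrite (eq_bigr (fun=> k.-1)); last first.
  by move=> u uN; rewrite /F uN cardC1 card_ord.
rewrite prod_nat_const; congr (_ * _).
rewrite (eq_bigr (fun=> k)); last first.
  by move=> u uN; rewrite /F (negPf uN) card_ord.
rewrite prod_nat_const; congr (_ ^ _); rewrite -(cardsC N) addKn.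
by apply: eq_card => u; rewrite !inE.
Qed.

(* Union bound over a uniformly random colouring. *)
Lemma colouring_meeting_all (U : finType) k d (A : {set U}) (N : U -> {set U}) :
  (forall a, a \in A -> d <= #|N a|) -> #|A| * k * k.-1 ^ d < k ^ d -> 0 < k ->
  exists f : U -> 'I_k, forall a c, a \in A -> exists2 u, u \in N a & f u = c.
Proof.
move=> dN lt k0.
pose bad (p : U * 'I_k) := [set f : {ffun U -> 'I_k} | [forall u in N p.1, f u != p.2]].
have bad_le p : p.1 \in A -> k ^ d * #|bad p| <= k.-1 ^ d * k ^ #|U|.
  move=> pA; rewrite /bad card_ffun_avoiding; have le := dN _ pA; have leU := max_card (mem (N p.1)).
  set n := #|N p.1| - d; set w := #|U| - #|N p.1|.
  have -> : #|N p.1| = d + n by rewrite subnKC.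
  have -> : #|U| = d + n + w by rewrite /n subnKC // subnKC.
  rewrite !expnD [X in X <= _](_ : _ = k ^ d * k.-1 ^ d * k ^ w * k.-1 ^ n); last by clear; lia.
  rewrite [X in _ <= X](_ : _ = k ^ d * k.-1 ^ d * k ^ w * k ^ n); last by clear; lia.
  by rewrite leq_mul2l; apply/orP; right; case: (n) => // n'; rewrite leq_exp2r // leq_pred.
pose allbad := \bigcup_(p in setX A [set: 'I_k]) bad p.
have cle : k ^ d * #|allbad| <= #|A| * k * (k.-1 ^ d * k ^ #|U|).
  apply: leq_trans (_ : k ^ d * (\sum_(p in setX A [set: 'I_k]) #|bad p|) <= _).
    rewrite leq_mul2l; apply/orP; right; rewrite /allbad.
    elim/big_rec2: _ => [|p n S _ le]; first by rewrite cards0.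
    by apply: leq_trans (leq_card_setU _ _) _; rewrite leq_add2l.
  have -> : #|A| * k = #|setX A [set: 'I_k]| by rewrite cardsX cardsT card_ord.
  rewrite big_distrr /= -sum_nat_const; apply: leq_sum => p; rewrite !inE => /andP[pA _].
  exact: bad_le.
have ltall : #|allbad| < #|{: {ffun U -> 'I_k}}|.
  rewrite card_ffun card_ord; have kd : 0 < k ^ d by rewrite expn_gt0 k0.
  rewrite -(ltn_pmul2l kd); apply: leq_ltn_trans cle _.
  by rewrite mulnA ltn_pmul2r // expn_gt0 k0.
have : [exists f : {ffun U -> 'I_k}, f \notin allbad].
  rewrite -negb_forall; apply: contraL ltall => /forallP H; rewrite -leqNgt.
  by apply: subset_leq_card; apply/subsetP=> f _; apply: H.
case/existsP=> f nf; exists f => a c aA.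
have : f \notin bad (a, c).
  by apply: contra nf => fb; apply/bigcupP; exists (a, c); rewrite // !inE aA.
by rewrite inE => /forall_inPn[u uN]; rewrite negbK => /eqP; exists u.
Qed.

(** Bernoulli's inequality for [(1 + 1 / x) ^ n], at [n = x + 1]. *)
Lemma expn_succ_ge2 x : 0 < x -> 2 * x ^ x.+1 <= x.+1 ^ x.+1.
Proof.
move=> x0; have bern n : x ^ n * (x + n) <= x * x.+1 ^ n.
  by elim: n => [|n IH]; rewrite ?expn0 ?addn0 ?mul1n ?muln1 // !expnS; nia.
rewrite -(leq_pmul2l x0); apply: leq_trans (bern x.+1).
by set p := x ^ x.+1; clear; nia.
Qed.

(** The factor [(1 - 1 / k) ^ (32 * k ^ 2)] is at most [2 ^ (- 32 * k)], whereas
    [n * k <= 128 * k ^ 4 <= 2 ^ (7 + 4 * k)]. *)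
Lemma colouring_bound k n : 0 < k -> n <= 128 * k ^ 3 -> n * k * k.-1 ^ (32 * k ^ 2) < k ^ (32 * k ^ 2).
Proof.
case: k => // [[|x]] _ le; first by rewrite exp0n // muln0 exp1n.
set k := x.+2 in le *; rewrite /= -/k.
have -> : 32 * k ^ 2 = k * (32 * k) by rewrite -mulnn; clear; lia.
rewrite !(expnM _ k); have h : 2 * x.+1 ^ k <= k ^ k by apply: expn_succ_ge2.
have h2 : 2 ^ (32 * k) * (x.+1 ^ k) ^ (32 * k) <= (k ^ k) ^ (32 * k).
  by rewrite -expnMn leq_exp2r.
apply: leq_trans h2; rewrite ltn_pmul2r ?expn_gt0 //.
have kl : k <= 2 ^ k by apply: ltnW; apply: ltn_expl.
apply: leq_ltn_trans (_ : 128 * (2 ^ k) ^ 4 < _).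
  apply: leq_trans (_ : 128 * k ^ 3 * k <= _); first by rewrite leq_mul2r le orbT.
  by rewrite -mulnA -expnSr leq_mul2l leq_exp2r.
rewrite -expnM (_ : 128 = 2 ^ 7) // -expnD ltn_exp2l //; rewrite /k; clear; lia.
Qed.

(** Units are indexed by [A0], with an arc from [a] to [a'] when the [K]-path of [a] meets the
    [L]-path of [a']. If every unit has out-neighbours of all [k] colours, or every unit has
    in-neighbours of all colours, each colour class contains a cycle. The classes share no unit, and
    a unit consists of three paths. *)
Theorem dense_pair_packing3 (T : finType) (e : rel T) k b X Y X' Y' L K t t' :
  0 < k -> b = 128 * k ^ 3 -> dense_pair e k b X Y X' Y' L K t t' -> packing e k 3.
Proof.
move=> k0 bE [wl [cX cY cX' cY'] [dXY dXY' dXX'] [lL lK] dense].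
pose d := 32 * k ^ 2.
pose M a c := ~~ [disjoint L a & K c].
(* There are more than [b * b / (2 * k) = 2 * d * b] meeting pairs. *)
have [|A [C [sA sC neA dA dC]]] := @min_degree_core T M d X X'.
  rewrite cX cX'; move: dense k0; rewrite bE -/(M _ _) /d.
  set E := \sum_(a in X) _; rewrite !expnS expn0; clear; nia.
(* Both sides are cut to the smaller of the two sizes, so that they can be linked perfectly; the
   smaller side is kept whole. *)
have [A0 sA0 cA0] := take_set (geq_minl #|A| #|C|).
have [C0 sC0 cC0] := take_set (geq_minr #|A| #|C|).
have sA0X : A0 \subset X := subset_trans sA0 sA.
have sC0X : C0 \subset X' := subset_trans sC0 sC.
have A0X a : a \in A0 -> a \in X by apply: subsetP.
have tI : {in A0 &, injective t} by move=> a a' /A0X h /A0X h'; apply: (linkage_inj lL).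
have [|||S [tS lS]] := wl (t @: A0) C0.
- apply/subsetP=> _ /imsetP[a /A0X aX ->]; by rewrite !inE (linkage_end lL aX) ?orbT.
- by apply/subsetP=> c /(subsetP sC0X) cc; rewrite !inE cc !orbT.
- by rewrite card_in_imset // cA0 cC0.
have tA a : a \in A0 -> t a \in t @: A0 by move=> aA; apply: imset_f.
pose g a := tS (t a).
have gC a : a \in A0 -> g a \in C0 by move/tA; apply: (linkage_end lS).
have gI : {in A0 &, injective g}.
  by move=> a a' aA a'A /(linkage_inj lS (tA a aA) (tA a' a'A)); apply: tI.
have gX a : a \in A0 -> g a \in X' by move/gC; apply: subsetP.
have gim : g @: A0 = C0.
  apply/eqP; rewrite eqEcard card_in_imset // cA0 cC0 leqnn andbT.
  by apply/subsetP=> _ /imsetP[a aX ->]; apply: gC.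
pose Q a := L a :|: S (t a) :|: K (g a).
have nA0 : #|A0| <= 128 * k ^ 3 by rewrite -bE -cX subset_leq_card.
have sumE (B : {set T}) (P : pred T) : \sum_(a in B) P a = #|[set a in B | P a]|.
  rewrite -sum1_card [RHS](eq_bigl (fun a => (a \in B) && P a)) => [|a]; last by rewrite inE.
  by rewrite big_mkcondr; apply: eq_bigr => a _; case: (P a).
have dYX : [disjoint Y & X'] by apply: disjointWl (disjointWr _ dXX'); [exact: subsetUr | exact: subsetUl].
have step (B : {set T}) a a' : a \in A0 -> a' \in A0 -> a \in B -> a' \in B -> M a' (g a) ->
    connect_plus e (\bigcup_(z in B) Q z) (g a) (g a').
  move=> aA a'A aB a'B /pred0Pn[x /andP[/= xL xK]].
  have sB z : z \in B -> Q z \subset \bigcup_(z in B) Q z by move=> zB; apply: (bigcup_sup z).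
  have sK z : z \in B -> K (g z) \subset \bigcup_(z in B) Q z.
    by move=> zB; apply: subset_trans (sB z zB); apply: subsetUr.
  have sL z : z \in B -> L z \subset \bigcup_(z in B) Q z.
    by move=> zB; apply: subset_trans (sB z zB); rewrite /Q -setUA subsetUl.
  have sS z : z \in B -> S (t z) \subset \bigcup_(z in B) Q z.
    by move=> zB; apply: subset_trans (sB z zB); rewrite /Q setUAC subsetUr.
  have wK := linkage_walk lK (gX a aA); have wL := linkage_walk lL (A0X a' a'A).
  have wS := linkage_walk lS (tA a' a'A).
  apply: (@connect_connect_plus _ _ _ _ x); first exact: connect_induced_sub (sK a aB) (wK.2 x xK).1.
  apply: (@connect_connect_plus _ _ _ _ (t a')); first exact: connect_induced_sub (sL a' a'B) (wL.2 x xL).2.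
  apply: connect_neq_plus; first exact: connect_induced_sub (sS a' a'B) (wS.2 _ wS.1).2.
  exact: neq_of_disjoint dYX (linkage_end lL (A0X a' a'A)) (gX a' a'A).
suff [f cyc] : exists f : T -> 'I_k, forall c, cyclic e (\bigcup_(a in [set a in A0 | f a == c]) Q a).
  exists [seq \bigcup_(a in [set a in A0 | f a == c]) Q a | c <- enum 'I_k]; split.
  - by rewrite size_map size_enum_ord.
  - by apply/allP=> _ /mapP[c _ ->].
  move=> x; rewrite count_map.
  apply: leq_trans (_ : #|[set a in A0 | x \in Q a]| <= _).
    rewrite -sumE (partition_big f xpredT) //= -sum1_count.
    rewrite [X in X <= _]big_mkcond /= [X in X <= _]big_enum /=; apply: leq_sum => c _ /=.
    case: (boolP (x \in _)) => // /bigcupP[a]; rewrite inE => aA xQ.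
    by rewrite (bigD1 a) //= xQ.
  apply: leq_trans (_ : #|[set a in A0 | [|| x \in L a, x \in S (t a) | x \in K (g a)]]| <= _).
    by apply: card_sub_pred => a _; rewrite !inE orbA.
  have l1 := @linkage_load _ _ _ _ _ _ lL A0 id x (in2W (@inj_id _)) A0X.
  have l2 := linkage_load lS x tI tA.
  have l3 := linkage_load lK x gI gX.
  apply: leq_trans (card_setU_pred _ _ _) _; apply: (@leq_add _ _ 1 2) => //.
  by apply: leq_trans (card_setU_pred _ _ _) _; apply: (@leq_add _ _ 1 1).
have /set0Pn[a0 a0A] : A0 != set0.
  rewrite -card_gt0 cA0 leq_min card_gt0 neA /=.
  case/set0Pn: neA => a aA; have := dA a aA; rewrite sumE => h.
  have d0 : 0 < d by rewrite muln_gt0 expn_gt0 k0.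
  have sub : [set c in C | M a c] \subset C by apply/subsetP=> c; rewrite inE => /andP[].
  exact: leq_trans d0 (leq_trans h (subset_leq_card sub)).
(* If [A0 = A], the degrees of the vertices of [C] survive and bound the out-degrees from below; if
   [C0 = C], the degrees of the vertices of [A] bound the in-degrees. *)
have [le|lt] := leqP #|A| #|C|.
  have A0E : A0 = A by apply/eqP; rewrite eqEcard sA0 cA0 (minn_idPl le) leqnn.
  have [|f fP] := @colouring_meeting_all T k d A0 (fun a => [set a' in A0 | M a' (g a)]) _ (colouring_bound k0 nA0) k0.
    move=> a aA; rewrite -sumE A0E; apply: dC; apply: (subsetP sC0); exact: gC.
  exists f => c; have [u0] := fP a0 c a0A; rewrite inE => /andP[u0A _] fu0.
  apply: (@cyclic_of_connect_plus _ _ _ (g @: [set a in A0 | f a == c]) (g u0)).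
    by apply: imset_f; rewrite inE u0A fu0 eqxx.
  move=> _ /imsetP[a aS ->]; have := aS; rewrite inE => /andP[aA fa].
  have [u] := fP a c aA; rewrite inE => /andP[uA Mu] fu.
  have uS : u \in [set a in A0 | f a == c] by rewrite inE uA fu eqxx.
  by exists (g u); [apply: imset_f | apply: step].
have C0E : C0 = C by apply/eqP; rewrite eqEcard sC0 cC0 (minn_idPr (ltnW lt)) leqnn.
have [|f fP] := @colouring_meeting_all T k d A0 (fun a => [set a' in A0 | M a (g a')]) _ (colouring_bound k0 nA0) k0.
  move=> a aA; rewrite -sumE.
  have -> : \sum_(a' in A0) M a (g a') = \sum_(c in C) M a c by rewrite -C0E -gim big_imset.
  by apply: dA; apply: (subsetP sA0).
exists f => c; have [u0] := fP a0 c a0A; rewrite inE => /andP[u0A _] fu0.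
apply: (@cyclic_of_predecessors _ _ _ (g @: [set a in A0 | f a == c]) (g u0)).
  by apply: imset_f; rewrite inE u0A fu0 eqxx.
move=> _ /imsetP[a aS ->]; have := aS; rewrite inE => /andP[aA fa].
have [u] := fP a c aA; rewrite inE => /andP[uA Mu] fu.
have uS : u \in [set a in A0 | f a == c] by rewrite inE uA fu eqxx.
by exists (g u); [apply: imset_f | apply: step].
Qed.

(** * Congestion two: colouring the intervals of two closed systems *)

Lemma degenerate_colouring (E : eqType) (M : rel E) D (s : seq E) : symmetric M -> uniq s ->
  (exists s', [/\ uniq s', {subset s' <= s}, s' != [::] &
     D * size s' <= \sum_(c <- s') \sum_(d <- s') M c d]) \/
  (exists col : E -> nat, (forall c, c \in s -> col c < D) /\
     (forall c d, c \in s -> d \in s -> c != d -> M c d -> col c != col d)).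
Proof.
move=> Ms; have [n] := ubnP (size s); elim: n s => // n IH s lt us.
have [s0|sn] := eqVneq s [::]; first by right; exists (fun=> 0); rewrite s0.
have [/allP H|] := boolP (all (fun c => D <= \sum_(d <- s) M c d) s).
  left; exists s; split=> //; rewrite mulnC -sum1_size big_distrl /= big_seq [X in _ <= X]big_seq.
  by apply: leq_sum => c cs; rewrite mul1n H.
case/allPn=> c cs; rewrite -ltnNge => low.
have sub : {subset rem c s <= s} by move=> d /mem_rem.
have [||[s' [h1 h2 h3 h4]]|[col [cD cP]]] := IH (rem c s).
- by rewrite size_rem //; move: lt; case: (s) sn => //= a l _; rewrite ltnS.
- exact: rem_uniq.
- by left; exists s'; split=> // d /h2/sub.
right; pose nb := [seq col d | d <- rem c s & M c d].
have szn : size nb < D.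
  rewrite size_map size_filter; apply: leq_ltn_trans low.
  rewrite -sum1_count big_mkcond (big_rem c cs) /=; apply: leq_trans (leq_addl _ _).
  by apply: leq_sum => d _; case: (M c d).
have [i iD ni] : exists2 i, i < D & i \notin nb.
  have : ~~ all (mem nb) (iota 0 D).
    apply: contraL szn => /allP sub'; rewrite -leqNgt -{1}(size_iota 0 D).
    by apply: uniq_leq_size; [exact: iota_uniq | exact: sub'].
  by case/allPn=> i; rewrite mem_iota add0n /= => iD ni; exists i.
have inrem d : d \in s -> d != c -> d \in rem c s.
  by move=> ds dc; rewrite mem_rem_uniq // !inE dc.
exists (fun d => if d == c then i else col d); split.
  by move=> d ds; case: (eqVneq d c) => // dc; apply: cD; apply: inrem.
have aux d : d \in s -> d != c -> M c d -> i != col d.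
  move=> ds dc Mcd; apply: contraNneq ni => ->; apply: map_f.
  by rewrite mem_filter Mcd inrem.
move=> a d as' ds ad Mad; case: (eqVneq a c) => [ac|ac]; case: (eqVneq d c) => [dc|dc].
- by rewrite ac dc eqxx in ad.
- by apply: aux => //; rewrite -ac.
- by rewrite eq_sym; apply: aux => //; rewrite Ms -dc.
by apply: cP => //; apply: inrem.
Qed.

Lemma span_cat (T : finType) (U : eqType) (R : U -> {set T}) c d :
  span R (c ++ d) = span R c :|: span R d.
Proof. by apply/setP=> x; rewrite inE !mem_span has_cat. Qed.

Lemma sorted_link_span (T : finType) (e : rel T) (U : eqType) (R : U -> {set T}) cs :
  sorted (link e R) (flatten cs) -> (forall u, u \in flatten cs -> R u != set0) ->
  sorted (link e (span R)) cs.
Proof.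
elim: cs => // c [|d cs] IH //= srt ne; apply/andP; split; last first.
  apply: IH; first by case/cat_sorted2: srt.
  by move=> u uc; apply: ne; rewrite mem_cat uc orbT.
apply/forall_inP=> x; rewrite mem_span => /hasP[u uc xu].
apply/forall_inP=> y; rewrite mem_span => /hasP[v vd yv].
rewrite -span_cat; rewrite catA in srt; have [scd _] := cat_sorted2 srt.
apply: (connect_plus_chain scd) xu yv.
  by move=> w; rewrite mem_cat => /orP[] h; apply: ne; rewrite !mem_cat h ?orbT.
by apply: (@cat_subseq _ [:: u] [:: v] c d); rewrite sub1seq.
Qed.

(* The units [R a] are the paths of [L], each followed by a path of a return
   linkage. *)
Lemma chunk_system (T : finType) (e : rel T) (I X Y : {set T}) L t k q :
  0 < k -> 0 < q -> well_linked e I -> X \subset I -> Y \subset I -> #|X| = #|Y| ->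
  [disjoint X & Y] -> linkage e X Y L t ->
  packing e k 2 \/
  exists (R : T -> {set T}) (cs : seq (seq T)) (col : seq T -> nat),
    [/\ [/\ forall a, a \in X -> L a \subset R a, uniq (flatten cs), uniq cs &
          forall a, (a \in flatten cs) = (a \in X)],
        forall c, c \in cs -> [/\ c != [::], sorted (link e R) c & size c <= q + 1],
        forall a, a \in X -> R a != set0,
        size cs * q <= #|X| + k * q &
        (forall c, c \in cs -> col c < 200 * k) /\
        (forall c d, c \in cs -> d \in cs -> c != d -> col c = col d ->
           [disjoint span R c & span R d])].
Proof.
move=> k0 q0 wl sX sY cXY dXY lL.
have [|V [tV lV]] := wl Y X sY sX; first by rewrite cXY.
have tY a : a \in X -> t a \in Y by apply: (linkage_end lL).
pose f a := tV (t a).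
have fX a : a \in X -> f a \in X by move/tY; apply: (linkage_end lV).
have tI : {in X &, injective t} := linkage_inj lL.
have fI : {in X &, injective f}.
  by move=> a a' aX a'X /(linkage_inj lV (tY a aX) (tY a' a'X)); apply: tI.
pose R a := L a :|: (V (t a) :\ f a).
have wL a : a \in X -> walk_set e (L a) a (t a) by apply: (linkage_walk lL).
have rV a : a \in X -> route e (V (t a)) (t a) (f a) by move/tY; apply: (linkage_route lV).
have neR a : a \in X -> R a != set0.
  by move=> aX; apply/set0Pn; exists a; rewrite inE; case: (wL a aX) => ->.
have lkR a : a \in X -> link e R a (f a).
  move=> aX; apply/forall_inP=> x xR; apply/forall_inP=> y yR.
  have tf : t a != f a by rewrite eq_sym; apply: neq_of_disjoint dXY (fX a aX) (tY a aX).
  exact: link_units (wL a aX) (rV a aX) tf (wL _ (fX a aX)) (rV _ (fX a aX)) x y xR yR.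
have load x : #|[set a in X | x \in R a]| <= 2.
  apply: leq_trans (_ : #|[set a in X | (x \in L a) || (x \in V (t a))]| <= _).
    by apply: card_sub_pred => a aX; rewrite !inE => /orP[->|/andP[_ ->]]; rewrite ?orbT.
  have l1 := @linkage_load _ _ _ _ _ _ lL X id x (in2W (@inj_id _)) (fun a h => h).
  have l2 := linkage_load lV x tI tY.
  by apply: leq_trans (card_setU_pred _ _ _) _; apply: (@leq_add _ _ 1 1).
have [sub|[chains [un memX srt szc]]] := closed_system_chains k fI fX neR lkR.
  by left; apply: subpacking_packing sub load.
have [|css [fl ok sz]] := @split_chains _ (link e R) (fun=> 1) 1 q chains _ srt; first by [].
pose cs := flatten css.
have fcs : flatten cs = flatten chains by rewrite /cs flatten_flatten fl.
have ucs : uniq cs by apply: uniq_of_flatten; [rewrite fcs | move=> d /ok[]].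
have mcs a : (a \in flatten cs) = (a \in X) by rewrite fcs memX.
have incs c a : c \in cs -> a \in c -> a \in X.
  by move=> cc ac; rewrite -mcs; apply/flattenP; exists c.
have szX : size (flatten chains) = #|X|.
  by rewrite -(card_uniqP un); apply: eq_card => a; rewrite memX.
have nespan c : c \in cs -> span R c != set0.
  move=> cc; have [] := ok c cc; case: c cc => // a c cc _ _ _.
  have aX := incs _ _ cc (mem_head a c).
  have /set0Pn[x xa] := neR a aX; apply/set0Pn; exists x; rewrite mem_span; apply/hasP.
  by exists a; rewrite ?mem_head.
have msym : symmetric (meets (span R)) by move=> c d; rewrite /meets disjoint_sym.
(* A set [s'] of intervals with average degree at least [200 * k] in the intersection graph is dense
   enough for [dense_packing], with the intervals as units and [s'] marked; otherwise [200 * k]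
   colours suffice. *)
have [[s' [us' sub' ne' dense]]|[col [cD cP]]] := degenerate_colouring (200 * k) msym ucs.
  left; have pf : perm_eq (filter (mem s') cs) s'.
    apply: uniq_perm => //; first exact: filter_uniq.
    by move=> c; rewrite mem_filter andb_idr //; apply: sub'.
  have cW : count (mem s') cs = size s' by rewrite -size_filter (perm_size pf).
  have szcss : size css = size chains by rewrite -fl size_map.
  have [|||||||Qs [h1 h2 h3]] := @dense_packing _ e _ (span R) css (mem s') k.
  - exact: ucs.
  - exact: nespan.
  - apply/allP=> l lcss; apply: sorted_link_span.
      by apply: (allP srt); rewrite -fl map_f.
    move=> u ul; apply: neR; rewrite -memX -fl; apply/flattenP; exists (flatten l) => //.
    exact: map_f.
  - by rewrite szcss ltnW.
  - exact: k0.
  - by rewrite -/cs cW lt0n size_eq0.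
  - rewrite -/cs cW; apply: leq_trans dense _; rewrite /crossings -[X in _ <= X]big_filter [X in _ <= X](perm_big _ pf) /=.
    by apply: leq_sum => c _; rewrite -[X in _ <= X]big_filter [X in _ <= X](perm_big _ pf).
  exists Qs; split=> // x; apply: leq_trans (h3 x) _; rewrite -/cs.
  apply: leq_trans (load x); rewrite -(count_flatten_card _ un memX) -fcs [X in _ <= X]count_flatten_sum.
  rewrite -[X in X <= _]sum1_count [X in X <= _]big_mkcond /=; apply: leq_sum => c _.
  by have := count_span_le R x c; case: (_ \in _).
right; exists R, cs, col; split=> //.
- by split=> //; [move=> a _; apply: subsetUl | rewrite fcs].
- move=> c /ok[h1 h2 h3]; split=> //; move: h3; by rewrite sum_const_seq count_predT muln1.
- move: sz; rewrite -/cs sum_const_seq count_predT muln1 szX => sz.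
  by apply: leq_trans sz _; rewrite leq_add2l leq_mul2r ltnW ?orbT.
split=> // c d cc dc cd E; apply/negPn/negP=> m.
by have := cP c d cc dc cd m; rewrite E eqxx.
Qed.

(** Fix a colour in each system: intervals of equal colour are disjoint, so [k] disjoint good pairs
    with these colours have congestion two. If no two colours provide them, there are at most
    [k * D * n] good pairs, with [n] the number of intervals, and [L] and [K] have too few
    meetings. *)
Theorem dense_pair_packing2 (T : finType) (e : rel T) k b X Y X' Y' L K t t' :
  0 < k -> b = 240 * 250 * k ^ 4 -> dense_pair e k b X Y X' Y' L K t t' -> packing e k 2.
Proof.
move=> k0 bE [wl [cX cY cX' cY'] [dXY dXY' dXX'] [lL lK] dense].
have [sX sY sX' sY'] : [/\ X \subset X :|: Y :|: X' :|: Y', Y \subset X :|: Y :|: X' :|: Y',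
    X' \subset X :|: Y :|: X' :|: Y' & Y' \subset X :|: Y :|: X' :|: Y'].
  by split; apply/subsetP=> z zz; rewrite !inE zz ?orbT.
have q0 : 0 < 16 * k by rewrite muln_gt0.
have [//|[R [cs [col [[LR un ucs memX] ok ne sz [cD cP]]]]]] :=
  chunk_system k0 q0 wl sX sY (etrans cX (esym cY)) dXY lL.
have [//|[R' [cs' [col' [[LR' un' ucs' memX'] ok' ne' sz' [cD' cP']]]]]] :=
  chunk_system k0 q0 wl sX' sY' (etrans cX' (esym cY')) dXY' lK.
pose D := 200 * k.
pose good (p : seq T * seq T) := cyclic e (span R p.1 :|: span R' p.2).
pose N c c' := \sum_(a <- c) \sum_(a' <- c') ~~ [disjoint R a & R' a'].
pose P al be := [seq p <- [seq (c, c') | c <- cs, c' <- cs'] | [&& good p, col p.1 == al & col' p.2 == be]].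
pose n1 al := count (fun c => col c == al) cs; pose n2 be := count (fun c => col' c == be) cs'.
have inP al be p : (p \in P al be) = [&& p.1 \in cs, p.2 \in cs', good p, col p.1 == al & col' p.2 == be].
  rewrite mem_filter andbC; case: p => c c' /=.
  have -> : ((c, c') \in [seq (c, c') | c <- cs, c' <- cs']) = (c \in cs) && (c' \in cs').
    by apply/allpairsP/andP=> [[[a a'] /= [h1 h2 [-> ->]]]|[h1 h2]] //; exists (c, c').
  by rewrite -andbA.
have uP al be : uniq (P al be).
  by rewrite filter_uniq // allpairs_uniq // => -[? ?] [? ?].
case: (pickP [pred p : 'I_D * 'I_D | k * (n1 p.1 + n2 p.2) < size (P p.1 p.2)]) => [[al be] /= lt|small].
  pose clash (p q : seq T * seq T) := (p.1 == q.1) || (p.2 == q.2).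
  have [[S [szS subS pwS]]|[S [szS subS cov]]] := greedy_selection (P al be) clash k; last first.
    exfalso; move: lt; rewrite ltnNge => /negP[].
    (* Each good pair shares its first or its second interval with one of the fewer than [k]
       selected pairs, which leaves at most [k * (n1 al + n2 be)] possibilities. *)
    pose cov1 := [seq (p.1, c') | p <- S, c' <- [seq c' <- cs' | col' c' == be]].
    pose cov2 := [seq (c, p.2) | p <- S, c <- [seq c <- cs | col c == al]].
    apply: leq_trans (_ : size (cov1 ++ cov2) <= _).
      apply: uniq_leq_size => // -[c c']; rewrite inP /= => /and5P[h1 h2 h3 h4 h5].
      have /hasP[q qS] : has (clash (c, c')) S by apply: cov; rewrite inP /= h1 h2 h3 h4.
      rewrite /clash mem_cat /= => /orP[/eqP->|/eqP->].
        apply/orP; left; apply/allpairsP; exists (q, c'); split=> //.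
        by rewrite mem_filter h5.
      apply/orP; right; apply/allpairsP; exists (q, c); split=> //.
      by rewrite mem_filter h4.
    rewrite size_cat !size_allpairs !size_filter -/(n1 al) -/(n2 be) -mulnDr [n2 _ + _]addnC.
    by rewrite leq_mul2r ltnW ?orbT.
  have pwd : forall p q, p \in S -> q \in S -> p != q -> ~~ clash p q.
    elim: S pwS {szS subS} => //= p S IH /andP[/allP np pw] a c.
    rewrite !inE => /predU1P[->|aS] /predU1P[->|cS] ac.
    - by rewrite eqxx in ac.
    - exact: np.
    - by rewrite /clash eq_sym [X in _ || X]eq_sym; apply: np.
    exact: IH.
  have uS : uniq S.
    elim: S pwS {szS subS pwd} => //= p S IH /andP[/allP np pw]; rewrite IH // andbT.
    by apply/negP=> /np; rewrite /clash eqxx.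
  exists [seq span R p.1 :|: span R' p.2 | p <- S]; split.
  - by rewrite size_map.
  - by apply/allP=> _ /mapP[p /subS + ->]; rewrite inP => /and5P[].
  move=> x; rewrite count_map.
  apply: leq_trans (_ : count (fun p => x \in span R p.1) S + count (fun p => x \in span R' p.2) S <= _).
    rewrite -count_predUI; apply: leq_trans (leq_addr _ _); apply: eq_leq; apply: eq_count => p /=.
    by rewrite !inE.
  have count1 (h : pred (seq T * seq T)) : (forall p q, p \in S -> q \in S -> p != q -> h p -> h q -> False) -> count h S <= 1.
    move=> H; rewrite -size_filter.
    have uf : uniq (filter h S) by rewrite filter_uniq.
    have Hf p q : p \in filter h S -> q \in filter h S -> p = q.
      rewrite !mem_filter => /andP[hp pS] /andP[hq qS]; apply/eqP/negPn/negP=> pq.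
      exact: (H p q).
    case: (filter h S) uf Hf => [|p [|q l]] //= /andP[np _] Hf.
    by rewrite (Hf p q) ?inE ?eqxx ?orbT in np.
  apply: (@leq_add _ _ 1 1); apply: count1 => p q pS qS pq xp xq; have := pwd p q pS qS pq.
    rewrite negb_or => /andP[n1' _].
    move: (subS _ pS) (subS _ qS); rewrite !inP => /and5P[p1 _ _ /eqP cp _] /and5P[q1 _ _ /eqP cq _].
    have /pred0P/(_ x) := cP _ _ p1 q1 n1' (etrans cp (esym cq)); by rewrite /= xp xq.
  rewrite negb_or => /andP[_ n2'].
  move: (subS _ pS) (subS _ qS); rewrite !inP => /and5P[_ p2 _ _ /eqP cp] /and5P[_ q2 _ _ /eqP cq].
  have /pred0P/(_ x) := cP' _ _ p2 q2 n2' (etrans cp (esym cq)); by rewrite /= xp xq.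
exfalso.
have sumX (F : T -> nat) : \sum_(a <- flatten cs) F a = \sum_(a in X) F a.
  rewrite -[RHS]big_enum; apply: perm_big; apply: uniq_perm => //; first exact: enum_uniq.
  by move=> a; rewrite memX mem_enum.
have sumX' (F : T -> nat) : \sum_(a <- flatten cs') F a = \sum_(a in X') F a.
  rewrite -[RHS]big_enum; apply: perm_big; apply: uniq_perm => //; first exact: enum_uniq.
  by move=> a; rewrite memX' mem_enum.
have szsum : \sum_(c <- cs) size c = b.
  have := sumX (fun=> 1); rewrite sum1_size sum1_card cX size_flatten sumnE big_map => <- //.
have szsum' : \sum_(c <- cs') size c = b.
  have := sumX' (fun=> 1); rewrite sum1_size sum1_card cX' size_flatten sumnE big_map => <- //.
pose E := \sum_(a in X) \sum_(a' in X') ~~ [disjoint L a & K a'].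
have EN : E <= \sum_(c <- cs) \sum_(c' <- cs') N c c'.
  apply: leq_trans (_ : \sum_(a in X) \sum_(a' in X') ~~ [disjoint R a & R' a'] <= _).
    apply: leq_sum => a aX; apply: leq_sum => a' aX'.
    case: (boolP [disjoint R a & R' a']) => dR; last by case: [disjoint _ & _].
    have -> // : [disjoint L a & K a'].
    by apply: disjointWl (disjointWr _ dR); [apply: LR | apply: LR'].
  rewrite -sumX big_flatten; apply: leq_sum => c _.
  rewrite /N [X in _ <= X]exchange_big /=; apply: leq_sum => a _.
  by rewrite -sumX' big_flatten.
have incs c a : c \in cs -> a \in c -> a \in X.
  by move=> cc ac; rewrite -memX; apply/flattenP; exists c.
have incs' c a : c \in cs' -> a \in c -> a \in X'.
  by move=> cc ac; rewrite -memX'; apply/flattenP; exists c.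
(* Intervals have at most [16 * k + 1] units, so [w] bounds the meetings in a good pair; other pairs
   are bounded by [sum_staircase]. *)
pose w := (16 * k + 1) * (16 * k + 1).
have Nle c c' : c \in cs -> c' \in cs' -> N c c' <= (size c + size c') + good (c, c') * w.
  move=> cc cc'; have [_ s1 z1] := ok c cc; have [_ s2 z2] := ok' c' cc'.
  have [g|bad] := boolP (good (c, c')).
    apply: leq_trans (leq_addl _ _); rewrite mul1n.
    apply: leq_trans (_ : size c * size c' <= _); last exact: leq_mul.
    rewrite /N -[size c]count_predT -sum_const_seq; apply: leq_sum => a _.
    by rewrite -[size c']sum1_size; apply: leq_sum => a' _; case: [disjoint _ & _].
  rewrite mul0n addn0; apply: sum_staircase => x x' y y' sx sy mx my; case/negP: bad.
  apply: (@cyclic_inversion _ _ _ _ _ _ _ _ x x' y y') => // a.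
    by move/(incs _ _ cc)/ne.
  by move/(incs' _ _ cc')/ne'.
pose G := \sum_(c <- cs) \sum_(c' <- cs') good (c, c').
have EG : E <= b * (size cs + size cs') + w * G.
  apply: leq_trans EN _.
  apply: leq_trans (_ : \sum_(c <- cs) \sum_(c' <- cs') ((size c + size c') + w * good (c, c')) <= _).
    rewrite big_seq [X in _ <= X]big_seq; apply: leq_sum => c cc.
    rewrite big_seq [X in _ <= X]big_seq; apply: leq_sum => c' cc'.
    by rewrite [w * _]mulnC; apply: Nle.
  apply: eq_leq; rewrite /G.
  have -> : \sum_(c <- cs) \sum_(c' <- cs') ((size c + size c') + w * good (c, c')) =
     \sum_(c <- cs) (size cs' * size c + b + w * \sum_(c' <- cs') good (c, c')).
    apply: eq_bigr => c _; rewrite big_split big_split /= sum_const_seq count_predT szsum'.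
    by rewrite -big_distrr.
  rewrite big_split big_split /= -!big_distrr /= sum_const_seq count_predT szsum; congr (_ + _).
  by rewrite -mulnDl mulnC [in LHS]addnC.
have GP : G <= \sum_(al < D) \sum_(be < D) size (P al be).
  have -> : G = count good [seq (c, c') | c <- cs, c' <- cs'].
    rewrite -sum1_count big_mkcond big_allpairs_dep /=; apply: eq_bigr => c _; apply: eq_bigr => c' _.
    by case: (good _).
  have -> : \sum_(al < D) \sum_(be < D) size (P al be) =
     \sum_(p <- [seq (c, c') | c <- cs, c' <- cs']) \sum_(al < D) \sum_(be < D)
        [&& good p, col p.1 == al & col' p.2 == be].
    rewrite [RHS]exchange_big /=; apply: eq_bigr => al _; rewrite [RHS]exchange_big /=.
    apply: eq_bigr => be _; rewrite /P size_filter -sum1_count big_mkcond /=.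
    by apply: eq_bigr => p _; case: ifP.
  rewrite -sum1_count big_mkcond /= big_seq [X in _ <= X]big_seq; apply: leq_sum => p.
  case/allpairsP=> -[c c'] /= [cc cc' ->] /=; case: (boolP (good _)) => // g.
  rewrite (bigD1 (Ordinal (cD c cc))) //= (bigD1 (Ordinal (cD' c' cc'))) //= !eqxx /=.
  by rewrite -addnA leq_addr.
have n1sum : \sum_(al < D) n1 al <= size cs.
  rewrite /n1; under eq_bigr do rewrite -sum1_count big_mkcond /=.
  rewrite exchange_big /= -[X in _ <= X]sum1_size big_seq [X in _ <= X]big_seq; apply: leq_sum => c cc.
  rewrite (bigD1 (Ordinal (cD c cc))) //= eqxx big1 // => i /negPf ni.
  by case: eqP => // h; case/negP: (negbT ni); apply/eqP/val_inj.
have n2sum : \sum_(be < D) n2 be <= size cs'.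
  rewrite /n2; under eq_bigr do rewrite -sum1_count big_mkcond /=.
  rewrite exchange_big /= -[X in _ <= X]sum1_size big_seq [X in _ <= X]big_seq; apply: leq_sum => c cc.
  rewrite (bigD1 (Ordinal (cD' c cc))) //= eqxx big1 // => i /negPf ni.
  by case: eqP => // h; case/negP: (negbT ni); apply/eqP/val_inj.
have GD : G <= k * D * (size cs + size cs').
  apply: leq_trans GP _.
  apply: leq_trans (_ : \sum_(al < D) \sum_(be < D) k * (n1 al + n2 be) <= _).
    apply: leq_sum => al _; apply: leq_sum => be _.
    by have := small (al, be); rewrite /= => /negbT; rewrite -leqNgt.
  have -> : \sum_(al < D) \sum_(be < D) k * (n1 al + n2 be) =
    k * (D * \sum_(al < D) n1 al + D * \sum_(be < D) n2 be).
    rewrite big_distrr [D * \sum_(be < D) n2 be](_ : _ = \sum_(al < D) \sum_(be < D) n2 be); last first.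
      by rewrite sum_nat_const card_ord.
    rewrite -big_split big_distrr /=; apply: eq_bigr => al _.
    by rewrite -big_distrr /= big_split /= sum_nat_const card_ord.
  by move: n1sum n2sum; clear; nia.
rewrite cX in sz; rewrite cX' in sz'.
move: dense; rewrite -/E.
(* As [w <= 289 * k ^ 2] and [D = 200 * k], the left side is at most [57800 * k ^ 4], which [b]
   exceeds. Then [E <= 2 * b * n] and [16 * k * n <= 4 * b], against [b * b < 2 * k * E]. *)
have wk : w * (k * D) <= b.
  rewrite bE /w /D !expnS expn0; move: k0; clear; nia.
have b16 : 16 * (k * k) <= b.
  by rewrite bE !expnS expn0; move: k0; clear; nia.
have E2 : E <= 2 * b * (size cs + size cs').
  apply: leq_trans EG _; move: GD wk; set n := size cs + size cs'; clear; nia.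
have n16 : 16 * k * (size cs + size cs') <= 2 * b + 32 * (k * k).
  by move: sz sz'; clear; nia.
move: E2 n16 b16; clear; set n := size cs + size cs'; nia.
Qed.

(** * Assembling the three bounds *)

Lemma dtw_le_mono (T : finType) (e : rel T) w w' : w <= w' -> dtw_le e w -> dtw_le e w'.
Proof.
move=> le [T0|[N [r [par [X [W [h1 [h2 [h3 [h4 [h5 [h6 h7]]]]]]]]]]]]; first by left.
right; exists N, r, par, X, W; do 6!(split; first by []).
by move=> t; apply: leq_trans (h7 t) _.
Qed.

Theorem theorem4 :
  exists C2 C3 C4 : nat, [/\ 0 < C2, 0 < C3, 0 < C4 &
    forall (k : nat) (T : finType) (e : rel T), 0 < k ->
      [/\ (~ has_cycle_family e k 4 -> dtw_le e (C4 * k ^ 3)),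
          (~ has_cycle_family e k 3 -> dtw_le e (C3 * k ^ 4)) &
          (~ has_cycle_family e k 2 -> dtw_le e (C2 * k ^ 5))]].
Proof.
(* The bound [24 * k * b + 2] is used with [b] equal to [240 * 250 * k ^ 4], [128 * k ^ 3] and
   [400 * k ^ 2]; the summand 2 is absorbed because the powers of [k] are positive. *)
exists (24 * (240 * 250) + 2), (24 * 128 + 2), (24 * 400 + 2).
split; try by rewrite addn2.
move=> k T e k0.
have main b p : 1 < p -> 0 < b -> (forall X Y X' Y' L K t t', dense_pair e k b X Y X' Y' L K t t' -> packing e k p) ->
    ~ has_cycle_family e k p -> dtw_le e (24 * k * b + 2).
  move=> p1 b0 H no; have [//|pk|[X [Y [X' [Y' [L [K [t [t' dp]]]]]]]]] := dtw_le_or_dense_pair e k b0.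
    case: no; apply: packing_has_cycle_family; case: pk => Qs [h1 h2 h3]; exists Qs; split=> // v.
    exact: leq_trans (h3 v) p1.
  by case: no; apply: packing_has_cycle_family; apply: H dp.
have kp n : 0 < k ^ n by rewrite expn_gt0 k0.
split=> no.
- apply: dtw_le_mono (main (400 * k ^ 2) 4 _ _ _ no) => //.
  + by move: (kp 3); rewrite !expnS expn0; clear; nia.
  + by rewrite muln_gt0 kp.
  + by move=> X Y X' Y' L K t t'; apply: dense_pair_packing4.
- apply: dtw_le_mono (main (128 * k ^ 3) 3 _ _ _ no) => //.
  + by move: (kp 4); rewrite !expnS expn0; clear; nia.
  + by rewrite muln_gt0 kp.
  + by move=> X Y X' Y' L K t t'; apply: dense_pair_packing3.
apply: dtw_le_mono (main (240 * 250 * k ^ 4) 2 _ _ _ no) => //.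
+ by move: (kp 5); rewrite !expnS expn0; clear; nia.
+ by rewrite muln_gt0 kp andbT muln_gt0.
by move=> X Y X' Y' L K t t'; apply: dense_pair_packing2.
Qed.
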